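(* Let $(G,H)$ be a $b$-Lie group with Lie algebra $\mathfrak{h}$ of $H$, and let $\theta\in{}^b\Omega^1(G;\mathfrak{h})$ be a principal $H$-$b$-connection for $\pi:G\to G/H$. Then $({}^bT^*G)/H$ has an induced Poisson structure inherited, through the diffeomorphism $$[\psi_\theta]:({}^bT^*G)/H\to\mathcal{H}^\circ\times_H\mathfrak{h}^*,$$ from the $b$-coadjoint bundle $\mathcal{H}^\circ\times_H\mathfrak{h}^*$. That is: there is a Poisson structure on $\mathcal{H}^\circ\times_H\mathfrak{h}^*=(\mathcal{H}^\circ\times\mathfrak{h}^* )/H$ for which the quotient map $\mathcal{H}^\circ\times\mathfrak{h}^*\to\mathcal{H}^\circ\times_H\mathfrak{h}^*$ is a Poisson map, where $\mathcal{H}^\circ\times\mathfrak{h}^*$ carries the Poisson structure dual to the $b$-symplectic form $(\psi_\theta)_*\omega_G=\overline\pi^*\omega_{G/H}-d\lambda^\theta$, and its pull-back by $[\psi_\theta]$ is a Poisson structure on $({}^bT^*G)/H$.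
   Context: A $b$-manifold is a pair $(M,Z)$ with $M$ an oriented manifold and $Z\subset M$ an oriented (embedded) hypersurface, called the critical hypersurface. A $b$-vector field is a vector field on $M$ tangent to $Z$ at every point of $Z$. If $f$ is a local defining function for $Z$ and $(f,z_2,\dots,z_n)$ is a chart, the $b$-vector fields form a free module with basis $f\,\partial/\partial f,\partial/\partial z_2,\dots,\partial/\partial z_n$; the vector bundle whose sections are the $b$-vector fields is the $b$-tangent bundle ${}^bTM$. Its dual is the $b$-cotangent bundle ${}^bT^*M$, and $b$-forms of degree $k$ are sections of $\Lambda^k({}^bT^*M)$, denoted ${}^b\Omega^k(M)$; ${}^b\Omega^k(M;E)$ denotes $b$-forms with values in a vector space $E$. Writing a $b$-form locally as $\alpha\wedge\frac{df}{f}+\beta$ with $\alpha,\beta$ smooth forms, its exterior derivative is $d\alpha\wedge\frac{df}{f}+d\beta$. Smooth maps between $b$-manifolds which are $b$-maps (transverse to the target hypersurface, with preimage of the target hypersurface equal to the source hypersurface) induce bundle maps of $b$-tangent bundles, and pull back $b$-forms to $b$-forms. A $b$-symplectic form is a closed $b$-form of degree 2 of maximal rank in $\Lambda^2({}^bT_p^*M)$ at every $p$; its inverse is a section of $\Lambda^2({}^bTM)$ and, viewed as a smooth bivector field on $M$, is the dual Poisson structure. For a $b$-manifold $(M,Z)$, ${}^bT^*M$ is a $b$-manifold with critical hypersurface ${}^bT^*M|_Z$. The $b$-Liouville form $\lambda_M\in{}^b\Omega^1({}^bT^*M)$ is $\langle(\lambda_M)_p,v\rangle=\langle p,\tau_*v\rangle$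 for $p\in{}^bT^*M$, $v\in{}^bT_p({}^bT^*M)$, with $\tau:{}^bT^*M\to M$ the projection; the canonical $b$-symplectic form is $\omega_M=-d\lambda_M$. A $b$-Lie group is a $b$-manifold $(G,H)$ where $G$ is a Lie group and $H\subset G$ is a closed codimension one subgroup. $H$ acts on $G$ by left translations $L_h$ ($h\in H$), which are $b$-maps, and on ${}^bT^*G$ by the lift $(h,\alpha_g)\mapsto(L_{h^{-1}})^*\alpha_g$; $G/H$ denotes the space of orbits $Hg$, and $\pi:G\to G/H$ is a principal $H$-bundle. $G/H$ is viewed as a one-dimensional $b$-manifold whose critical hypersurface is the point $[e]$, so that $\pi$ is a $b$-map with induced $\pi_*:{}^bTG\to{}^bT(G/H)$. $\zeta_g(X)=\zeta_g^X=\frac{d}{dt}\big|_{t=0}(e^{tX}g)$ for $g\in G$, $X\in\mathfrak{h}$; for fixed $X$ it is a vector field tangent to $H$, hence a section of ${}^bTG$. $\mathcal{H}\subset{}^bTG$ is the vertical subbundle with fibre $\mathcal{H}_g=(R_g)_*\mathfrak{h}=\zeta_g(\mathfrak{h})$, and $\mathcal{H}^\circ\subset{}^bT^*G$ is its annihilator, a $b$-manifold with critical hypersurface $\mathcal{H}^\circ|_H$. $\tau_G^*:{}^bT^*G\to G$ is the projection, and $\overline\pi:\mathcal{H}^\circ\to{}^bT^*(G/H)$ is defined by $(\overline\pi\alpha_g)(\pi_*v_g)=\alpha_gv_g$ for $\alpha_g\in\mathcal{H}_g^\circ$, $v_g\in{}^bT_gG$; it is a principal $H$-bundle. A principal $H$-$b$-connection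 for $\pi$ is a $\theta\in{}^b\Omega^1(G;\mathfrak{h})$ with $\theta(\zeta_g^X)=X$ and $\theta((L_h)_*v)=\mathrm{Ad}_h(\theta(v))$ for all $g\in G$, $X\in\mathfrak{h}$, $h\in H$, $v\in{}^bTG$. It determines the diffeomorphism $\psi_\theta:{}^bT^*G\to\mathcal{H}^\circ\times\mathfrak{h}^*$, $\alpha_g\mapsto(\alpha_g-\alpha_g\circ\zeta_g\circ\theta_g,\ \alpha_g\circ\zeta_g)$, which is $H$-equivariant for the lifted action on ${}^bT^*G$ and the diagonal action $(h,(\beta,\mu))\mapsto((L_{h^{-1}})^*\beta,\mu\circ\mathrm{Ad}_{h^{-1}})$ on $\mathcal{H}^\circ\times\mathfrak{h}^*$. The form $\lambda^\theta$ is the $b$-form of degree 1 on $\mathcal{H}^\circ\times\mathfrak{h}^*$ given by $\lambda^\theta_{(\alpha,\mu)}(w,\phi)=\mu\bigl(((\tau_G^*|_{\mathcal{H}^\circ})^*\theta)w\bigr)$, and $\overline\pi^*\omega_{G/H}$ is regarded as a form on $\mathcal{H}^\circ\times\mathfrak{h}^*$ via the projection to $\mathcal{H}^\circ$. The $b$-coadjoint bundle is $\mathcal{H}^\circ\times_H\mathfrak{h}^*:=(\mathcal{H}^\circ\times\mathfrak{h}^* )/H\to{}^bT^*(G/H)$, the bundle associated to $\overline\pi:\mathcal{H}^\circ\to{}^bT^*(G/H)$ and the coadjoint representation of $H$ on $\mathfrak{h}^*$. $[\psi_\theta]$ is the diffeomorphism of quotients induced by $\psi_\theta$. *)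

(* Defs.v *)
From HB Require Import structures.
From mathcomp Require Import all_boot all_order all_algebra.
From mathcomp Require Import all_classical all_reals all_analysis.
Import Order.TTheory GRing.Theory Num.Theory.
Import numFieldNormedType.Exports.
Set Implicit Arguments.
Unset Strict Implicit.
Unset Printing Implicit Defensive.
Local Open Scope classical_set_scope.
Local Open Scope ring_scope.

(* A space is a set of points together with its algebra of smooth functions
   (a Sikorski differential space); a manifold is a space that is locally
   diffeomorphic to R^m (Hausdorff, second countable).  On manifolds this is
   the usual category, and submanifolds, products, bundles and quotients by
   principal actions carry the usual structures.
   The field [crit] is the critical hypersurface. *)

Section Smooth.
Context {R : realType}.

Definition unitv m (i : 'I_m) : 'rV[R]_m := delta_mx 0 i.

Fixpoint Ck m (k : nat) (f : 'rV[R]_m -> R) : Prop :=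
  if k is k'.+1 then
    continuous f /\
    forall i, (forall v, derivable f v (unitv i)) /\
              Ck k' (fun v => 'D_(unitv i) f v)
  else continuous f.

Definition smooth m (f : 'rV[R]_m -> R) : Prop := forall k, Ck k f.

(* functions that are locally smooth functions of finitely many elements of
   F0, where "locally" refers to the initial topology of F0 *)
Definition gen (T : Type) (F0 : set (T -> R)) : set (T -> R) :=
  [set f | forall x, exists m (g : 'I_m -> T -> R) (phi : 'rV[R]_m -> R) (eps : R),
     [/\ 0 < eps, forall i, F0 (g i), smooth phi &
         forall y, (forall i, `|g i y - g i x| < eps) ->
                   f y = phi (\row_i g i y)]].

End Smooth.

Record bspace (R : realType) := BSpace {
  pt :> Type;
  cinf : set (pt -> R);
  crit : set pt }.
Arguments BSpace {R}.
Arguments cinf {R}.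
Arguments crit {R}.

Section Spaces.
Context {R : realType}.
Implicit Types M N : bspace R.

Definition bopen M (U : set M) : Prop :=
  forall x, U x -> exists2 f, cinf M f & f x != 0 /\ forall y, f y != 0 -> U y.

Definition smooth_map M N (phi : M -> N) : Prop :=
  forall f, cinf N f -> cinf M (f \o phi).

Definition diffeo M N (phi : M -> N) (psi : N -> M) : Prop :=
  [/\ smooth_map phi, smooth_map psi, cancel phi psi & cancel psi phi].

Definition subspace M (A : set M) : bspace R :=
  BSpace {x : M | A x}
    (gen [set F | exists2 f, cinf M f & F = fun x => f (sval x)])
    [set x | crit M (sval x)].

Definition prodspace M N : bspace R :=
  BSpace (M * N)%type
    (gen [set F | (exists2 f, cinf M f & F = fun x => f x.1) \/
                  (exists2 f, cinf N f & F = fun x => f x.2)])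
    [set x | crit M x.1 \/ crit N x.2].

(* The quotient by an equivalence relation E; its points are the classes. *)
Definition quotspace_pt M (E : M -> M -> Prop) : Type :=
  {S : set M | exists x, S = [set y | E x y]}.

Definition qmap M (E : M -> M -> Prop) (x : M) : quotspace_pt E :=
  exist _ [set y | E x y] (ex_intro _ x erefl).

Definition quotspace M (E : M -> M -> Prop) : bspace R :=
  BSpace (quotspace_pt E)
    [set f : quotspace_pt E -> R | cinf M (fun x => f (qmap E x))]
    (qmap E @` crit M).

(** Manifolds and b-manifolds *)

Record chart (m : nat) M := Chart {
  cdom : set M;
  coord : M -> 'rV[R]_m;
  param : 'rV[R]_m -> M }.

(* the open set [cdom k] is diffeomorphic to R^m through [coord k], with
   inverse [param k]; [coord k] is irrelevant outside [cdom k] *)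
Definition is_chart m M (k : chart m M) : Prop :=
  [/\ bopen (cdom k),
      (forall v, cdom k (param k v)) /\ cancel (param k) (coord k),
      forall x, cdom k x -> param k (coord k x) = x,
      forall i x, cdom k x -> exists2 f, cinf M f &
        exists2 V, bopen V /\ V x & forall y, V y -> coord k y 0 i = f y
    & forall f, cinf M f -> smooth (f \o param k)].

Definition manifold m M : Prop :=
  [/\ forall f, gen (cinf M) f -> cinf M f,
      forall x y, x <> y -> exists2 f, cinf M f & f x <> f y,
      exists2 B : nat -> set M, (forall i, bopen (B i)) &
        forall U x, bopen U -> U x -> exists i, B i x /\ B i `<=` U
    & forall x, exists k : chart m M, is_chart k /\ cdom k x].

Definition oriented m M : Prop :=
  exists A : set (chart m M),
  [/\ A `<=` @is_chart m M,
      forall x, exists2 k, A k & cdom k x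
    & forall k k' v, A k -> A k' -> cdom k' (param k v) ->
        0 < \det (\matrix_(i < m, j < m)
                    'D_(unitv j) (fun w => coord k' (param k w) 0 i) v)].

Definition hypersurface n M (Z : set M) : Prop :=
  forall x, Z x -> exists k : chart n.+1 M,
    [/\ is_chart k, cdom k x
      & forall y, cdom k y -> (Z y <-> coord k y 0 ord0 = 0)].

Definition bmanifold n M : Prop :=
  [/\ manifold n.+1 M, oriented n.+1 M, bopen (~` crit M),
      hypersurface n (crit M) & oriented n (subspace (crit M))].

(** b-vector fields *)

(* A vector field is a derivation of [cinf M].  It is extended by 0 to
   non-smooth functions, so that equality of vector fields is [=]. *)
Definition op M : Type := (M -> R) -> M -> R.

Definition bvf M (V : op M) : Prop :=
  [/\ forall f, cinf M f -> cinf M (V f),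
      forall (a : R) f g, cinf M f -> cinf M g ->
        V (fun x => a * f x + g x) = (fun x => a * V f x + V g x),
      forall f g, cinf M f -> cinf M g ->
        V (fun x => f x * g x) = (fun x => V f x * g x + f x * V g x),
      forall f, ~ cinf M f -> V f = (fun=> 0)
    & forall f, cinf M f -> (forall z, crit M z -> f z = 0) ->
        forall z, crit M z -> V f z = 0].

Definition op_comb M (f : M -> R) (V W : op M) : op M :=
  fun h x => f x * V h x + W h x.

Definition lieb M (V W : op M) : op M :=
  fun h x => V (W h) x - W (V h) x.

(* The fibre of the b-tangent bundle at p is bX(M) / I_p bX(M), where bX(M) is
   the module of b-vector fields and I_p the ideal of functions vanishing at p.
   Its linear dual, the fibre of the b-cotangent bundle, consists of the
   functionals on bX(M) that are linear over evaluation at p. *)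
Definition is_covec M (p : M) (a : op M -> R) : Prop :=
  (forall f V W, cinf M f -> bvf V -> bvf W ->
     a (op_comb f V W) = f p * a V + a W) /\
  (forall V, ~ bvf V -> a V = 0).

Record covec M := Covec {
  base : M;
  cv : op M -> R;
  _ : is_covec base cv }.

Definition bcot M : bspace R :=
  BSpace (covec M)
    (gen [set F | (exists2 f, cinf M f & F = fun a => f (base a)) \/
                  (exists2 V, bvf V & F = fun a => cv a V)])
    [set a | crit M (base a)].

(* [bpush phi p V W]: the map induced by the b-map phi on b-tangent spaces
   sends the class of V at p to the class of W at phi p.  Near p (where u is
   nonzero) the section phi_* V of the pull-back of the b-tangent bundle of N
   is a combination of pulled back b-vector fields, with value W at p. *)
Definition bpush M N (phi : M -> N) (p : M) (V : op M) (W : op N) : Prop :=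
  [/\ bvf V, bvf W &
  exists (u : M -> R) k (c : 'I_k -> M -> R) (Y : 'I_k -> op N),
  [/\ cinf M u /\ u p = 1,
      forall i, cinf M (c i) /\ c i p = 0,
      forall i, bvf (Y i)
    & forall f, cinf N f -> forall x,
        u x * V (f \o phi) x =
        u x * W f (phi x) + \sum_(i < k) c i x * Y i f (phi x)]].

(** b-forms of degrees 1 and 2, evaluated on b-vector fields *)

Definition form1 M : Type := op M -> M -> R.
Definition form2 M : Type := op M -> op M -> M -> R.

Definition is_form2 M (w : form2 M) : Prop :=
  [/\ forall V W, bvf V -> bvf W -> cinf M (w V W),
      forall V W, bvf V -> bvf W -> w V W = (fun x => - w W V x)
    & forall f V V' W, cinf M f -> bvf V -> bvf V' -> bvf W ->
        w (op_comb f V V') W = (fun x => f x * w V W x + w V' W x)].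

Definition eq_form2 M (w w' : form2 M) : Prop :=
  forall V W, bvf V -> bvf W -> w V W = w' V W.

(* [xget] picks the unique value of the pull-back at the given point *)
Definition pull2 M N (phi : M -> N) (w : form2 N) : form2 M :=
  fun V V' p => xget 0 [set r | exists W W',
    [/\ bpush phi p V W, bpush phi p V' W' & r = w W W' (phi p)]].

(* Exterior derivatives by the invariant (Koszul) formula.  Off the critical
   hypersurface this is the usual d; since d(df/f) = 0 and that complement is
   dense, it sends a /\ df/f + b to da /\ df/f + db. *)
Definition d1 M (l : form1 M) : form2 M :=
  fun V W x => V (l W) x - W (l V) x - l (lieb V W) x.

Definition d2 M (w : form2 M) (V1 V2 V3 : op M) (x : M) : R :=
  V1 (w V2 V3) x + V2 (w V3 V1) x + V3 (w V1 V2) x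
  - w (lieb V1 V2) V3 x - w (lieb V2 V3) V1 x - w (lieb V3 V1) V2 x.

Definition bsymplectic M (w : form2 M) : Prop :=
  [/\ is_form2 w,
      forall V1 V2 V3, bvf V1 -> bvf V2 -> bvf V3 ->
        d2 w V1 V2 V3 = (fun=> 0)
    & forall p V, bvf V -> (forall W, bvf W -> w V W p = 0) ->
        forall a : covec M, base a = p -> cv a V = 0].

Definition liouville M : form1 (bcot M) :=
  fun V p => xget 0 [set r |
    exists2 W, bpush (@base M : bcot M -> M) p V W & r = cv p W].
Arguments liouville : clear implicits.

Definition omega_can M : form2 (bcot M) :=
  fun V W x => - d1 (liouville M) V W x.

(** Poisson structures, as brackets on smooth functions *)

Definition bracket M : Type := (M -> R) -> (M -> R) -> M -> R.

Definition poisson M (br : bracket M) : Prop :=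
  [/\ forall f g, cinf M f -> cinf M g -> cinf M (br f g),
      forall (a : R) f g h, cinf M f -> cinf M g -> cinf M h ->
        br (fun x => a * f x + g x) h = (fun x => a * br f h x + br g h x),
      forall f g, cinf M f -> cinf M g -> br f g = (fun x => - br g f x),
      forall f g h, cinf M f -> cinf M g -> cinf M h ->
        br (fun x => f x * g x) h = (fun x => br f h x * g x + f x * br g h x)
    & forall f g h, cinf M f -> cinf M g -> cinf M h -> forall x,
        br f (br g h) x + br g (br h f) x + br h (br f g) x = 0].

(* Sign convention: with i_(X_f) w = df the bracket is w (X_f, X_g), hence
   {q, p} = 1 for w = dq /\ dp = - d (p dq). *)
Definition dual_poisson M (w : form2 M) (br : bracket M) : Prop :=
  forall f g, cinf M f -> cinf M g -> exists X Y,
    [/\ bvf X, bvf Y,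
        forall V, bvf V -> w X V = V f,
        forall V, bvf V -> w Y V = V g
      & br f g = w X Y].

Definition poisson_map M N (phi : M -> N) (brM : bracket M) (brN : bracket N)
    : Prop :=
  forall f g, cinf N f -> cinf N g ->
    brM (f \o phi) (g \o phi) = brN f g \o phi.

Definition pull_bracket M N (phi : M -> N) (phi' : N -> M) (br : bracket N)
    : bracket M :=
  fun f g => br (f \o phi') (g \o phi') \o phi.

End Spaces.
Arguments omega_can {R} M.

(** b-Lie groups *)

Section BLie.
Context {R : realType}.
Variables (G : groupType) (C : set (G -> R)) (H : set G).

Definition gspace : bspace R := BSpace G C H.

Definition blie_group (n : nat) : Prop :=
  [/\ bmanifold n gspace,
      smooth_map (fun x : prodspace gspace gspace => (x.1 * x.2)%g : gspace),
      smooth_map (fun x : gspace => (x^-1)%g : gspace)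
    & [/\ H 1%g, forall x y, H x -> H y -> H (x * y)%g
        & forall x, H x -> H (x^-1)%g]].

(* The Lie algebra of H is the tangent space at 1 of H, i.e. the point
   derivations of [C] at 1 killing the functions that vanish on H, again
   extended by 0 to non-smooth functions. *)
Definition tvec : Type := (G -> R) -> R.

Definition lieH (X : tvec) : Prop :=
  [/\ forall (a : R) f g, C f -> C g ->
        X (fun x => a * f x + g x) = a * X f + X g,
      forall f g, C f -> C g ->
        X (fun x => f x * g x) = X f * g 1%g + f 1%g * X g,
      forall f, ~ C f -> X f = 0
    & forall f, C f -> (forall h, H h -> f h = 0) -> X f = 0].

Definition tcomb (a : R) (X Y : tvec) : tvec := fun f => a * X f + Y f.

Definition Ad (h : G) (X : tvec) : tvec :=
  fun f => X (fun k => f (h * k * h^-1)%g).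

(* d/dt f (exp(tX) g) at t = 0, i.e. (R_g)_* X *)
Definition zeta (X : tvec) : op gspace := fun f g => X (fun k => f (k * g)%g).

(* (L_h)_* V *)
Definition Lpush (h : G) (V : op gspace) : op gspace :=
  fun f g => V (fun k => f (h * k)%g) (h^-1 * g)%g.

Record dualH := DualH {
  ev : tvec -> R;
  _ : (forall a X Y, lieH X -> lieH Y ->
         ev (tcomb a X Y) = a * ev X + ev Y) /\
      (forall X, ~ lieH X -> ev X = 0) }.

Definition dualHspace : bspace R :=
  BSpace dualH (gen [set F | exists2 X, lieH X & F = fun mu => ev mu X]) set0.

(** The orbit space G/H (of left translations) and its projection *)

Definition orbG (g g' : gspace) : Prop := exists2 h, H h & g' = (h * g)%g.
Definition GmodH : bspace R := quotspace orbG.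
Definition piG : gspace -> GmodH := qmap orbG.

(** The annihilator of the vertical bundle, and the map it has to the
    b-cotangent bundle of G/H *)

Definition vann (a : bcot gspace) : Prop :=
  forall X, lieH X -> cv a (zeta X) = 0.
Definition Hann : bspace R := subspace vann.
Definition tauH : Hann -> gspace := fun b => base (sval b).

Definition is_pibar (pibar : Hann -> bcot GmodH) : Prop :=
  forall b, base (pibar b) = piG (tauH b) /\
    forall V W, bpush piG (tauH b) V W -> cv (pibar b) W = cv (sval b) V.

(** The product of the annihilator with the dual of the Lie algebra of H *)

Definition Pspace : bspace R := prodspace Hann dualHspace.
Definition prP : Pspace -> Hann := fun x => x.1.

(** Actions of H, and the orbit spaces *)

(* a' = (L_(h^-1))^* a *)
Definition cact (h : G) (a a' : bcot gspace) : Prop :=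
  base a' = (h * base a)%g /\ forall V, cv a' V = cv a (Lpush h^-1%g V).

Definition pact (h : G) (x x' : Pspace) : Prop :=
  cact h (sval x.1) (sval x'.1) /\
  forall X, ev x'.2 X = ev x.2 (Ad h^-1%g X).

Definition orbT (a a' : bcot gspace) : Prop := exists2 h, H h & cact h a a'.
Definition orbP (x x' : Pspace) : Prop := exists2 h, H h & pact h x x'.

Definition TmodH : bspace R := quotspace orbT.
Definition coadj_bundle : bspace R := quotspace orbP.
Definition qT : bcot gspace -> TmodH := qmap orbT.
Definition qP : Pspace -> coadj_bundle := qmap orbP.

(** Principal connections *)

Definition hform1 : Type := op gspace -> G -> tvec.

Definition bconnection (theta : hform1) : Prop :=
  [/\ forall V g, bvf V -> lieH (theta V g),
      forall (mu : dualH) V, bvf V -> C (fun g => ev mu (theta V g)),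
      forall (f : gspace -> R) V W g, C f -> bvf V -> bvf W ->
        theta (op_comb f V W) g = tcomb (f g) (theta V g) (theta W g),
      forall X g, lieH X -> theta (zeta X) g = X
    & forall h V g, H h -> bvf V ->
        theta (Lpush h V) (h * g)%g = Ad h (theta V g)].

Definition is_psi (theta : hform1) (psi : bcot gspace -> Pspace) : Prop :=
  forall a,
  [/\ base (sval (psi a).1) = base a,
      forall V, bvf V ->
        cv (sval (psi a).1) V = cv a V - cv a (zeta (theta V (base a)))
    & forall X, lieH X -> ev (psi a).2 X = cv a (zeta X)].

Definition lambda_theta (theta : hform1) : form1 Pspace :=
  fun V x => xget 0 [set r | exists W U,
    [/\ bpush prP x V W, bpush tauH (prP x) W U
      & r = ev x.2 (theta U (tauH (prP x)))]].

Definition omega_theta (theta : hform1) (pibar : Hann -> bcot GmodH)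
    : form2 Pspace :=
  fun V W x => pull2 prP (pull2 pibar (omega_can GmodH)) V W x
               - d1 (lambda_theta theta) V W x.

End BLie.

(* Main.v *)
Require Import Defs.
From mathcomp Require Import all_boot all_order all_algebra.
From mathcomp Require Import all_classical all_reals all_analysis.
From mathcomp Require Import ring lra.
Import Order.TTheory GRing.Theory Num.Theory.
Import numFieldNormedType.Exports.
Set Implicit Arguments.
Unset Strict Implicit.
Unset Printing Implicit Defensive.
Local Open Scope classical_set_scope.
Local Open Scope ring_scope.

(* Near g0 the orbits of H are the levels of an H-invariant function: a curve s
   transverse to H at 1 makes (h, t) |-> h s(t) g0 a local diffeomorphism, by the
   implicit function theorem.  This gives charts of G and of G/H with the same
   coordinate c_0, and the b-frame e_0 = c_0 d/dc_0, e_1, ..., e_n of such a chart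
   of G has e_1, ..., e_n vertical and e_0 projecting to the b-frame of G/H.
   Hence an element b of the annihilator is determined by its base point and by
   P(b) = b(e_0), and pibar sends P to the fibre coordinate of bcot (G/H).
   Writing eps_i for the coframe dual to the e_i, the Liouville form of bcot G is
   the sum of the P_i eps_i, where P_i(a) = a(e_i).  Since psi' (b, mu) is
   b + mu o theta, it is carried to P eps_0 + lambda^theta, while the Liouville
   form of bcot (G/H) pulls back to P eps_0; applying d gives the identity of
   b-symplectic forms.  The Darboux form yields Hamiltonian b-vector fields, hence
   a Poisson bracket, which descends to the orbit space because the Liouville form
   is H-invariant. *)

(** * Smooth functions on open subsets of R^m *)

(** A space is only an algebra of functions, so tangent vectors are derivations and neighbourhoods
    are nonvanishing sets of smooth functions ([bnear]). The obstacle is the direction normal to the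
    critical hypersurface: the component of V along e_0 is V c_0 / c_0, which the values of V on
    functions at a critical point do not determine. Hadamard's lemma makes this quotient smooth, and
    density of the complement makes it unique. That uniqueness is what gives every [xget] in
    [pull2], [liouville] and [lambda_theta] a well defined value. The charts adapted to H are local,
    whereas a function on G/H is an H-invariant function on all of G. Extending a function of the
    slice parameter by zero requires H to be closed, together with compactness of a piece of the
    slice. Hamiltonian fields are found chart by chart and glued without a partition of unity, since
    nondegeneracy forces local solutions to agree. The bracket is built on the b-cotangent bundle of
    G, where invariance under H is visible, and is moved to the product by [psi]. Smooth functions
    on an orbit space are by definition the invariant ones, so the bracket descends with all its
    axioms. *)

Section CkOn.
Context {R : realType}.

Lemma ctsC (T : topologicalType) (a : R) (x : T) : (fun=> a) @ x --> a.
Proof. exact: cvg_cst. Qed.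

Lemma ctsD (T : topologicalType) (f g : T -> R) (x : T) (a b : R) :
  f @ x --> a -> g @ x --> b -> (fun v => f v + g v) @ x --> a + b.
Proof. exact: cvgD. Qed.

Lemma ctsM (T : topologicalType) (f g : T -> R) (x : T) (a b : R) :
  f @ x --> a -> g @ x --> b -> (fun v => f v * g v) @ x --> a * b.
Proof. exact: cvgM. Qed.

Lemma cvg_sumr (T I : Type) (F : set_system T) (r : seq I) (f : I -> T -> R)
    (a : I -> R) : Filter F -> (forall i, f i x @[x --> F] --> a i) ->
  \sum_(i <- r) f i x @[x --> F] --> \sum_(i <- r) a i.
Proof.
move=> FF h; elim: r => [|i r IH].
  by rewrite big_nil; under eq_fun do rewrite big_nil; exact: cvg_cst.
by rewrite big_cons; under eq_fun do rewrite big_cons; exact: cvgD.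
Qed.

Lemma ctsP (T : topologicalType) (f : T -> R) (x : T) (a : R) :
  f @ x --> a <-> forall e : R, 0 < e -> \forall y \near x, `|a - f y| < e.
Proof. by split=> [/cvgrPdist_lt|h]; [|apply/cvgrPdist_lt]. Qed.

Lemma ctsV (T : topologicalType) (f : T -> R) (x : T) (a : R) :
  a != 0 -> f @ x --> a -> (fun v => (f v)^-1) @ x --> a^-1.
Proof. by move=> a0 fa; exact: cvgV. Qed.

(** Limits and derivatives are those of the ambient space, taken at the points of A. Restriction to
    a smaller set is then immediate, and openness of A enters only when a function is replaced by
    one equal to it on A. *)
Fixpoint Ck_on m (A : set 'rV[R]_m) (k : nat) (f : 'rV[R]_m -> R) : Prop :=
  if k is k'.+1 then
    (forall v, A v -> f @ v --> f v) /\
    forall i, (forall v, A v -> derivable f v (unitv i)) /\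
              Ck_on A k' (fun v => 'D_(unitv i) f v)
  else forall v, A v -> f @ v --> f v.

Definition smooth_on m (A : set 'rV[R]_m) (f : 'rV[R]_m -> R) : Prop :=
  forall k, Ck_on A k f.

Lemma Ck_onT m k (f : 'rV[R]_m -> R) : Ck_on setT k f <-> Ck k f.
Proof.
elim: k f => [|k IH] f /=.
  by split=> h v; [exact: h | move=> _; exact: h].
split=> -[h1 h2]; split.
- by move=> v; exact: h1.
- move=> i; have [h3 /IH h4] := h2 i; split=> // v; exact: h3.
- by move=> v _; exact: h1.
- by move=> i; have [h3 h4] := h2 i; split=> //; apply/IH.
Qed.

Lemma smooth_onT m (f : 'rV[R]_m -> R) : smooth_on setT f <-> smooth f.
Proof. by split=> h k; apply/Ck_onT. Qed.

Lemma Ck_on_cvg m (A : set 'rV[R]_m) k f v : Ck_on A k f -> A v -> f @ v --> f v.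
Proof. by case: k => [|k] /= h Av; [exact: h | case: h => h _; exact: h]. Qed.

Lemma Ck_onW m (A : set 'rV[R]_m) k f : Ck_on A k.+1 f -> Ck_on A k f.
Proof.
elim: k f => [|k IH] f; first by case.
move=> -[h1 h2]; split=> // i; have [h3 h4] := h2 i; split=> //.
exact: IH.
Qed.

Lemma Ck_on_sub m (A B : set 'rV[R]_m) k f : A `<=` B -> Ck_on B k f -> Ck_on A k f.
Proof.
move=> AB; elim: k f => [|k IH] f /=; first by move=> h v /AB; exact: h.
move=> [h1 h2]; split=> [v /AB|i]; first exact: h1.
have [h3 h4] := h2 i; split; last exact: IH.
by move=> v /AB; exact: h3.
Qed.

Lemma smooth_on_sub m (A B : set 'rV[R]_m) f :
  A `<=` B -> smooth_on B f -> smooth_on A f.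
Proof. by move=> AB h k; exact: (Ck_on_sub AB). Qed.

Lemma smooth_smooth_on m (A : set 'rV[R]_m) f : smooth f -> smooth_on A f.
Proof. by move/smooth_onT; exact: smooth_on_sub. Qed.

(** B need not be a neighbourhood of v: the conditions in [Ck_on] already speak of ambient germs at
    the points of the set. *)
Lemma Ck_on_loc m (A : set 'rV[R]_m) k f :
  (forall v, A v -> exists2 B : set 'rV[R]_m, B v & Ck_on B k f) -> Ck_on A k f.
Proof.
elim: k f => [|k IH] f h /=.
  by move=> v /h [B Bv]; exact.
split=> [v /h [B Bv [h1 _]]|i]; first exact: h1.
split=> [v /h [B Bv [_ /(_ i) [h1 _]]]|]; first exact: h1.
apply: IH => v /h [B Bv [_ /(_ i) [_ h1]]].
by exists B.
Qed.

Lemma Ck_on_ext m (A : set 'rV[R]_m) k f g : open A ->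
  (forall v, A v -> f v = g v) -> Ck_on A k f -> Ck_on A k g.
Proof.
move=> oA; elim: k f g => [|k IH] f g fg.
all: have nfg v (Av : A v) : \forall w \near v, f w = g w
  by apply: filterS (open_nbhs_nbhs (conj oA Av)) => w /fg.
  by move=> h v Av; rewrite -(fg v Av); exact: cvg_trans (near_eq_cvg (nfg v Av)) (h v Av).
move=> [h1 h2]; split=> [v Av|i].
  by rewrite -(fg v Av); exact: cvg_trans (near_eq_cvg (nfg v Av)) (h1 v Av).
have [h3 h4] := h2 i; split=> [v Av|].
  exact: near_eq_derivable (nfg v Av) (h3 v Av).
by apply: IH h4 => v Av; apply: near_eq_derive; exact: nfg.
Qed.

Lemma smooth_on_ext m (A : set 'rV[R]_m) f g : open A ->
  (forall v, A v -> f v = g v) -> smooth_on A f -> smooth_on A g.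
Proof. by move=> oA fg h k; exact: Ck_on_ext (h k). Qed.

Lemma smooth_loc m (f : 'rV[R]_m -> R) :
  (forall v, exists2 B : set 'rV[R]_m, B v & smooth_on B f) -> smooth f.
Proof.
move=> h; apply/smooth_onT => k; apply: Ck_on_loc => v _.
by have [B Bv hB] := h v; exists B.
Qed.

Lemma Ck_on_cst m (A : set 'rV[R]_m) k (a : R) : Ck_on A k (fun=> a).
Proof.
elim: k a => [|k IH] a /=; first by move=> v _; exact: ctsC.
split=> [v _|i]; first exact: ctsC.
split=> [v _|]; first exact: derivable_cst.
suff -> : (fun v => 'D_(unitv i) (fun=> a) v) = fun=> 0 :> R by exact: IH.
by apply/funext => v; rewrite derive_cst.
Qed.

Lemma derivable_coord m (v w : 'rV[R]_m) (i : 'I_m) :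
  is_derive v w (fun u : 'rV[R]_m => u 0 i) (w 0 i).
Proof.
have h : h^-1 *: ((h *: w + v) 0 i - v 0 i) @[h --> 0^'] --> w 0 i.
  apply: (@cvg_trans _ ((fun=> w 0 i) @ (0 : R)^')); last exact: cvg_cst.
  apply: near_eq_cvg; near=> h.
  rewrite !mxE addrK /GRing.scale /= mulrA mulVf ?mul1r//.
  by near: h; exact: nbhs_dnbhs_neq.
apply: DeriveDef; first by apply/cvg_ex; exists (w 0 i).
by apply: cvg_lim h.
Unshelve. all: by end_near. Qed.

Lemma Ck_on_coord m (A : set 'rV[R]_m) k (i : 'I_m) : Ck_on A k (fun v => v 0 i).
Proof.
case: k => [|k] /=; first by move=> v _; exact: coord_continuous.
split=> [v _|j]; first exact: coord_continuous.
split=> [v _|]; first by case: (derivable_coord v (unitv j) i).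
suff -> : (fun v => 'D_(unitv j) (fun v : 'rV[R]_m => v 0 i) v) = fun=> unitv j 0 i :> R.
  exact: Ck_on_cst.
by apply/funext => v; have [_ ->] := derivable_coord v (unitv j) i.
Qed.

Lemma Ck_on_add m (A : set 'rV[R]_m) k f g : open A ->
  Ck_on A k f -> Ck_on A k g -> Ck_on A k (fun v => f v + g v).
Proof.
move=> oA; elim: k f g => [|k IH] f g /=.
  by move=> hf hg v Av; apply: ctsD; [exact: hf|exact: hg].
move=> [f1 f2] [g1 g2]; split=> [v Av|i].
  by apply: ctsD; [exact: f1|exact: g1].
have [f3 f4] := f2 i; have [g3 g4] := g2 i; split=> [v Av|].
  by apply: derivableD; [exact: f3|exact: g3].
apply: Ck_on_ext oA _ (IH _ _ f4 g4) => v Av.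
by rewrite deriveD//; [exact: f3|exact: g3].
Qed.

Lemma Ck_on_mul m (A : set 'rV[R]_m) k f g : open A ->
  Ck_on A k f -> Ck_on A k g -> Ck_on A k (fun v => f v * g v).
Proof.
move=> oA; elim: k f g => [|k IH] f g.
  by move=> hf hg v Av; apply: ctsM; [exact: hf|exact: hg].
move=> F G; move: (F) (G) => [f1 f2] [g1 g2]; split=> [v Av|i].
  by apply: ctsM; [exact: f1|exact: g1].
have [f3 f4] := f2 i; have [g3 g4] := g2 i; split=> [v Av|].
  by apply: derivableM; [exact: f3|exact: g3].
have := Ck_on_add oA (IH _ _ (Ck_onW F) g4) (IH _ _ (Ck_onW G) f4).
apply: Ck_on_ext => // v Av.
by rewrite deriveM//; [exact: f3|exact: g3].
Qed.

Lemma Ck_on_sum m (A : set 'rV[R]_m) k (I : Type) (r : seq I) (P : pred I) F :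
  open A -> (forall i, P i -> Ck_on A k (F i)) ->
  Ck_on A k (fun v => \sum_(i <- r | P i) F i v).
Proof.
move=> oA h; elim: r => [|i r IH].
  apply: Ck_on_ext oA _ (Ck_on_cst A k 0) => v _; by rewrite big_nil.
have [Pi|nPi] := boolP (P i); last first.
  by apply: Ck_on_ext oA _ IH => v _; rewrite big_cons (negbTE nPi).
apply: Ck_on_ext oA _ (Ck_on_add oA (h i Pi) IH) => v _.
by rewrite big_cons Pi.
Qed.

Lemma Ck_on_inv m (A : set 'rV[R]_m) k f : open A ->
  (forall v, A v -> f v != 0) -> Ck_on A k f -> Ck_on A k (fun v => (f v)^-1).
Proof.
move=> oA nz; elim: k => [|k IH].
  by move=> hf v Av; apply: ctsV; [exact: nz|exact: hf].
move=> F; move: (F) => [f1 f2]; split=> [v Av|i].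
  by apply: ctsV; [exact: nz|exact: f1].
have [f3 f4] := f2 i; split=> [v Av|].
  by apply: derivableV; [exact: nz|exact: f3].
have F' := IH (Ck_onW F).
have := Ck_on_mul oA (Ck_on_cst A k (-1)) (Ck_on_mul oA (Ck_on_mul oA F' F') f4).
apply: Ck_on_ext => // v Av.
rewrite deriveV//; [|exact: nz|exact: f3].
by rewrite -exprVn expr2 /GRing.scale /=; ring.
Qed.

(** The matrix norm is the sup norm, so cubes form a basis of neighbourhoods; openness arguments
    become one inequality per coordinate. *)
Lemma near_rVP m (v : 'rV[R]_m) (P : 'rV[R]_m -> Prop) :
  (\forall w \near v, P w) <->
  exists2 e : R, 0 < e &
    forall w : 'rV[R]_m, (forall i, `|w 0 i - v 0 i| < e) -> P w.
Proof.
split=> [/nbhs_ballP[e e0 h]|[e e0 h]].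
  exists e => // w hw; apply: h; split=> // i j.
  by rewrite ord1 -ball_normE /= distrC.
apply/nbhs_ballP; exists e => // w [_ hw]; apply: h => i.
by have := hw 0 i; rewrite -ball_normE /= distrC.
Qed.

Lemma cvg_rV m (T : topologicalType) (g : 'I_m -> T -> R) (x : T) (a : 'rV[R]_m) :
  (forall j, g j @ x --> a 0 j) -> (fun y => \row_j g j y) @ x --> a.
Proof.
move=> h P /near_rVP[e e0 hP].
have : nbhs x [set y | forall j, `|g j y - a 0 j| < e].
  apply: filter_forall => j; have /ctsP/(_ e e0) := h j.
  by apply: filterS => y; rewrite distrC.
apply: filterS => y hy; apply: hP => j; rewrite mxE; exact: hy.
Qed.

Lemma is_derive_line m (f : 'rV[R]_m -> R) (p w : 'rV[R]_m) (s : R) :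
  derivable f (s *: w + p) w ->
  is_derive s 1 (fun t : R => f (t *: w + p)) ('D_w f (s *: w + p)).
Proof.
have e : (fun h : R => h^-1 *: (f ((h *: 1 + s) *: w + p) - f (s *: w + p))) =
   (fun h : R => h^-1 *: (f (h *: w + (s *: w + p)) - f (s *: w + p))).
  by apply/funext => h; rewrite scalerDl addrA /GRing.scale /= mulr1.
by move=> d; apply: DeriveDef; rewrite /derivable /derive /= e.
Qed.

Lemma MVT_line m (f : 'rV[R]_m -> R) (p w : 'rV[R]_m) (h : R) :
  (forall s : R, `|s| <= `|h| -> derivable f (s *: w + p) w) ->
  exists2 s : R, `|s| <= `|h| &
    f (h *: w + p) - f p = h * 'D_w f (s *: w + p).
Proof.
move=> df; pose g (t : R) := f (t *: w + p).
have dg (s : R) : `|s| <= `|h| -> is_derive s 1 g ('D_w f (s *: w + p)).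
  by move=> /df; exact: is_derive_line.
have g0 : g 0 = f p by rewrite /g scale0r add0r.
have [h0|h0|h0] := ltgtP 0 h; last 1 first.
- by rewrite -h0; exists 0 => //; rewrite !scale0r add0r subrr mul0r.
- have [||s] := @MVT R g (fun s => 'D_w f (s *: w + p)) 0 h h0.
  + move=> x; rewrite in_itv /= => /andP[x0 xh]; apply: dg.
    by rewrite !gtr0_norm// ltW.
  + apply: derivable_within_continuous => x; rewrite in_itv /= => /andP[x0 xh].
    have [] := dg x => //.
    by rewrite !ger0_norm// ltW.
  rewrite in_itv /= g0 subr0 => /andP[s0 sh] e; exists s.
    by rewrite !gtr0_norm// ltW.
  by rewrite e mulrC.
- have [||s] := @MVT R g (fun s => 'D_w f (s *: w + p)) h 0 h0.
  + move=> x; rewrite in_itv /= => /andP[x0 xh]; apply: dg.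
    by rewrite !ltr0_norm// lerN2 ltW.
  + apply: derivable_within_continuous => x; rewrite in_itv /= => /andP[x0 xh].
    have [] := dg x => //.
    by rewrite (ler0_norm xh) ltr0_norm// lerN2.
  rewrite in_itv /= g0 sub0r => /andP[s0 sh] e; exists s.
    by rewrite !ltr0_norm// lerN2 ltW.
  by rewrite -/(g h) -opprB e; ring.
Qed.

(* Caratheodory's form of differentiability *)
Lemma C1_factor m (A : set 'rV[R]_m) (f : 'rV[R]_m -> R) (p : 'rV[R]_m) :
  open A -> A p -> Ck_on A 1 f ->
  exists Q : 'I_m -> 'rV[R]_m -> R,
    (forall y, f y - f p = \sum_(j < m) (y 0 j - p 0 j) * Q j y) /\
    forall j, Q j @ p --> 'D_(unitv j) f p.
Proof.
move=> oA Ap [_ C1].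
(* [pa k y] takes its first k coordinates from y and the others from p, so consecutive points differ
   in one coordinate and the mean value theorem on a line applies. *)
pose pa (k : nat) (y : 'rV[R]_m) : 'rV[R]_m :=
  \row_l if (l < k)%N then y 0 l else p 0 l.
(* The default value on y_j = p_j is the only one that makes Q_j continuous at p. *)
pose Q (j : 'I_m) (y : 'rV[R]_m) := if y 0 j == p 0 j then 'D_(unitv j) f p
  else (f (pa j.+1 y) - f (pa j y)) / (y 0 j - p 0 j).
have paS (j : 'I_m) y :
    pa j.+1 y = (y 0 j - p 0 j) *: unitv j + pa j y.
  apply/rowP => l; rewrite !mxE /= ltnS leq_eqVlt.
  have [->|lj] := eqVneq l j; first by rewrite !eqxx ltnn /= mulr1 subrK.
  by rewrite -val_eqE in lj; rewrite (negbTE lj) /= mulr0 add0r.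
exists Q; split=> [y|j].
  have -> : f y - f p = f (pa m y) - f (pa 0 y).
    by congr (f _ - f _); apply/rowP => l; rewrite mxE ?ltn_ord.
  rewrite -(telescope_sumr (fun k => f (pa k y)) (leq0n m)) big_mkord.
  apply: eq_bigr => j _; rewrite /Q; case: eqP => [e|/eqP ne].
    by rewrite paS e subrr mul0r scale0r add0r subrr.
  by rewrite mulrC divfK// subr_eq0.
apply/ctsP => e e0.
have [dj cj] := C1 j.
have /near_rVP[r r0 hr] : \forall z \near p, A z /\
    `|'D_(unitv j) f p - 'D_(unitv j) f z| < e.
  apply: filterI; first exact: open_nbhs_nbhs.
  by have /ctsP := cj p Ap; exact.
apply/near_rVP; exists r => // y yr; rewrite /Q.
case: eqP => [_|/eqP ne]; first by rewrite subrr normr0.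
have pb (s : R) : `|s| <= `|y 0 j - p 0 j| ->
    forall l, `|(s *: unitv j + pa j y) 0 l - p 0 l| < r.
  move=> hs l; rewrite !mxE /=; case: eqP => [->|_].
    by rewrite ltnn mulr1 addrK (le_lt_trans hs).
  by rewrite mulr0 add0r; case: ifP => // _; rewrite subrr normr0.
have [s hs] := @MVT_line _ f (pa j y) (unitv j) (y 0 j - p 0 j)
   (fun s hs => dj _ (hr _ (pb s hs)).1).
rewrite -paS => ->; rewrite mulrC mulKf ?subr_eq0//.
exact: (hr _ (pb s hs)).2.
Qed.

(** Of the g_j only derivability in the direction w is asked: [C1_factor] writes the difference
    quotient of the composite as a finite sum of products of convergent factors. *)
Lemma chain_rule m n (A : set 'rV[R]_m) (f : 'rV[R]_m -> R)
    (g : 'I_m -> 'rV[R]_n -> R) (p w : 'rV[R]_n) (G := fun v => \row_j g j v) :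
  open A -> A (G p) -> Ck_on A 1 f -> (forall j, derivable (g j) p w) ->
  is_derive p w (fun v => f (G v))
    (\sum_(j < m) 'D_(unitv j) f (G p) * 'D_w (g j) p).
Proof.
move=> oA Ap C1 dg.
have [Q [Qe Qc]] := C1_factor oA Ap C1.
have Gc : G (h *: w + p) @[h --> (0 : R)] --> G p.
  apply: cvg_rV => j; rewrite mxE.
  have /derivable1P/derivable1_diffP/differentiable_continuous := dg j.
  by rewrite /prop_for /continuous_at /= scale0r add0r.
have h : h^-1 *: (f (G (h *: w + p)) - f (G p)) @[h --> (0 : R)^'] -->
   \sum_(j < m) 'D_(unitv j) f (G p) * 'D_w (g j) p.
  have -> : (fun h : R => h^-1 *: (f (G (h *: w + p)) - f (G p))) =
     (fun h : R => \sum_(j < m)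
        Q j (G (h *: w + p)) * (h^-1 *: (g j (h *: w + p) - g j p))).
    apply/funext => h; rewrite Qe scaler_sumr; apply: eq_bigr => j _.
    by rewrite !mxE /GRing.scale /=; ring.
  apply: cvg_sumr => j; apply: cvgM; last exact: dg.
  by move=> P hP; apply: (@cvg_within _ (nbhs (0 : R))); exact: (Gc _ (Qc j _ hP)).
apply: DeriveDef; first by apply/cvg_ex; eexists; exact: h.
by apply: cvg_lim h.
Qed.

Lemma Ck_on_comp m n (A : set 'rV[R]_m) (B : set 'rV[R]_n) k f
    (g : 'I_m -> 'rV[R]_n -> R) :
  open A -> open B -> (forall v, B v -> A (\row_j g j v)) ->
  Ck_on A k f -> (forall j, Ck_on B k (g j)) ->
  Ck_on B k (fun v => f (\row_j g j v)).
Proof.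
move=> oA oB AB.
elim: k f g AB => [|k IH] f g AB cf cg.
  move=> v Bv.
  have cG : (fun v => \row_j g j v) @ v --> \row_j g j v.
    by apply: cvg_rV => j; rewrite mxE; exact: cg.
  exact: cvg_comp cG (cf _ (AB v Bv)).
have cg' j : Ck_on B k (g j) by exact: Ck_onW.
split=> [v Bv|i].
  have cG : (fun v => \row_j g j v) @ v --> \row_j g j v.
    by apply: cvg_rV => j; rewrite mxE; exact: Ck_on_cvg (cg j) Bv.
  exact: cvg_comp cG (Ck_on_cvg cf (AB v Bv)).
have C1 : Ck_on A 1 f.
  case: cf => c0 c1; split=> // j; have [c2 c3] := c1 j; split=> // v Av.
  exact: Ck_on_cvg c3 Av.
have dc v : B v -> is_derive v (unitv i) (fun v => f (\row_j g j v))
   (\sum_(j < m) 'D_(unitv j) f (\row_j g j v) * 'D_(unitv i) (g j) v).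
  move=> Bv; apply: (chain_rule oA (AB v Bv) C1) => j.
  by have [_ /(_ i) [h _]] := cg j; exact: h.
split=> [v Bv|]; first by case: (dc v Bv).
have : Ck_on B k (fun v => \sum_(j < m) 'D_(unitv j) f (\row_j g j v) * 'D_(unitv i) (g j) v).
  apply: Ck_on_sum => // j _; apply: Ck_on_mul => //.
    by apply: (IH ('D_(unitv j) f) g AB) => //; have [_ /(_ j) []] := cf.
  by have [_ /(_ i) []] := cg j.
by apply: Ck_on_ext => // v Bv; have [_ ->] := dc v Bv.
Qed.
End CkOn.

Section Smooth.
Context {R : realType}.

Lemma smooth_on_comp m n (A : set 'rV[R]_m) (B : set 'rV[R]_n) f
    (g : 'I_m -> 'rV[R]_n -> R) :
  open A -> open B -> (forall v, B v -> A (\row_j g j v)) ->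
  smooth_on A f -> (forall j, smooth_on B (g j)) ->
  smooth_on B (fun v => f (\row_j g j v)).
Proof. by move=> oA oB AB sf sg k; apply: (Ck_on_comp oA oB AB) => // j; exact: sg. Qed.

Lemma smooth_comp m n (f : 'rV[R]_m -> R) (g : 'I_m -> 'rV[R]_n -> R) :
  smooth f -> (forall j, smooth (g j)) -> smooth (fun v => f (\row_j g j v)).
Proof.
move=> /smooth_onT sf sg; apply/smooth_onT.
by apply: (smooth_on_comp openT openT) => // j; exact/smooth_onT.
Qed.

Lemma smooth_cst m (a : R) : smooth (fun _ : 'rV[R]_m => a).
Proof. by apply/smooth_onT => k; exact: Ck_on_cst. Qed.

Lemma smooth_coord m (i : 'I_m) : smooth (fun v : 'rV[R]_m => v 0 i).
Proof. by apply/smooth_onT => k; exact: Ck_on_coord. Qed.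

Lemma smoothD m (f g : 'rV[R]_m -> R) : smooth f -> smooth g ->
  smooth (fun v => f v + g v).
Proof.
move=> /smooth_onT sf /smooth_onT sg; apply/smooth_onT => k.
exact: Ck_on_add openT (sf k) (sg k).
Qed.

Lemma smoothM m (f g : 'rV[R]_m -> R) : smooth f -> smooth g ->
  smooth (fun v => f v * g v).
Proof.
move=> /smooth_onT sf /smooth_onT sg; apply/smooth_onT => k.
exact: Ck_on_mul openT (sf k) (sg k).
Qed.

Lemma smooth_sum m (I : Type) (r : seq I) (P : pred I) (F : I -> 'rV[R]_m -> R) :
  (forall i, P i -> smooth (F i)) -> smooth (fun v => \sum_(i <- r | P i) F i v).
Proof.
move=> h; apply/smooth_onT => k; apply: Ck_on_sum openT _ => i Pi.
by have /smooth_onT := h i Pi; exact.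
Qed.

Lemma smooth_derive m (f : 'rV[R]_m -> R) i : smooth f -> smooth (fun v => 'D_(unitv i) f v).
Proof. by move=> sf k; have [_ /(_ i) []] := sf k.+1. Qed.

Lemma smooth_derivable m (f : 'rV[R]_m -> R) i v : smooth f -> derivable f v (unitv i).
Proof. by move=> sf; have [_ /(_ i) [h _]] := sf 1%N; exact: h. Qed.

Lemma smooth_cvg m (f : 'rV[R]_m -> R) (v : 'rV[R]_m) : smooth f -> f @ v --> f v.
Proof. by move=> sf; exact: sf 0%N v. Qed.

Lemma smooth_chain m n (f : 'rV[R]_m -> R) (g : 'I_m -> 'rV[R]_n -> R) i v :
  smooth f -> (forall j, smooth (g j)) ->
  'D_(unitv i) (fun v => f (\row_j g j v)) v =
  \sum_(j < m) 'D_(unitv j) f (\row_j g j v) * 'D_(unitv i) (g j) v.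
Proof.
move=> sf sg.
have [|j|] := @chain_rule R m n setT f g v (unitv i) openT I.
- by have /smooth_onT := sf; exact.
- exact: smooth_derivable.
- by [].
Qed.

End Smooth.

(** * Bump functions, Hadamard's lemma, implicit functions *)

Section Bump.
Context {R : realType}.

Lemma is_derive_line0 (V : normedModType R) (f : V -> R) (x w : V) (c : R) :
  is_derive x w f c <-> is_derive (0 : R) (1 : R) (fun t : R => f (t *: w + x)) c.
Proof.
have e0 : (fun t : R => t^-1 *: (f ((t *: (1 : R) + 0 : R) *: w + x) - f ((0 : R) *: w + x))) =
    (fun t : R => t^-1 *: (f (t *: w + x) - f x)).
  by apply/funext => t; rewrite /GRing.scale /= mulr1 addr0 -!/(GRing.scale _ _) scale0r add0r.
by split=> -[d v]; apply: DeriveDef; move: d v; rewrite /derivable /derive /= e0.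
Qed.

Lemma is_derive_comp1 (V : normedModType R) (h : R -> R) (f : V -> R) (x w : V) (a b : R) :
  is_derive (f x) 1 h a -> is_derive x w f b ->
  is_derive x w (fun v => h (f v)) (a * b).
Proof.
move=> ha /is_derive_line0 hb; apply/is_derive_line0.
have := @is_derive1_comp R h (fun t : R => f (t *: w + x)) 0 a b.
by rewrite scale0r add0r; apply.
Qed.

Lemma is_derive_mulr (x c : R) : is_derive x (1 : R) (fun t : R => t * c) c.
Proof.
have := is_deriveZ c (is_derive_id x (1 : R)).
rewrite /GRing.scale /= mulr1; congr is_derive.
by apply/funext => t; rewrite mulrC.
Qed.

(* [flat n t] is [t^-n exp(-1/t)] for [t > 0]; this family is stable under
   differentiation, so each member is smooth. *)
Definition flat (n : nat) (t : R) : R :=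
  if 0 < t then t^-1 ^+ n * expR (- t^-1) else 0.

Lemma flat_ge0 n t : 0 <= flat n t.
Proof.
rewrite /flat; case: ifP => // t0.
by rewrite mulr_ge0 ?expR_ge0// exprn_ge0// invr_ge0 ltW.
Qed.

Lemma flat_gt0 n t : 0 < t -> 0 < flat n t.
Proof. by move=> t0; rewrite /flat t0 mulr_gt0 ?expR_gt0// exprn_gt0// invr_gt0. Qed.

Lemma flat_eq0 n t : t <= 0 -> flat n t = 0.
Proof. by move=> t0; rewrite /flat ltNge t0. Qed.

(** From exp(1/t) >= (1/t)^(n+1) / (n+1)!. With [flatS], this linear bound forces the derivative at
    0 to vanish. *)
Lemma flat_le n t : flat n t <= n.+1`!%:R * `|t|.
Proof.
rewrite /flat; case: ifP => [t0|_]; last by rewrite mulr_ge0.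
have t1 : 0 < t^-1 by rewrite invr_gt0.
have h := expR_ge1Dxn n (ltW t1).
have f0 : (0 : R) < n.+1`!%:R by rewrite ltr0n fact_gt0.
rewrite expRN ler_pdivrMr ?expR_gt0// gtr0_norm//.
have {}h : t^-1 ^+ n.+1 / n.+1`!%:R <= expR t^-1 by apply: le_trans h; rewrite lerDr.
have -> : t^-1 ^+ n = n.+1`!%:R * t * (t^-1 ^+ n.+1 / n.+1`!%:R).
  rewrite exprS; field.
  by rewrite !gt_eqF.
by rewrite ler_pM2l// mulr_gt0.
Qed.

Lemma flatS n t : flat n t = t * flat n.+1 t.
Proof.
rewrite /flat; case: ifP => [t0|_]; last by rewrite mulr0.
by rewrite exprS !mulrA mulfV ?mul1r// gt_eqF.
Qed.

Lemma is_derive_flat n (t : R) :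
  is_derive t (1 : R) (flat n) (flat n.+2 t - n%:R * flat n.+1 t).
Proof.
have [t0|t0|->] := ltgtP t 0.
- have /near_eq_is_derive : \forall s \near t, (fun=> 0 : R) s = flat n s.
    near=> s; rewrite flat_eq0// ltW//; near: s; exact: lt_nbhsl.
  apply; rewrite !flat_eq0 ?ltW// mulr0 subrr; exact: is_derive_cst.
- have /near_eq_is_derive : \forall s \near t,
     (fun t => t^-1 ^+ n * expR (- t^-1)) s = flat n s.
    near=> s; rewrite /flat ifT//; near: s; exact: lt_nbhsr.
  apply.
  have t1 : t != 0 by rewrite gt_eqF.
  have dV : is_derive t (1 : R) (fun s : R => s^-1) (- t^-1 ^+ 2).
    have := @is_deriveV _ id t 1 1 t1 (is_derive_id _ _).
    by rewrite exprVn /GRing.scale /= mulr1.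
  have dE : is_derive t (1 : R) (fun s : R => expR (- s^-1)) (expR (- t^-1) * t^-1 ^+ 2).
    apply: is_derive_comp1.
    by apply: is_derive_eq; rewrite opprK.
  have -> : (fun s : R => s^-1 ^+ n * expR (- s^-1)) =
      (fun s : R => s^-1) ^+ n * (fun s : R => expR (- s^-1)).
    by apply/funext => s; rewrite !fctE.
  apply: (is_derive_eq (is_deriveM (is_deriveX n dV) dE)).
  rewrite /flat t0 /GRing.scale /=.
  rewrite !fctE; case: n => [|n]; first by rewrite !expr0; ring.
  by rewrite /= !exprS; ring.
(* At 0 the difference quotient of [flat n] is [flat n.+1], squeezed between 0 and a multiple of
   |h|. *)
- have h : h^-1 *: (flat n (h *: (1 : R) + 0) - flat n 0) @[h --> (0 : R)^'] --> (0 : R).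
    apply: (@squeeze_cvgr _ _ _ _ (fun=> 0) (fun h => n.+2`!%:R * `|h|)).
    + near=> h; have h0 : h != 0 by near: h; exact: nbhs_dnbhs_neq.
      rewrite (flat_eq0 _ (lexx 0)) subr0 /GRing.scale /= mulr1 addr0 flatS mulKf//.
      by rewrite flat_ge0 flat_le.
    + exact: cvg_cst.
    + rewrite -[X in _ --> X](mulr0 (n.+2`!%:R : R)); apply: cvgM; first exact: cvg_cst.
      rewrite -[X in _ --> X](normr0 R).
      by apply: cvg_norm; move=> P hP; apply: (@cvg_within _ (nbhs (0 : R))).
  rewrite !(flat_eq0 _ (lexx 0)) mulr0 subr0.
  apply: DeriveDef; first by apply/cvg_ex; exists 0.
  by apply: cvg_lim h.
Unshelve. all: by end_near. Qed.

Lemma Ck_on_flat m (A : set 'rV[R]_m) k n f : open A -> Ck_on A k f ->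
  Ck_on A k (fun v => flat n (f v)).
Proof.
move=> oA; elim: k n f => [|k IH] n f cf.
  move=> v Av; apply: cvg_comp (cf v Av) _.
  by have [/derivable1_diffP/differentiable_continuous] := is_derive_flat n (f v).
split=> [v Av|i].
  apply: cvg_comp (Ck_on_cvg cf Av) _.
  by have [/derivable1_diffP/differentiable_continuous] := is_derive_flat n (f v).
have [_ /(_ i) [df cdf]] := cf.
have D v : A v -> is_derive v (unitv i) (fun v => flat n (f v))
    ((flat n.+2 (f v) - n%:R * flat n.+1 (f v)) * 'D_(unitv i) f v).
  by move=> Av; apply: is_derive_comp1 (is_derive_flat n (f v)) (derivableP (df v Av)).
split=> [v Av|]; first by case: (D v Av).
have cf' := Ck_onW cf.
have := Ck_on_mul oA (Ck_on_add oA (IH n.+2 f cf')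
  (Ck_on_mul oA (Ck_on_cst A k (- n%:R)) (IH n.+1 f cf'))) cdf.
by apply: Ck_on_ext => // v Av; have [_ ->] := D v Av; rewrite mulNr.
Qed.

Lemma smooth_flat m (f : 'rV[R]_m -> R) n : smooth f -> smooth (fun v => flat n (f v)).
Proof.
by move=> /smooth_onT sf; apply/smooth_onT => k; exact: Ck_on_flat openT (sf k).
Qed.

(** The two terms of the denominator never vanish together because 1/4 < 3/4. The margins 1/4 and
    3/4 make [step] constant near 0 and near 1, so that bumps built from it are locally constant
    where that is needed. *)
Definition step (t : R) : R :=
  flat 0 (t - 4^-1) / (flat 0 (t - 4^-1) + flat 0 (3 / 4 - t)).

Lemma step_den_gt0 t : 0 < flat 0 (t - 4^-1) + flat 0 (3 / 4 - t).
Proof.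
have [h|h] := ltP (4^-1) t.
  by apply: ltr_wpDr; [exact: flat_ge0 | apply: flat_gt0; rewrite subr_gt0].
by apply: ltr_wpDl; [exact: flat_ge0 | apply: flat_gt0; lra].
Qed.

Lemma step0 t : t <= 4^-1 -> step t = 0.
Proof. by move=> h; rewrite /step flat_eq0 ?mul0r// subr_le0. Qed.

Lemma step1 t : 3 / 4 <= t -> step t = 1.
Proof.
move=> h; rewrite /step (flat_eq0 _ (_ : 3 / 4 - t <= 0)) ?addr0 ?subr_le0//.
by rewrite mulfV// gt_eqF// flat_gt0//; lra.
Qed.

Lemma smooth_step m (f : 'rV[R]_m -> R) : smooth f -> smooth (fun v => step (f v)).
Proof.
move=> sf.
have s1 : smooth (fun v => flat 0 (f v - 4^-1)).
  by apply: smooth_flat; apply: smoothD => //; exact: smooth_cst.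
have s2 : smooth (fun v => flat 0 (3 / 4 - f v)).
  apply: smooth_flat; apply: smoothD; first exact: smooth_cst.
  suff -> : (fun v => - f v) = (fun v => -1 * f v) by apply: smoothM => //; exact: smooth_cst.
  by apply/funext => v; rewrite mulN1r.
apply: smoothM => //; apply/smooth_onT => k.
apply: Ck_on_inv openT _ _ => [v _|]; first by rewrite gt_eqF// step_den_gt0.
by have /smooth_onT := smoothD s1 s2; exact.
Qed.

End Bump.

(** * Quotients by a coordinate, through integrals depending on a parameter *)

Section Hadamard.
Context {R : realType}.
Notation mu := (@lebesgue_measure R).

Local Notation I01 := (`[(0 : R), 1]%classic).

Lemma unit_integrable (f : R -> R) : {within I01, continuous f} ->
  mu.-integrable I01 (EFin \o f).
Proof. by move=> cf; apply: continuous_compact_integrable => //; exact: segment_compact. Qed.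

Lemma unit_integral_cst (a : R) : \int[mu]_(s in I01) a = a.
Proof.
have m1 : mu I01 = 1%E.
  by rewrite lebesgue_measure_itv /= lte_fin ltr01 sube0.
have -> : \int[mu]_(s in I01) a = a * fine (mu I01) by apply: Rintegral_cst; exact: measurable_itv.
by rewrite m1 mulr1.
Qed.

Lemma unit_integral_dist (f g : R -> R) (e : R) :
  {within I01, continuous f} -> {within I01, continuous g} ->
  (forall s, I01 s -> `|f s - g s| <= e) ->
  `|\int[mu]_(s in I01) f s - \int[mu]_(s in I01) g s| <= e.
Proof.
move=> cf cg h.
have cfg : {within I01, continuous (fun s => f s - g s)}.
  by move=> s; apply: cvgB; [exact: cf | exact: cg].
rewrite -RintegralB//; [|exact: unit_integrable..].
have /le_trans : `|\int[mu]_(s in I01) (f s - g s)| <= \int[mu]_(s in I01) `|f s - g s|.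
  by apply: le_normr_Rintegral; [exact: measurable_itv | exact: unit_integrable].
apply.
rewrite -[leRHS](unit_integral_cst e).
apply: le_Rintegral => //.
- by apply: unit_integrable => s; apply: cvg_norm; exact: cfg.
- by apply: unit_integrable => s; exact: cvg_cst.
Qed.

Variables (m : nat) (i : 'I_m) (a : R).

Definition interp (s : R) (w : 'rV[R]_m) : 'rV[R]_m :=
  \row_j if j == i then a + s * (w 0 j - a) else w 0 j.

(** Hadamard's integral along the segment that moves the i-th coordinate from a to w_i. The weight
    s^n closes the family under differentiation: each derivative in direction i brings out one
    factor s. *)
Definition hadq (n : nat) (f : 'rV[R]_m -> R) (w : 'rV[R]_m) : R :=
  \int[mu]_(s in I01) (s ^+ n * f (interp s w)).

Lemma interp_cvg (s : R) (w : 'rV[R]_m) :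
  (fun z : R * 'rV[R]_m => interp z.1 z.2) @ (nbhs (s, w)) --> interp s w.
Proof.
have c2 j : (fun z : R * 'rV[R]_m => z.2 0 j) @ nbhs (s, w) --> w 0 j.
  apply: (@cvg_comp _ _ _ snd (fun v : 'rV[R]_m => v 0 j) _ (nbhs w)); first exact: cvg_snd.
  exact: coord_continuous.
have c1 : (fun z : R * 'rV[R]_m => z.1) @ nbhs (s, w) --> s by exact: cvg_fst.
apply: cvg_rV => j; rewrite mxE; case: eqP => _; last exact: c2.
apply: ctsD; first exact: ctsC.
apply: ctsM => //; apply: ctsD; [exact: c2|exact: ctsC].
Qed.

Lemma interp_cvg1 (s : R) (w : 'rV[R]_m) : (fun t => interp t w) @ s --> interp s w.
Proof.
apply: cvg_rV => j; rewrite mxE; case: eqP => _; last exact: ctsC.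
apply: ctsD; first exact: ctsC.
by apply: ctsM; [exact: cvg_id | exact: ctsC].
Qed.

Lemma interp_within n (f : 'rV[R]_m -> R) (w : 'rV[R]_m) : continuous f ->
  {within I01, continuous (fun s => s ^+ n * f (interp s w))}.
Proof.
move=> cf; apply: continuous_subspaceT => s; apply: ctsM; first exact: exprn_continuous.
exact: cvg_comp (@interp_cvg1 s w) (cf _).
Qed.

(** Uniformity in s is the tube lemma over the compact interval [0, 1]. *)
Lemma interp_near (f : 'rV[R]_m -> R) (w : 'rV[R]_m) (e : R) : continuous f -> 0 < e ->
  \forall v \near w, forall s : R, I01 s -> `|f (interp s v) - f (interp s w)| < e.
Proof.
move=> cf e0.
have /compact_near_coveringP cI : compact I01 by exact: segment_compact.
have e2 : 0 < e / 2 by rewrite divr_gt0.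
apply: (cI _ (nbhs w) (fun v s => `|f (interp s v) - f (interp s w)| < e)) => s _.
have h : \forall z \near (s, w), `|f (interp s w) - f (interp z.1 z.2)| < e / 2.
  have /ctsP := cvg_comp _ _ (@interp_cvg s w) (cf (interp s w)).
  exact.
have h1 : \forall z \near (s, w), `|f (interp s w) - f (interp z.1 w)| < e / 2.
  have /ctsP /(_ _ e2) h1 := cvg_comp _ _ (@interp_cvg1 s w) (cf (interp s w)).
  exact: (cvg_fst h1).
near=> z; rewrite (splitr e).
apply: le_lt_trans (ler_distD (f (interp s w)) _ _) _.
by apply: ltrD; [rewrite distrC|]; near: z.
Unshelve. all: by end_near. Qed.

Lemma hadq_cvg n (f : 'rV[R]_m -> R) (w : 'rV[R]_m) : continuous f -> hadq n f @ w --> hadq n f w.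
Proof.
move=> cf; apply/ctsP => e e0.
have e2 : 0 < e / 2 by rewrite divr_gt0.
apply: filterS (@interp_near f w _ cf e2) => v hv.
apply: (@le_lt_trans _ _ (e / 2)); last by rewrite ltr_pdivrMr// ltr_pMr// ltr1n.
apply: unit_integral_dist; [exact: interp_within..|move=> s Is].
rewrite -mulrBr normrM -[leRHS]mul1r ler_pM//.
  move: Is; rewrite /= in_itv /= => /andP[s0 s1].
  by rewrite ger0_norm ?exprn_ge0// exprn_ile1.
by rewrite distrC ltW// hv.
Qed.

(** Differentiation under the integral sign; the derivative is again a [hadq], with exponent n or n
    + 1, so induction on k applies for all n at once. *)
Lemma Ck_on_hadq (k n : nat) (f : 'rV[R]_m -> R) : Ck_on setT k f -> Ck_on setT k (hadq n f).
Proof.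
elim: k n f => [|k IH] n f cf.
  by move=> v _; apply: hadq_cvg => w; exact: cf.
have cf0 : continuous f by move=> w; exact: Ck_on_cvg cf I.
split=> [v _|j]; first exact: hadq_cvg.
have [_ /(_ j) [df cdf]] := cf.
have D v : is_derive v (unitv j) (hadq n f)
    (hadq (n + (j == i)) (fun v => 'D_(unitv j) f v) v).
  pose c (s : R) := if j == i then s else 1.
  pose F (x s : R) := s ^+ n * f (interp s (x *: unitv j + v)).
  pose dF (x s : R) := s ^+ n * c s * 'D_(unitv j) f (interp s (x *: unitv j + v)).
  have sh s x : interp s (x *: unitv j + v) = (x * c s) *: unitv j + interp s v.
    apply/rowP => l; rewrite !mxE /= /c.
    case: (eqVneq l i) => [->|li]; case: (eqVneq j i) => [ji|ji] /=.
    - by ring.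
    - by ring.
    - by rewrite ji (negbTE li) /=; ring.
    - by ring.
  have dFP x s : is_derive x (1 : R) (fun x => F x s) (dF x s).
    rewrite /F /dF -mulrA; apply: is_derive_eq; last by [].
    apply: is_deriveZ.
    under eq_fun do rewrite sh.
    have := @is_derive_comp1 _ R (fun t => f (t *: unitv j + interp s v)) (fun x => x * c s) x 1
       ('D_(unitv j) f ((x * c s) *: unitv j + interp s v)) (c s).
    rewrite [c s * _]mulrC sh; apply.
      apply: is_derive_line; exact: df.
    exact: is_derive_mulr.
  have cD : continuous (fun v => 'D_(unitv j) f v) by move=> w; exact: Ck_on_cvg cdf I.
  have [M0 hM0] : exists M0, forall s, I01 s -> `|'D_(unitv j) f (interp s v)| <= M0.
    have cN : {within I01, continuous (fun s => `|'D_(unitv j) f (interp s v)|)}.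
      apply: continuous_subspaceT => s; apply: cvg_norm.
      exact: cvg_comp (@interp_cvg1 s v) (cD _).
    have [s _ hs] := EVT_max (ler01 : 0 <= 1 :> R) cN.
    by exists `|'D_(unitv j) f (interp s v)| => t; exact: hs.
  (* Domination by a constant: M0 bounds the derivative for x = 0, and [interp_near] adds at most 1
     for small x, uniformly in s. *)
  have [r r0 hr] : exists2 r : R, 0 < r & forall x s : R, `|x| < r -> I01 s -> `|dF x s| <= M0 + 1.
    have : \forall x \near (0 : R), forall s, I01 s ->
       `|'D_(unitv j) f (interp s (x *: unitv j + v)) - 'D_(unitv j) f (interp s v)| < 1.
      have hc : (fun x : R => x *: unitv j + v) @ (0 : R) --> v.
        apply: (@cvg_trans _ (nbhs (0 *: unitv j + v))); last by rewrite scale0r add0r.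
        by apply: cvgD; [apply: cvgZr_tmp|exact: cvg_cst].
      exact: hc _ (@interp_near _ v 1 cD ltr01).
    move=> /nbhs_ballP[r r0 hr]; exists r => // x s xr Is.
    have {}hr : `|'D_(unitv j) f (interp s (x *: unitv j + v)) - 'D_(unitv j) f (interp s v)| < 1.
      by apply: hr => //; rewrite -ball_normE /= sub0r normrN.
    have [s0 s1] : 0 <= s /\ s <= 1 by move: Is; rewrite /= in_itv /= => /andP[].
    rewrite /dF !normrM -[leRHS]mul1r ler_pM//; last first.
      rewrite -(subrK ('D_(unitv j) f (interp s v)) ('D_(unitv j) f (interp s _))).
      rewrite (le_trans (ler_normD _ _))// addrC lerD ?hM0//; exact: ltW.
    rewrite -[leRHS]mul1r ler_pM//.
      by rewrite ger0_norm ?exprn_ge0// exprn_ile1.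
    by rewrite /c; case: ifP => _; rewrite ?normr1// ger0_norm.
  have cF x : {within I01, continuous (F x)} by exact: interp_within.
  have M1 : 0 <= M0 + 1.
    apply: le_trans (hr 0 0 _ _); rewrite ?normr0//.
    by rewrite /= in_itv /= lexx ler01.
  have I0 : `](- r), r[%classic (0 : R) by rewrite /= in_itv /= oppr_lt0 r0.
  have pF x s : partial1of2 F x s = dF x s.
    by rewrite partial1of2E; have [_ ->] := dFP x s.
  have iM : mu.-integrable I01 (EFin \o (fun _ : R => M0 + 1)).
    by apply: unit_integrable => s; exact: cvg_cst.
  have Ir x : `](- r), r[%classic x -> `|x| < r by rewrite /= in_itv /= -ltr_norml.
  have dd : derivable (fun x => \int[mu]_(s in I01) F x s) 0 1.
    apply: (@derivable_under_integral _ _ _ mu F I01 (measurable_itv _) 0 (-r) r I0 _ _ (fun=> M0 + 1)) => //.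
    - by move=> x _; exact: unit_integrable.
    - by move=> x s /Ir xr Is; rewrite pF; exact: hr.
  have de : (fun x => \int[mu]_(s in I01) F x s)^`()%classic 0 = \int[mu]_(s in I01) (partial1of2 F) 0 s.
    apply: (@differentiation_under_integral _ _ _ mu F I01 (measurable_itv _) 0 (-r) r I0 _ _ (fun=> M0 + 1)) => //.
    - by move=> x _; exact: unit_integrable.
    - by move=> x s /Ir xr Is; rewrite pF; exact: hr.
  apply/is_derive_line0; apply: DeriveDef => //.
  rewrite -derive1E de; apply: eq_Rintegral => s _.
  rewrite pF /dF scale0r add0r /c; congr (_ * _).
  by case: eqP => _; rewrite ?addn1 ?addn0 ?mulr1// exprSr.
split=> [v _|]; first by case: (D v).
have := IH (n + (j == i))%N _ cdf.
by apply: Ck_on_ext openT _ => v _; have [_ ->] := D v.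
Qed.

Lemma smooth_hadq n (f : 'rV[R]_m -> R) : smooth f -> smooth (hadq n f).
Proof. by move=> /smooth_onT sf; apply/smooth_onT => k; exact: Ck_on_hadq. Qed.

(** The fundamental theorem of calculus along the segment from [interp 0 w], whose i-th coordinate
    is a, to w. *)
Lemma hadq_eq (f : 'rV[R]_m -> R) (w : 'rV[R]_m) : smooth f ->
  f w - f (interp 0 w) = (w 0 i - a) * hadq 0 (fun v => 'D_(unitv i) f v) w.
Proof.
move=> sf.
have E s : interp s w = (s * (w 0 i - a)) *: unitv i + interp 0 w.
  apply/rowP => l; rewrite !mxE /=.
  by case: (eqVneq l i) => [->|li] /=; ring.
have E1 : interp 1 w = w.
  by apply/rowP => l; rewrite mxE; case: eqP => // ->; rewrite mul1r addrC subrK.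
pose g s := f (interp s w).
pose dg s := 'D_(unitv i) f (interp s w) * (w 0 i - a).
have dgP s : is_derive s (1 : R) g (dg s).
  rewrite /g; under eq_fun do rewrite E.
  have := @is_derive_comp1 _ R (fun t => f (t *: unitv i + interp 0 w)) (fun s => s * (w 0 i - a)) s 1
       ('D_(unitv i) f ((s * (w 0 i - a)) *: unitv i + interp 0 w)) (w 0 i - a).
  rewrite /dg (E s); apply.
    by apply: is_derive_line; exact: smooth_derivable.
  exact: is_derive_mulr.
have cD : continuous (fun v => 'D_(unitv i) f v).
  by move=> v; apply: smooth_cvg; exact: smooth_derive.
have cDi : {within I01, continuous (fun s => 'D_(unitv i) f (interp s w))}.
  by apply: continuous_subspaceT => s; exact: cvg_comp (@interp_cvg1 s w) (cD _).
have cdg : {within I01, continuous dg}.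
  by move=> s; apply: cvgM; [exact: cDi | exact: cvg_cst].
have cg s : g @ s --> g s.
  by have [/derivable1_diffP/differentiable_continuous] := dgP s.
have := @continuous_FTC2 R dg g 0 1 ltr01 cdg.
have -> : (w 0 i - a) * hadq 0 (fun v => 'D_(unitv i) f v) w = \int[mu]_(s in I01) dg s.
  rewrite /hadq; under [in LHS]eq_Rintegral do rewrite expr0 mul1r.
  rewrite mulrC -RintegralZr//; exact: unit_integrable.
rewrite /Rintegral => ->.
- by rewrite -EFinB /= /g E1.
- split=> [s _||]; first by case: (dgP s).
  + exact: cvg_at_right_filter.
  + exact: cvg_at_left_filter.
- by move=> s _; rewrite derive1E; have [_ ->] := dgP s.
Qed.

Lemma hadq_diag (f : 'rV[R]_m -> R) (w : 'rV[R]_m) : w 0 i = a -> hadq 0 f w = f w.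
Proof.
move=> wa; rewrite /hadq -[RHS]unit_integral_cst; apply: eq_Rintegral => s _.
rewrite expr0 mul1r; congr f; apply/rowP => j; rewrite mxE; case: eqP => // ->.
by rewrite wa subrr mulr0 addr0.
Qed.

End Hadamard.

(** * Extension of smooth germs *)

Section Localize.
Context {R : realType}.

Lemma cts_lt (T : topologicalType) (f : T -> R) (x : T) (a b : R) :
  f @ x --> a -> a < b -> \forall y \near x, f y < b.
Proof. by move=> fa ab; exact: fa _ (lt_nbhsl ab). Qed.

Lemma cts_gt (T : topologicalType) (f : T -> R) (x : T) (a b : R) :
  f @ x --> a -> b < a -> \forall y \near x, b < f y.
Proof. by move=> fa ab; exact: fa _ (lt_nbhsr ab). Qed.

Lemma cvg_rVF m (T : Type) (F : set_system T) (g : 'I_m -> T -> R) (a : 'rV[R]_m) :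
  Filter F -> (forall j, g j x @[x --> F] --> a 0 j) -> \row_j g j y @[y --> F] --> a.
Proof.
move=> FF h P /near_rVP[e e0 hP].
have : F [set y | forall j, `|g j y - a 0 j| < e].
  apply: filter_forall => j; have /cvgrPdist_lt/(_ e e0) := h j.
  by apply: filterS => y; rewrite distrC.
move=> hF; change (F [set y | P (\row_j g j y)]); apply: filterS hF => y hy.
by apply: hP => j; rewrite mxE; exact: hy.
Qed.

Definition cube m (v : 'rV[R]_m) (e : R) : set 'rV[R]_m :=
  [set w | forall i, `|w 0 i - v 0 i| < e].

Lemma cube_near m (v : 'rV[R]_m) e : 0 < e -> nbhs v (cube v e).
Proof. by move=> e0; apply/near_rVP; exists e. Qed.

Lemma cube_nbhs m (v w : 'rV[R]_m) e : cube v e w -> nbhs w (cube v e).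
Proof.
move=> hw; apply: (@filter_forall _ _ _ (nbhs w)) => i.
have h : (fun u : 'rV[R]_m => `|u 0 i - v 0 i|) @ w --> `|w 0 i - v 0 i|.
  have h0 : (fun u : 'rV[R]_m => u 0 i - v 0 i) @ w --> w 0 i - v 0 i.
    by apply: ctsD; [exact: coord_continuous | exact: ctsC].
  exact: cvg_norm h0.
exact: cts_lt h (hw i).
Qed.

Lemma cube_open m (v : 'rV[R]_m) e : open (cube v e).
Proof. by rewrite openE => w; exact: cube_nbhs. Qed.

Lemma smooth_prod m (I : Type) (r : seq I) (F : I -> 'rV[R]_m -> R) :
  (forall i, smooth (F i)) -> smooth (fun v => \prod_(i <- r) F i v).
Proof.
move=> h; elim: r => [|i r IH].
  by under eq_fun do rewrite big_nil; exact: smooth_cst.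
by under eq_fun do rewrite big_cons; exact: smoothM.
Qed.

(** Multiplication by a product of one-variable bumps. The values of f outside the cube are
    arbitrary, which is harmless because the product of bumps vanishes near every point outside
    it. *)
Lemma smooth_localize m (v0 : 'rV[R]_m) (e : R) (f : 'rV[R]_m -> R) : 0 < e ->
  smooth_on (cube v0 e) f ->
  exists2 g, smooth g & \forall v \near v0, g v = f v.
Proof.
move=> e0 sf.
(* Equal to 1 at the centre and at most 0 once the i-th coordinate leaves the cube; the square
   replaces the absolute value, which is not smooth. *)
pose q (i : 'I_m) (v : 'rV[R]_m) : R := 1 - ((v 0 i - v0 0 i) / e) ^+ 2.
pose chi v := \prod_(i < m) step (q i v).
have sq i : smooth (q i).
  have sl : smooth (fun v : 'rV[R]_m => (v 0 i - v0 0 i) / e).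
    apply: smoothM; last exact: smooth_cst.
    by apply: smoothD; [exact: smooth_coord | exact: smooth_cst].
  rewrite /q; under eq_fun do rewrite -mulN1r expr2.
  apply: smoothD; first exact: smooth_cst.
  by apply: smoothM; [exact: smooth_cst | exact: smoothM].
have schi : smooth chi by apply: smooth_prod => i; exact: smooth_step.
exists (fun v => chi v * f v).
  apply: smooth_loc => v; have [hv|] := pselect (cube v0 e v).
    exists (cube v0 e) => // k; apply: Ck_on_mul; [exact: cube_open| |exact: sf].
    exact: smooth_smooth_on.
  move/existsNP => [i /negP]; rewrite -leNgt => hi.
  have qi : q i v < 4^-1.
    have : 1 <= `|(v 0 i - v0 0 i) / e| ^+ 2.
      by rewrite exprn_ege1// normrM (gtr0_norm (_ : 0 < e^-1)) ?invr_gt0// ler_pdivlMr// mul1r.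
    by rewrite real_normK ?num_real// /q => h; lra.
  have : \forall w \near v, q i w < 4^-1 by apply: (@cts_lt 'rV[R]_m (q i) v _ _ _ qi); exact: smooth_cvg.
  move=> /near_rVP[d d0 hd]; exists (cube v d); first by move=> j; rewrite subrr normr0.
  apply: (@smooth_on_ext _ _ _ (fun=> 0)); first exact: cube_open.
    move=> w /hd hw; rewrite /chi (bigD1 i)//= step0 ?mul0r//; exact: ltW.
  by apply: smooth_smooth_on; exact: smooth_cst.
have hq (i : 'I_m) : \forall v \near v0, 3 / 4 < q i v.
  apply: (@cts_gt 'rV[R]_m (q i) v0 (q i v0)); first exact: smooth_cvg.
  by rewrite /q subrr mul0r expr0n subr0; lra.
have := @filter_forall _ _ _ (nbhs v0) (nbhs_filter v0) hq.
apply: filterS => v hv; rewrite /chi big1 ?mul1r// => i _.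
by rewrite step1// ltW.
Qed.

End Localize.

(** * The implicit function theorem for one equation *)

Section Implicit.
Context {R : realType}.
Variable m : nat.
Implicit Types (v w : 'rV[R]_m) (t : R).

Definition ext (v : 'rV[R]_m) (t : R) : 'rV[R]_(m + 1) :=
  \row_j match fintype.split j with inl l => v 0 l | inr _ => t end.
Let it : 'I_(m + 1) := rshift m ord0.

Lemma ext_line v t h : h *: unitv it + ext v t = ext v (t + h).
Proof.
apply/rowP => j; rewrite !mxE /=; case: splitP => l jl.
  have -> : (j == it) = false.
    by apply/eqP => e; have := ltn_ord l; rewrite -jl e /= addn0 ltnn.
  by rewrite mulr0 add0r.
have -> : j == it by apply/eqP/val_inj; rewrite /= jl; case: l {jl} => -[].
by rewrite mulr1 addrC.
Qed.

Lemma ext_line1 v t h (i : 'I_m) :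
  ext (h *: unitv i + v) t = h *: unitv (lshift 1 i) + ext v t.
Proof.
apply/rowP => j; rewrite !mxE /=; case: splitP => l jl.
  by rewrite !mxE /= -!val_eqE /= jl.
have -> : (j == lshift 1 i) = false.
  by apply/eqP => e; have := ltn_ord i; move: jl; rewrite e /= => ->; rewrite ltnNge leq_addr.
by rewrite mulr0 add0r.
Qed.

Lemma ext_cvg (T : topologicalType) (f : T -> 'rV[R]_m) (g : T -> R) (x : T) v t :
  f @ x --> v -> g @ x --> t -> (fun y => ext (f y) (g y)) @ x --> ext v t.
Proof.
move=> fv gt; apply: cvg_rV => j; rewrite mxE; case: (fintype.split j) => // l.
exact: cvg_comp fv (@coord_continuous _ _ _ 0 l v).
Qed.

Lemma ext_cvgF (T : Type) (F : set_system T) (f : T -> 'rV[R]_m) (g : T -> R) v t :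
  Filter F -> f x @[x --> F] --> v -> g x @[x --> F] --> t -> ext (f y) (g y) @[y --> F] --> ext v t.
Proof.
move=> FF fv gt; apply: cvg_rVF => j; rewrite mxE; case: (fintype.split j) => // l.
exact: cvg_comp fv (@coord_continuous _ _ _ 0 l v).
Qed.

(** P is strictly increasing in the last variable on a box, so the intermediate value theorem gives
    a zero T v. The mean value theorem yields continuity of T and the quotient formula for its
    derivatives, and this formula gives all orders of smoothness. The solution is finally replaced
    by a globally smooth function, hence the equation only near v0. *)
Lemma implicit_pos (P : 'rV[R]_(m + 1) -> R) (v0 : 'rV[R]_m) (t0 : R) :
  smooth P -> P (ext v0 t0) = 0 -> 0 < 'D_(unitv it) P (ext v0 t0) ->
  exists2 T : 'rV[R]_m -> R, smooth T &
    T v0 = t0 /\ \forall v \near v0, P (ext v (T v)) = 0.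
Proof.
move=> sP P0 D0; pose D := 'D_(unitv it) P; pose a := D (ext v0 t0) / 2.
have a0 : 0 < a by rewrite divr_gt0.
have sD : smooth D by exact: smooth_derive.
have cP (w : 'rV[R]_(m + 1)) : P @ w --> P w by exact: smooth_cvg.
have cD (w : 'rV[R]_(m + 1)) : D @ w --> D w by exact: smooth_cvg.
have [r r0 hr] : exists2 r : R, 0 < r & forall v t,
    cube v0 r v -> `|t - t0| < r -> a < D (ext v t).
  have : \forall w \near ext v0 t0, a < D w.
    by apply: cts_gt (cD _) _; rewrite /a ltr_pdivrMr// ltr_pMr// ltr1n.
  move=> /near_rVP[r r0 hr]; exists r => // v t hv ht; apply: hr => i.
  by rewrite !mxE; case: (fintype.split i) => // l; exact: hv.
(* A point within d of t0, moved by at most 2 d, stays within 3 d < r, where the derivative exceeds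
   a. *)
pose d := r / 4.
have d0 : 0 < d by rewrite divr_gt0.
have mvt v t h : cube v0 r v -> `|t - t0| <= d -> `|h| <= 2 * d ->
    exists2 s, `|s| <= `|h| & P (ext v (t + h)) - P (ext v t) = h * D (ext v (t + s))
      /\ a < D (ext v (t + s)).
  move=> hv ht hh.
  have [s hs e] := @MVT_line R _ P (ext v t) (unitv it) h (fun s _ => @smooth_derivable R _ P _ _ sP).
  exists s => //; rewrite !ext_line in e; rewrite e; split=> //; apply: hr => //.
  rewrite addrAC (le_lt_trans (ler_normD _ _))//.
  have : `|s| <= 2 * d by apply: le_trans hh.
  by rewrite /d in ht *; lra.
have c0 : cube v0 r v0 by move=> i; rewrite subrr normr0.
have [e [e0 er eN eP]] : exists e, [/\ 0 < e, e <= r,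
    forall v, cube v0 e v -> P (ext v (t0 - d)) < 0 &
    forall v, cube v0 e v -> 0 < P (ext v (t0 + d))].
  have pos : 0 < P (ext v0 (t0 + d)).
    have [||s _ []] := @mvt v0 t0 d c0; rewrite ?subrr ?normr0 ?gtr0_norm//; try lra.
    by rewrite P0 subr0 => -> h; rewrite mulr_gt0// (lt_trans a0).
  have neg : P (ext v0 (t0 - d)) < 0.
    have [||s _ []] := @mvt v0 t0 (- d) c0; rewrite ?subrr ?normr0 ?normrN ?gtr0_norm//; try lra.
    by rewrite P0 subr0 => -> h; rewrite mulNr oppr_lt0 mulr_gt0// (lt_trans a0).
  have cE t : (fun v => P (ext v t)) @ v0 --> P (ext v0 t).
    have h : (fun v => ext v t) @ v0 --> ext v0 t by apply: ext_cvg; [exact: cvg_id|exact: ctsC].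
    exact: cvg_comp h (cP _).
  have : \forall v \near v0, P (ext v (t0 - d)) < 0 /\ 0 < P (ext v (t0 + d)).
    by apply: filterI; [exact: cts_lt (cE _) neg | exact: cts_gt (cE _) pos].
  move=> /near_rVP[e e0 he]; exists (Num.min e r); split.
  - by rewrite lt_min e0.
  - by rewrite ge_min lexx orbT.
  - by move=> v hv; case: (he v) => // i; have := hv i; rewrite lt_min => /andP[].
  - by move=> v hv; case: (he v) => // i; have := hv i; rewrite lt_min => /andP[].
have Br v : cube v0 e v -> cube v0 r v by move=> hv i; exact: lt_le_trans (hv i) er.
have cl v : continuous (fun t => P (ext v t)).
  move=> t; have h : (fun t => ext v t) @ t --> ext v t by apply: ext_cvg; [exact: cvg_cst|exact: cvg_id].
  exact: cvg_comp h (cP _).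
have /choice[T hT] : forall v, exists t, cube v0 e v -> `|t - t0| <= d /\ P (ext v t) = 0.
  move=> v; have [hv|] := pselect (cube v0 e v); last by exists 0.
  have dd : t0 - d <= t0 + d by lra.
  have [||t] := @IVT R (fun t => P (ext v t)) (t0 - d) (t0 + d) 0 dd.
  - exact: continuous_subspaceT (cl v).
  - by rewrite ge_min le_max (ltW (eN v hv)) (ltW (eP v hv)) orbT.
  rewrite in_itv /= => /andP[h1 h2] h3; exists t => _; split=> //.
  by rewrite ler_norml; apply/andP; split; lra.
(* the mean value theorem between [(w, T v)] and [(w, T w)] *)
have /choice[S hS] : forall vw : 'rV[R]_m * 'rV[R]_m, exists s,
    cube v0 e vw.1 -> cube v0 e vw.2 ->
    [/\ `|s| <= `|T vw.2 - T vw.1|, a < D (ext vw.2 (T vw.1 + s))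
     & - P (ext vw.2 (T vw.1)) = (T vw.2 - T vw.1) * D (ext vw.2 (T vw.1 + s))].
  move=> [v w] /=; have [hv|] := pselect (cube v0 e v); last by exists 0.
  have [hw|] := pselect (cube v0 e w); last by exists 0.
  have [tv _] := hT v hv; have [tw Pw] := hT w hw.
  have [|s hs []] := @mvt w (T v) (T w - T v) (Br w hw) tv.
    rewrite (le_trans (ler_distD t0 _ _))// [`|t0 - _|]distrC.
    by lra.
  by rewrite [T v + (_ - _)]addrC subrK Pw sub0r => h1 h2; exists s.
have Tc v : cube v0 e v -> T @ v --> T v.
  move=> hv; apply/ctsP => z z0.
  have h : (fun w => P (ext w (T v))) @ v --> (0 : R).
    have [_ <-] := hT v hv.
    have h : (fun w => ext w (T v)) @ v --> ext v (T v) by apply: ext_cvg; [exact: cvg_id|exact: ctsC].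
    exact: cvg_comp h (cP _).
  have /ctsP /(_ (z * a) (mulr_gt0 z0 a0)) h' := h.
  have : nbhs v (cube v0 e) by apply: open_nbhs_nbhs; split=> //; exact: cube_open.
  apply: filterS2 h' => w; rewrite sub0r normrN => h' hw.
  have [_ h1 h2] := hS (v, w) hv hw; rewrite /= in h1 h2.
  rewrite distrC -(ltr_pM2r a0); apply: le_lt_trans h'.
  rewrite -[leRHS]normrN h2 normrM ler_wpM2l//.
  by rewrite (le_trans (ltW h1))// ler_norm.
have dT v i : cube v0 e v -> is_derive v (unitv i) T
    (- 'D_(unitv (lshift 1 i)) P (ext v (T v)) / D (ext v (T v))).
  move=> hv.
  have hl : (fun h : R => h *: unitv i + v) @ (0 : R)^' --> v.
    move=> Q hQ; apply: (@cvg_within _ (nbhs (0 : R))).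
    have : (fun h : R => h *: unitv i + v) @ (0 : R) --> v.
      rewrite -[X in _ --> X]add0r -(scale0r (unitv i)).
      by apply: cvgD; [apply: cvgZr_tmp | exact: cvg_cst].
    exact.
  have hin : \forall h \near (0 : R)^', cube v0 e (h *: unitv i + v).
    exact: hl _ (cube_nbhs hv).
  have h : h^-1 *: (T (h *: unitv i + v) - T v) @[h --> (0 : R)^'] -->
      - 'D_(unitv (lshift 1 i)) P (ext v (T v)) / D (ext v (T v)).
    pose w h := h *: unitv i + v.
    (* Since P vanishes at (v, T v) and at (w h, T (w h)), the increment of T times the derivative
       at an intermediate point is minus the increment of P with last variable fixed at T v. *)
    apply: (@cvg_trans _ ((fun h => - (h^-1 *: (P (ext (w h) (T v)) - P (ext v (T v))))
        / D (ext (w h) (T v + S (v, w h)))) @ (0 : R)^')).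
      apply: near_eq_cvg; near=> h.
      have hw : cube v0 e (w h) by near: h.
      have [_ h1 h2] := hS (v, w h) hv hw; rewrite /= in h1 h2.
      rewrite /GRing.scale /= (hT v hv).2 subr0 -mulrN h2 -mulrA mulfK//.
      by rewrite gt_eqF// (lt_trans a0).
    apply: cvgM.
      apply: cvgN.
      have := @smooth_derivable R _ P (lshift 1 i) (ext v (T v)) sP.
      rewrite /derivable /derive.
      by under eq_fun do rewrite /= -ext_line1; exact.
    apply: cvgV; first by rewrite gt_eqF// (lt_trans a0)//; apply: hr; [exact: Br | have [] := hT v hv; rewrite /d; lra].
    have hS0 : (fun h => T v + S (v, w h)) @ (0 : R)^' --> T v.
      rewrite -[X in _ --> X]addr0; apply: cvgD; first exact: cvg_cst.
      apply: norm_cvg0.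
      apply: (@squeeze_cvgr _ _ _ _ (fun=> 0) (fun h => `|T (w h) - T v|)).
      - near=> h; rewrite normr_ge0 /=.
        have hw : cube v0 e (w h) by near: h.
        by have [] := hS (v, w h) hv hw.
      - exact: cvg_cst.
      - rewrite -[X in _ --> X](normr0 R) -[X in `|X|](subrr (T v)).
        apply: cvg_norm; apply: cvgB; last exact: cvg_cst.
        exact: cvg_comp hl (Tc v hv).
    have hE : (fun h => ext (w h) (T v + S (v, w h))) @ (0 : R)^' --> ext v (T v).
      exact: ext_cvgF hl hS0.
    exact: cvg_comp hE (cD _).
  apply: DeriveDef; first by apply/cvg_ex; eexists; exact: h.
  by apply: cvg_lim h.
(* Bootstrapping: the derivative of T is a smooth expression in v and T v, and T is of class C^k by
   induction. *)
have ck k : Ck_on (cube v0 e) k T.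
  elim: k => [|k IH]; first by move=> v; exact: Tc.
  split=> [v|i]; first exact: Tc.
  split=> [v hv|]; first by case: (dT v i hv).
  have oB : open (cube v0 e) by exact: cube_open.
  have ce (Q : 'rV[R]_(m + 1) -> R) : smooth Q -> Ck_on (cube v0 e) k (fun v => Q (ext v (T v))).
    move=> /smooth_onT sQ.
    apply: (@Ck_on_comp R (m + 1) m setT (cube v0 e) k Q (fun j v =>
      match fintype.split j with inl l => v 0 l | inr _ => T v end) openT oB) => // j.
    by case: (fintype.split j) => // l; exact: Ck_on_coord.
  have := Ck_on_mul oB (Ck_on_mul oB (Ck_on_cst _ k (-1)) (ce _ (smooth_derive (lshift 1 i) sP)))
     (Ck_on_inv oB _ (ce _ sD)).
  move=> cc; apply: Ck_on_ext oB _ (cc _) => v hv.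
    by have [_ ->] := dT v i hv; rewrite mulN1r.
  by rewrite gt_eqF// (lt_trans a0)//; apply: hr; [exact: Br | have [] := hT v hv; rewrite /d; lra].
have [g sg hg] := smooth_localize e0 ck.
(* T comes from a choice, so its value at v0 must be recovered: both T v0 and t0 are zeros of a
   function with positive derivative between them. *)
have Tv0 : T v0 = t0.
  have hv0 : cube v0 e v0 by move=> i; rewrite subrr normr0.
  have [t1 P1] := hT v0 hv0.
  have tt : `|t0 - t0| <= d by rewrite subrr normr0 ltW.
  have [|s _ []] := @mvt v0 t0 (T v0 - t0) c0 tt; first by lra.
  rewrite [t0 + (_ - _)]addrC subrK P1 P0 subrr => /esym/eqP; rewrite mulf_eq0 subr_eq0 => /orP[/eqP//|].
  by move=> /eqP -> ; rewrite ltNge ltW.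
exists g => //; split; first by rewrite (nbhs_singleton hg).
apply: filterS2 hg (cube_near v0 e0) => v -> hv.
by have [] := hT v hv.
Unshelve. all: by end_near. Qed.

Lemma implicit_function (P : 'rV[R]_(m + 1) -> R) (v0 : 'rV[R]_m) (t0 : R) :
  smooth P -> P (ext v0 t0) = 0 -> 'D_(unitv (rshift m ord0)) P (ext v0 t0) != 0 ->
  exists2 T : 'rV[R]_m -> R, smooth T &
    T v0 = t0 /\ \forall v \near v0, P (ext v (T v)) = 0.
Proof.
move=> sP P0; rewrite neq_lt => /orP[D0|]; last exact: implicit_pos.
have sN : smooth (fun w : 'rV[R]_(m + 1) => -1 * P w) by apply: smoothM => //; exact: smooth_cst.
have [||T sT [Tv hT]] := implicit_pos sN (_ : -1 * P (ext v0 t0) = 0).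
- by rewrite P0 mulr0.
- have -> : (fun w : 'rV[R]_(m + 1) => -1 * P w) = (fun w : 'rV[R]_(m + 1) => - P w) by apply/funext => w; rewrite mulN1r.
  by rewrite deriveN ?oppr_gt0//; exact: smooth_derivable.
exists T => //; split=> //; apply: filterS hT => v /eqP.
by rewrite mulN1r oppr_eq0 => /eqP.
Qed.

End Implicit.

Section Hadamard_sum.
Context {R : realType}.

(** Telescoping along the path that replaces the coordinates of w by those of v one at a time; each
    increment is a coordinate difference times a [hadq], and at v the integrand is constant. *)
Lemma hadamard m (f : 'rV[R]_m -> R) (v : 'rV[R]_m) : smooth f ->
  exists q : 'I_m -> 'rV[R]_m -> R, (forall i, smooth (q i)) /\
   [/\ forall w, f w - f v = \sum_(i < m) (w 0 i - v 0 i) * q i w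
     & forall i, q i v = 'D_(unitv i) f v].
Proof.
move=> sf.
pose pa (k : nat) (w : 'rV[R]_m) : 'rV[R]_m := \row_l if (l < k)%N then v 0 l else w 0 l.
pose q (i : 'I_m) (w : 'rV[R]_m) := hadq i (v 0 i) 0 (fun u => 'D_(unitv i) f u) (pa i w).
have paS (i : 'I_m) w : pa i.+1 w = interp i (v 0 i) 0 (pa i w).
  apply/rowP => l; rewrite !mxE ltnS leq_eqVlt.
  by case: (eqVneq l i) => [->|li]; [rewrite eqxx mul0r addr0 | rewrite -val_eqE in li; rewrite (negbTE li)].
exists q; split=> [i|].
  apply: (@smooth_comp R m m (hadq i (v 0 i) 0 (fun u => 'D_(unitv i) f u))
    (fun l w => if (l < i)%N then v 0 l else w 0 l)) => [|j].
    by apply: smooth_hadq; exact: smooth_derive.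
  by case: (j < i)%N; [exact: smooth_cst|exact: smooth_coord].
split=> [w|i].
  have -> : f w - f v = - (f (pa m w) - f (pa 0 w)).
    rewrite opprB; congr (f _ - f _); apply/rowP => l; rewrite mxE ?ltn_ord//.
  rewrite -(telescope_sumr (fun k => f (pa k w)) (leq0n m)) big_mkord -sumrN.
  apply: eq_bigr => i _; rewrite opprB paS hadq_eq// mxE ltnn //.
have pv : pa i v = v by apply/rowP => l; rewrite mxE; case: ifP.
by rewrite /q pv hadq_diag.
Qed.

End Hadamard_sum.

(** * Smooth functions and derivations on spaces *)

Section Gen.
Context {R : realType}.

Lemma finite_min (I : finType) (e : I -> R) :
  (forall i, 0 < e i) -> exists2 d : R, 0 < d & forall i, d <= e i.
Proof.
move=> e0; exists (\big[Num.min/1]_i e i); first by apply/bigmin_gtP.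
by move=> i; exact: bigmin_le.
Qed.

Lemma gen_incl (T : Type) (F0 : set (T -> R)) f : F0 f -> gen F0 f.
Proof.
move=> Ff x; exists 1%N, (fun=> f), (fun v => v 0 0), 1; split=> //.
  exact: smooth_coord.
by move=> y _; rewrite mxE.
Qed.

(** The tool that reduces smoothness of a map to generators. The inner generators needed for all the
    g_i are merged into one finite family, indexed by the dependent sum J, and the outer expression
    is composed with the inner ones. *)
Lemma gen_bind (T U : Type) (h : T -> U) (F0 : set (U -> R)) (F1 : set (T -> R)) :
  (forall f, F0 f -> gen F1 (f \o h)) -> forall f, gen F0 f -> gen F1 (f \o h).
Proof.
move=> H f gf x; have [m [g [phi [eps [eps0 Fg sphi E]]]]] := gf (h x).
pose spec := {k : nat & (('I_k -> T -> R) * ('rV[R]_k -> R) * R)%type}.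
have /choice[s hs] : forall i, exists s : spec,
    [/\ 0 < (tagged s).2, forall l, F1 ((tagged s).1.1 l), smooth (tagged s).1.2 &
     forall y, (forall l, `|(tagged s).1.1 l y - (tagged s).1.1 l x| < (tagged s).2) ->
       g i (h y) = (tagged s).1.2 (\row_l (tagged s).1.1 l y)].
  move=> i; have [k [g' [phi' [eps' ?]]]] := H _ (Fg i) x.
  by exists (existT _ k (g', phi', eps')).
pose k i := tag (s i).
pose gg i : 'I_(k i) -> T -> R := (tagged (s i)).1.1.
pose pp i : 'rV[R]_(k i) -> R := (tagged (s i)).1.2.
pose J : finType := {i : 'I_m & 'I_(k i)}.
pose G (j : 'I_#|J|) : T -> R := gg (tag (enum_val j)) (tagged (enum_val j)).
pose rk i (l : 'I_(k i)) : 'I_#|J| := enum_rank (Tagged (fun i => 'I_(k i)) l).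
pose pi i (w : 'rV[R]_#|J|) := pp i (\row_l w 0 (rk i l)).
pose psi (w : 'rV[R]_#|J|) := phi (\row_i pi i w).
have Gr i l y : G (rk i l) y = gg i l y by rewrite /G /rk enum_rankK.
have spi i : smooth (pi i).
  by have [_ _ sp _] := hs i; apply: smooth_comp => // l; exact: smooth_coord.
have [d d0 hd] : exists2 d : R, 0 < d & forall i, d <= (tagged (s i)).2.
  by apply: finite_min => i; have [] := hs i.
pose w0 : 'rV[R]_#|J| := \row_j G j x.
(* The outer expression is valid for values of the g_i close to those at x; continuity of [pi] turns
   this into closeness of the merged generators. *)
have : \forall w \near w0, forall i, `|pi i w0 - pi i w| < eps.
  apply: (@filter_forall _ _ _ (nbhs w0)) => i.
  by have /ctsP := @smooth_cvg R _ (pi i) w0 (spi i); exact.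
move=> /near_rVP[d' d'0 hd'].
exists #|J|, G, psi, (Num.min d d'); split.
- by rewrite lt_min d0.
- by move=> j; have [_ h1 _ _] := hs (tag (enum_val j)); exact: h1.
- exact: smooth_comp.
move=> y hy.
have gi i : g i (h y) = pi i (\row_j G j y).
  have [_ _ _ ->] := hs i; last first.
    move=> l; have := hy (rk i l); rewrite !Gr lt_min => /andP[h1 _].
    exact: lt_le_trans h1 (hd i).
  by congr pp; apply/rowP => l; rewrite !mxE Gr.
have gi0 i : g i (h x) = pi i w0.
  have [e0 _ _ ->] := hs i; last by move=> l; rewrite subrr normr0.
  by congr pp; apply/rowP => l; rewrite !mxE Gr.
rewrite /= E.
  by congr phi; apply/rowP => i; rewrite !mxE.
move=> i; rewrite gi gi0 distrC; apply: hd' => j.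
by rewrite !mxE; have := hy j; rewrite lt_min => /andP[].
Qed.

Lemma gen_idem (T : Type) (F0 : set (T -> R)) f : gen (gen F0) f -> gen F0 f.
Proof. exact: (@gen_bind T T id). Qed.

End Gen.

(** * Locality and the smooth calculus on spaces *)

Section Near.
Context {R : realType}.
Implicit Types M N : bspace R.

(** The manifold axiom on which the local calculus rests. It passes to products, subspaces,
    b-cotangent bundles and quotients, so the same calculus applies on all of them. *)
Definition gclosed M := forall f, gen (cinf M) f -> cinf M f.

(* [P] holds on a neighbourhood of [x]; [bopen U] is [forall x, U x -> bnear x U]. *)
Definition bnear M (x : M) (P : M -> Prop) : Prop :=
  exists2 f, cinf M f & f x != 0 /\ forall y, f y != 0 -> P y.

Lemma bnear_self M (x : M) P : bnear x P -> P x.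
Proof. by move=> [f _ [fx]]; exact. Qed.

Lemma bnear_near M (x : M) P : bnear x P -> bnear x (fun y => bnear y P).
Proof. by move=> [f cf [fx h]]; exists f => //; split=> // y fy; exists f. Qed.

Lemma bnearS M (x : M) (P Q : M -> Prop) :
  (forall y, P y -> Q y) -> bnear x P -> bnear x Q.
Proof. by move=> PQ [f cf [fx h]]; exists f => //; split=> // y /h /PQ. Qed.

Lemma bnear_smooth M N (h : M -> N) (x : M) P :
  smooth_map h -> bnear (h x) P -> bnear x (fun y => P (h y)).
Proof. by move=> sh [f cf [fx H]]; exists (f \o h); [exact: sh|split=> // y; exact: H]. Qed.

Section Closed.
Variable M : bspace R.
Hypothesis gM : gclosed M.

Lemma cinf_comp m (phi : 'rV[R]_m -> R) (g : 'I_m -> M -> R) :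
  smooth phi -> (forall i, cinf M (g i)) -> cinf M (fun x => phi (\row_i g i x)).
Proof. by move=> sp cg; apply: gM => x; exists m, g, phi, 1; split. Qed.

Lemma cinf_cst (a : R) : cinf M (fun=> a).
Proof. by apply: (@cinf_comp 0 (fun=> a) (fun _ _ => 0)) => [|[]//]; exact: smooth_cst. Qed.

Lemma cinfD f g : cinf M f -> cinf M g -> cinf M (fun x => f x + g x).
Proof.
move=> cf cg; have := @cinf_comp 2 (fun v => v 0 0 + v 0 1) (fun i => if i == 0 then f else g).
under [X in _ -> _ -> cinf _ X]eq_fun do rewrite !mxE /=.
apply; first by apply: smoothD; exact: smooth_coord.
by move=> i; case: ifP.
Qed.

Lemma cinfM f g : cinf M f -> cinf M g -> cinf M (fun x => f x * g x).
Proof.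
move=> cf cg; have := @cinf_comp 2 (fun v => v 0 0 * v 0 1) (fun i => if i == 0 then f else g).
under [X in _ -> _ -> cinf _ X]eq_fun do rewrite !mxE /=.
apply; first by apply: smoothM; exact: smooth_coord.
by move=> i; case: ifP.
Qed.

Lemma cinfN f : cinf M f -> cinf M (fun x => - f x).
Proof.
by move=> cf; under eq_fun do rewrite -mulN1r; apply: cinfM => //; exact: cinf_cst.
Qed.

Lemma cinfB f g : cinf M f -> cinf M g -> cinf M (fun x => f x - g x).
Proof. by move=> cf cg; apply: cinfD => //; exact: cinfN. Qed.

Lemma cinf_sum (I : Type) (r : seq I) (P : pred I) (f : I -> M -> R) :
  (forall i, P i -> cinf M (f i)) -> cinf M (fun x => \sum_(i <- r | P i) f i x).
Proof.
move=> h; elim: r => [|i r IH].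
  by under eq_fun do rewrite big_nil; exact: cinf_cst.
have [Pi|nPi] := boolP (P i); last by under eq_fun do rewrite big_cons (negbTE nPi).
by under eq_fun do rewrite big_cons Pi; apply: cinfD => //; exact: h.
Qed.

Lemma bnearT (x : M) : bnear x (fun=> True).
Proof. by exists (fun=> 1); [exact: cinf_cst|rewrite oner_eq0]. Qed.

Lemma bnearI (x : M) (P Q : M -> Prop) :
  bnear x P -> bnear x Q -> bnear x (fun y => P y /\ Q y).
Proof.
move=> [f cf [fx hf]] [g cg [gx hg]]; exists (fun y => f y * g y); first exact: cinfM.
split=> [|y]; first by rewrite mulf_neq0.
by rewrite mulf_eq0 negb_or => /andP[/hf ? /hg ?].
Qed.

Lemma bnear_all (x : M) n (P : 'I_n -> M -> Prop) :
  (forall i, bnear x (P i)) -> bnear x (fun y => forall i, P i y).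
Proof.
elim: n P => [|n IH] P h.
  by apply: bnearS (bnearT x) => y _ [].
have := bnearI (h ord0) (IH (fun i => P (lift ord0 i)) (fun i => h _)).
apply: bnearS => y [h0 hS] i.
by case: (unliftP ord0 i) => [j ->|->].
Qed.

(** [flat 0 (f - a)] is a smooth function whose nonvanishing set is exactly f > a. *)
Lemma bnear_gt (x : M) f a : cinf M f -> a < f x -> bnear x (fun y => a < f y).
Proof.
move=> cf fx; exists (fun y => flat 0 (f y - a)).
  have := @cinf_comp 1 (fun v => flat 0 (v 0 0 - a)) (fun=> f).
  under [X in _ -> _ -> cinf _ X]eq_fun do rewrite !mxE /=.
  apply=> //; apply: smooth_flat; apply: smoothD; [exact: smooth_coord|exact: smooth_cst].
split=> [|y]; first by rewrite gt_eqF// flat_gt0// subr_gt0.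
by rewrite ltNge; apply: contra => h; rewrite flat_eq0// subr_le0.
Qed.

Lemma bnear_lt (x : M) f a : cinf M f -> f x < a -> bnear x (fun y => f y < a).
Proof.
move=> cf fx; apply: bnearS (bnear_gt (cinfN cf) (_ : - a < - f x)); last by rewrite ltrN2.
by move=> y; rewrite ltrN2.
Qed.

Lemma bnear_neq (x : M) f a : cinf M f -> f x != a -> bnear x (fun y => f y != a).
Proof.
move=> cf fx; exists (fun y => f y - a); first by apply: cinfB => //; exact: cinf_cst.
by rewrite subr_eq0; split=> // y; rewrite subr_eq0.
Qed.

Lemma bnear_rV (x : M) m (g : 'I_m -> M -> R) (P : 'rV[R]_m -> Prop) :
  (forall i, cinf M (g i)) -> (\forall v \near \row_i g i x, P v) ->
  bnear x (fun y => P (\row_i g i y)).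
Proof.
move=> cg /near_rVP[e e0 he].
have : bnear x (fun y => forall i, g i x - e < g i y /\ g i y < g i x + e).
  apply: bnear_all => i; apply: bnearI.
    by apply: bnear_gt => //; rewrite ltrBlDr ltrDl.
  by apply: bnear_lt => //; rewrite ltrDl.
apply: bnearS => y hy; apply: he => i; rewrite !mxE ltr_norml.
by have [h1 h2] := hy i; apply/andP; split; lra.
Qed.

Definition lcinf (x : M) f := exists2 f', cinf M f' & bnear x (fun y => f y = f' y).

(** The function k that cuts out the neighbourhood is added to f' as a second generator: within |k
    x| of k x it cannot vanish, so the topology of the generators sees where f = f'. *)
Lemma cinf_local f : (forall x, lcinf x f) -> cinf M f.
Proof.
move=> h; apply: gM => x; have [f' cf' [k ck [kx hk]]] := h x.
exists 2, (fun i => if i == 0 then f' else k), (fun v => v 0 0), `|k x|; split.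
- by rewrite normr_gt0.
- by move=> i; case: ifP.
- exact: smooth_coord.
move=> y hy; rewrite mxE /=; apply: hk.
have := hy 1; rewrite /=; apply: contraTneq => ->.
by rewrite sub0r normrN ltxx.
Qed.

Lemma lcinf_cinf x f : cinf M f -> lcinf x f.
Proof. by move=> cf; exists f => //; apply: bnearS (bnearT x). Qed.

Lemma lcinf_ext x f g : bnear x (fun y => f y = g y) -> lcinf x f -> lcinf x g.
Proof.
move=> fg [f' cf' h]; exists f' => //.
by apply: bnearS (bnearI fg h) => y [<-].
Qed.

Lemma lcinfM x f g : lcinf x f -> lcinf x g -> lcinf x (fun y => f y * g y).
Proof.
move=> [f' cf hf] [g' cg hg]; exists (fun y => f' y * g' y); first exact: cinfM.
by apply: bnearS (bnearI hf hg) => y [-> ->].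
Qed.

Lemma lcinfV x f : cinf M f -> f x != 0 -> lcinf x (fun y => (f y)^-1).
Proof.
move=> cf fx; pose v0 : 'rV[R]_1 := \row_i f x.
have e0 : 0 < `|f x| by rewrite normr_gt0.
have : smooth_on (cube v0 `|f x|) (fun v : 'rV[R]_1 => (v 0 0)^-1).
  move=> k; apply: Ck_on_inv; [exact: cube_open| |exact: Ck_on_coord].
  move=> v /(_ 0); rewrite !mxE; apply: contraTneq => ->.
  by rewrite sub0r normrN ltxx.
move=> /(smooth_localize e0)[g sg hg].
exists (fun y => g (\row_(i < 1) f y)); first exact: (@cinf_comp 1 g (fun=> f)).
have := @bnear_rV x 1 (fun=> f) _ (fun=> cf) hg.
by apply: bnearS => y ->; rewrite mxE.
Qed.

(** Stated as an open alternative at every point rather than through a support: this is the form in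
    which products with chi are extended by zero. The square of f / f x is 1 at x and 0 where f
    vanishes, so [step] is constant near both. *)
Lemma bump_exists (x : M) (P : M -> Prop) : bnear x P ->
  exists2 chi, cinf M chi &
    bnear x (fun y => chi y = 1) /\
    forall y, bnear y P \/ bnear y (fun z => chi z = 0).
Proof.
move=> [f cf [fx hf]]; pose k y := (f y / f x) * (f y / f x).
have cq : cinf M (fun y => f y / f x) by apply: cinfM => //; exact: cinf_cst.
have ck : cinf M k by exact: cinfM.
exists (fun y => step (k y)).
  have := @cinf_comp 1 (fun v => step (v 0 0)) (fun=> k).
  under [X in _ -> _ -> cinf _ X]eq_fun do rewrite !mxE /=.
  by apply=> //; apply: smooth_step; exact: smooth_coord.
split.
  apply: bnearS (bnear_gt ck (_ : 3 / 4 < k x)) => [y h|].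
    by rewrite step1// ltW.
  by rewrite /k divff//; lra.
move=> y; have [fy|fy] := eqVneq (f y) 0; last by left; exists f.
right; apply: bnearS (bnear_lt ck (_ : k y < 4^-1)) => [z h|].
  by rewrite step0// ltW.
by rewrite /k fy mul0r mul0r invr_gt0.
Qed.

Lemma cinf_bump chi (P : M -> Prop) f : cinf M chi ->
  (forall y, bnear y P \/ bnear y (fun z => chi z = 0)) ->
  (forall y, P y -> lcinf y f) -> cinf M (fun y => chi y * f y).
Proof.
move=> cchi h hf; apply: cinf_local => y; have [/bnear_self Py|h0] := h y.
  by apply: lcinfM; [exact: lcinf_cinf|exact: hf].
exists (fun=> 0); first exact: cinf_cst.
by apply: bnearS h0 => z ->; rewrite mul0r.
Qed.

End Closed.
End Near.

(** * Point derivations, b-vector fields and b-covectors *)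

Section Derivations.
Context {R : realType}.
Implicit Types M N : bspace R.

Definition pder M (x : M) (D : (M -> R) -> R) : Prop :=
  (forall a f g, cinf M f -> cinf M g -> D (fun y => a * f y + g y) = a * D f + D g) /\
  (forall f g, cinf M f -> cinf M g -> D (fun y => f y * g y) = D f * g x + f x * D g).

Section One.
Variables (M : bspace R) (gM : gclosed M) (x : M) (D : (M -> R) -> R).
Hypothesis DD : pder x D.

Lemma pder0 : D (fun=> 0) = 0.
Proof.
have := DD.1 1 _ _ (cinf_cst gM 0) (cinf_cst gM 0).
under eq_fun do rewrite mulr0 addr0.
by move/eqP; rewrite mul1r -subr_eq subrr eq_sym => /eqP.
Qed.

Lemma pderZ a f : cinf M f -> D (fun y => a * f y) = a * D f.
Proof.
move=> cf; have := DD.1 a _ _ cf (cinf_cst gM 0).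
by under eq_fun do rewrite addr0; rewrite pder0 addr0.
Qed.

Lemma pderD f g : cinf M f -> cinf M g -> D (fun y => f y + g y) = D f + D g.
Proof.
by move=> cf cg; have := DD.1 1 _ _ cf cg; under eq_fun do rewrite mul1r; rewrite mul1r.
Qed.

Lemma pderN f : cinf M f -> D (fun y => - f y) = - D f.
Proof. by move=> cf; under eq_fun do rewrite -mulN1r; rewrite pderZ// mulN1r. Qed.

Lemma pderB f g : cinf M f -> cinf M g -> D (fun y => f y - g y) = D f - D g.
Proof. by move=> cf cg; rewrite pderD ?pderN//; exact: cinfN. Qed.

Lemma pder_cst a : D (fun=> a) = 0.
Proof.
have c1 := cinf_cst gM 1.
have D1 : D (fun=> 1) = 0.
  have := DD.2 _ _ c1 c1; under eq_fun do rewrite mulr1.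
  by move/eqP; rewrite mulr1 mul1r -subr_eq subrr eq_sym => /eqP.
by have := pderZ a c1; under eq_fun do rewrite mulr1; rewrite D1 mulr0.
Qed.

Lemma pder_sum (I : Type) (r : seq I) (f : I -> M -> R) : (forall i, cinf M (f i)) ->
  D (fun y => \sum_(i <- r) f i y) = \sum_(i <- r) D (f i).
Proof.
move=> cf; elim: r => [|i r IH].
  by rewrite big_nil; under eq_fun do rewrite big_nil; exact: pder0.
rewrite big_cons; under eq_fun do rewrite big_cons.
by rewrite pderD ?IH//; exact: cinf_sum.
Qed.

(** If k cuts out the neighbourhood, the product of f - g and k is zero, and the Leibniz rule at x
    leaves k x times D (f - g). *)
Lemma pder_local f g : cinf M f -> cinf M g -> bnear x (fun y => f y = g y) -> D f = D g.
Proof.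
move=> cf cg [k ck [kx hk]].
have cfg := cinfB gM cf cg.
have e : (fun y => (f y - g y) * k y) = fun=> 0.
  apply/funext => y; have [->|/hk ->] := eqVneq (k y) 0; first by rewrite mulr0.
  by rewrite subrr mul0r.
have := DD.2 _ _ cfg ck; rewrite e pder0 (hk x kx) subrr mul0r addr0 => /esym/eqP.
by rewrite mulf_eq0 (negbTE kx) orbF pderB// subr_eq0 => /eqP.
Qed.

(** Hadamard's expansion at the image of x: the factors g_i - g_i x vanish at x, so the Leibniz rule
    leaves D (g_i) times the value of q_i, a partial derivative of phi. *)
Lemma pder_chain m (phi : 'rV[R]_m -> R) (g : 'I_m -> M -> R) :
  smooth phi -> (forall i, cinf M (g i)) ->
  D (fun y => phi (\row_i g i y)) =
  \sum_(i < m) 'D_(unitv i) phi (\row_i g i x) * D (g i).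
Proof.
move=> sp cg; pose v : 'rV[R]_m := \row_i g i x.
have [q [sq [he hv]]] := hadamard v sp.
have cq i : cinf M (fun y => q i (\row_j g j y)) by exact: cinf_comp.
have cgx i : cinf M (fun y => g i y - g i x) by apply: cinfB => //; exact: cinf_cst.
have -> : (fun y => phi (\row_i g i y)) =
    (fun y => phi v + \sum_(i < m) (g i y - g i x) * q i (\row_j g j y)).
  apply/funext => y; rewrite -[LHS](subrK (phi v)) addrC he; congr (_ + _).
  by apply: eq_bigr => i _; rewrite !mxE.
rewrite pderD; [|exact: cinf_cst|by apply: cinf_sum => // i _; exact: cinfM].
rewrite pder_cst add0r pder_sum; last by move=> i; exact: cinfM.
apply: eq_bigr => i _; rewrite (DD.2 _ _ (cgx i) (cq i)) subrr mul0r addr0.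
rewrite pderB//; last exact: cinf_cst.
by rewrite pder_cst subr0 mulrC hv.
Qed.

End One.

Lemma pder_push M N (h : M -> N) (x : M) D : smooth_map h -> pder x D ->
  pder (h x) (fun f => D (f \o h)).
Proof.
by move=> sh [D1 D2]; split=> [a f g cf cg|f g cf cg]; [apply: D1|apply: D2]; exact: sh.
Qed.

Lemma bvf_pder M (V : op M) x : bvf V -> pder x (fun f => V f x).
Proof.
move=> [_ V2 V3 _ _]; split=> [a f g cf cg|f g cf cg]; first by rewrite V2.
by rewrite V3.
Qed.

Lemma bvf_cinf M (V : op M) f : bvf V -> cinf M f -> cinf M (V f).
Proof. by case=> + _ _ _ _; exact. Qed.

Lemma bvf_crit M (V : op M) f z : bvf V -> cinf M f -> (forall z, crit M z -> f z = 0) ->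
  crit M z -> V f z = 0.
Proof. by case=> _ _ _ _ h cf hf; exact: h. Qed.

Lemma bvf_non M (V : op M) f : bvf V -> ~ cinf M f -> V f = fun=> 0.
Proof. by case=> _ _ _ h _; exact: h. Qed.

Lemma bvf_intro M (V : op M) : (forall f, cinf M f -> cinf M (V f)) ->
  (forall x, pder x (fun f => V f x)) -> (forall f, ~ cinf M f -> V f = (fun=> 0)) ->
  (forall f, cinf M f -> (forall z, crit M z -> f z = 0) -> forall z, crit M z -> V f z = 0) ->
  bvf V.
Proof.
move=> h1 h2 h3 h4; split=> // [a f g cf cg|f g cf cg]; apply/funext => x.
  by have [-> //] := h2 x.
by have [_ -> //] := h2 x.
Qed.

Lemma pder_comb M (x : M) (a : R) D E : pder x D -> pder x E ->
  pder x (fun f => a * D f + E f).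
Proof.
move=> [D1 D2] [E1 E2]; split=> [b f g cf cg|f g cf cg].
  by rewrite D1// E1//; ring.
by rewrite D2// E2//; ring.
Qed.

Definition op0 M : op M := fun _ _ => 0.

Lemma bvf_op0 M : gclosed M -> bvf (@op0 M).
Proof.
move=> gM; apply: bvf_intro => // [f _|x]; first exact: cinf_cst.
by split=> *; rewrite /op0; ring.
Qed.

Lemma bvf_comb M f (V W : op M) : gclosed M -> cinf M f -> bvf V -> bvf W ->
  bvf (op_comb f V W).
Proof.
move=> gM cf bV bW; apply: bvf_intro => [g cg|x|g ng|g cg hg z cz].
- apply: cinfD => //; last exact: bvf_cinf.
  by apply: cinfM => //; exact: bvf_cinf.
- by apply: (pder_comb (f x)); exact: bvf_pder.
- by apply/funext => x; rewrite /op_comb (bvf_non bV ng) (bvf_non bW ng) mulr0 addr0.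
- by rewrite /op_comb (bvf_crit bV cg hg cz) (bvf_crit bW cg hg cz) mulr0 addr0.
Qed.

Lemma bvf_lieb M (V W : op M) : gclosed M -> bvf V -> bvf W -> bvf (lieb V W).
Proof.
move=> gM bV bW.
have V0 (U : op M) : bvf U -> U (fun=> 0) = fun=> 0.
  by move=> bU; apply/funext => x; exact: (pder0 gM (bvf_pder x bU)).
apply: bvf_intro => [g cg|x|g ng|g cg hg z cz].
- by apply: cinfB => //; do 2?exact: bvf_cinf => //; apply: bvf_cinf => //; exact: bvf_cinf.
- have pV := bvf_pder x bV; have pW := bvf_pder x bW.
  split=> [a f g cf cg|f g cf cg]; rewrite /lieb.
    have [_ V2 _ _ _] := bV; have [_ W2 _ _ _] := bW.
    have cVf := bvf_cinf bV cf; have cVg := bvf_cinf bV cg.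
    have cWf := bvf_cinf bW cf; have cWg := bvf_cinf bW cg.
    rewrite (W2 _ _ _ cf cg) (V2 _ _ _ cf cg) (V2 _ _ _ cWf cWg) (W2 _ _ _ cVf cVg); ring.
  have [_ _ V3 _ _] := bV; have [_ _ W3 _ _] := bW.
  rewrite W3// V3//.
  have cVf := bvf_cinf bV cf; have cVg := bvf_cinf bV cg.
  have cWf := bvf_cinf bW cf; have cWg := bvf_cinf bW cg.
  rewrite (pderD pV) ?(pderD pW); try exact: cinfM.
  rewrite !pV.2 ?pW.2 //; ring.
- by apply/funext => x; rewrite /lieb (bvf_non bW ng) (bvf_non bV ng) !V0// subrr.
- rewrite /lieb (bvf_crit bV (bvf_cinf bW cg) _ cz); last by move=> y; exact: bvf_crit.
  by rewrite (bvf_crit bW (bvf_cinf bV cg) _ cz) ?subrr// => y; exact: bvf_crit.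
Qed.

Definition op_sum M n (c : 'I_n -> M -> R) (V : 'I_n -> op M) : op M :=
  fun f x => \sum_(i < n) c i x * V i f x.

Lemma op_sum0 M (c : 'I_0 -> M -> R) V : op_sum c V = @op0 M.
Proof. by apply/funext => f; apply/funext => x; rewrite /op_sum big_ord0. Qed.

Lemma op_sumS M n (c : 'I_n.+1 -> M -> R) V :
  op_sum c V = op_comb (c ord0) (V ord0)
    (op_sum (fun i => c (lift ord0 i)) (fun i => V (lift ord0 i))).
Proof. by apply/funext => f; apply/funext => x; rewrite /op_sum big_ord_recl. Qed.

Lemma bvf_sum M n (c : 'I_n -> M -> R) (V : 'I_n -> op M) : gclosed M ->
  (forall i, cinf M (c i)) -> (forall i, bvf (V i)) -> bvf (op_sum c V).
Proof.
move=> gM; elim: n c V => [|n IH] c V cc bV; first by rewrite op_sum0; exact: bvf_op0.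
by rewrite op_sumS; apply: bvf_comb => //; exact: IH.
Qed.

Lemma bvf_smul M (V : op M) f : gclosed M -> cinf M f -> bvf V -> bvf (fun g x => f x * V g x).
Proof.
move=> gM cf bV; have := bvf_comb gM cf bV (bvf_op0 gM).
by congr bvf; apply/funext => g; apply/funext => x; rewrite /op_comb /op0 addr0.
Qed.

Lemma covecP M (a : covec M) : is_covec (base a) (cv a).
Proof. by case: a. Qed.

Lemma covec_eq M (a b : covec M) : base a = base b ->
  (forall V, bvf V -> cv a V = cv b V) -> a = b.
Proof.
case: a b => [p a ha] [q b hb] /= pq E; subst q.
have ab : a = b.
  apply/funext => V; have [/E //|nV] := pselect (bvf V).
  by rewrite ha.2// hb.2.
by subst b; congr Covec; exact: Prop_irrelevance.
Qed.

Section Covec.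
Variables (M : bspace R) (gM : gclosed M) (p : M) (a : op M -> R).
Hypothesis ca : is_covec p a.

Lemma covec0 : a (@op0 M) = 0.
Proof.
have := ca.1 _ _ _ (cinf_cst gM 1) (bvf_op0 gM) (bvf_op0 gM).
have -> : op_comb (fun=> 1) (@op0 M) (@op0 M) = @op0 M.
  by apply/funext => f; apply/funext => x; rewrite /op_comb /op0 mulr0 addr0.
by move/eqP; rewrite mul1r -subr_eq subrr eq_sym => /eqP.
Qed.

Lemma covecZ f V : cinf M f -> bvf V -> a (fun g x => f x * V g x) = f p * a V.
Proof.
move=> cf bV; have := ca.1 _ _ _ cf bV (bvf_op0 gM); rewrite covec0 addr0 => <-.
by congr a; apply/funext => g; apply/funext => x; rewrite /op_comb /op0 addr0.
Qed.

Lemma covec_sum n (c : 'I_n -> M -> R) (V : 'I_n -> op M) :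
  (forall i, cinf M (c i)) -> (forall i, bvf (V i)) ->
  a (op_sum c V) = \sum_(i < n) c i p * a (V i).
Proof.
elim: n c V => [|n IH] c V cc bV; first by rewrite op_sum0 covec0 big_ord0.
rewrite op_sumS ca.1//; last exact: bvf_sum.
by rewrite IH// big_ord_recl.
Qed.

(** Multiplication by the function k that cuts out the neighbourhood makes V and W equal as
    operators, and k p cancels since a covector is linear over evaluation at p. *)
Lemma covec_local V W : bvf V -> bvf W ->
  bnear p (fun y => forall f, cinf M f -> V f y = W f y) -> a V = a W.
Proof.
move=> bV bW [k ck [kp hk]].
have : a (fun g x => k x * V g x) = a (fun g x => k x * W g x).
  congr a; apply/funext => g; apply/funext => x.
  have [->|kx] := eqVneq (k x) 0; first by rewrite !mul0r.
  have [cg|ng] := pselect (cinf M g); first by rewrite (hk x kx).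
  by rewrite (bvf_non bV ng) (bvf_non bW ng).
by rewrite !covecZ// => /(mulfI kp).
Qed.

End Covec.
End Derivations.

(** * b-frames and push-forward of b-vectors *)

Section Frame.
Context {R : realType}.
Implicit Types M N : bspace R.

(* [c] is a local coordinate system on the open set [U], in terms of germs:
   smooth functions are locally smooth in [c], and [c] is an open map. *)
Definition coords M m (U : M -> Prop) (c : 'I_m -> M -> R) : Prop :=
  [/\ forall x, U x -> bnear x U,
      forall i, cinf M (c i),
      forall f x, cinf M f -> U x ->
        exists2 phi, smooth phi & bnear x (fun y => f y = phi (\row_i c i y))
    & forall x (P : M -> Prop), U x -> bnear x P ->
        \forall v \near \row_i c i x, exists2 y, P y & \row_i c i y = v].

Record frame M m := Frame {
  fU : M -> Prop;
  fc : 'I_m.+1 -> M -> R;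
  fd : 'I_m.+1 -> op M;
  fe : 'I_m.+1 -> op M;
  feps : 'I_m.+1 -> op M -> M -> R }.

(** The b-frame is [rho] times the coordinate frame; one formula then serves the normal and the
    tangential directions. *)
Definition rho M m (F : frame M m) (i : 'I_m.+1) (x : M) : R :=
  if i == ord0 then fc F ord0 x else 1.

(* A b-frame adapted to coordinates [fc], whose coordinate [0] defines the
   critical hypersurface: [fd i] is the i-th partial derivative, [fe] is the
   frame [c_0 d/dc_0, d/dc_1, ...] and [feps] the dual coframe. *)
Record is_frame M m (F : frame M m) : Prop := IsFrame {
  fr_open : forall x, fU F x -> bnear x (fU F);
  fr_c : forall i, cinf M (fc F i);
  fr_e : forall i, bvf (fe F i);
  fr_eE : forall i x f, fU F x -> cinf M f -> fe F i f x = rho F i x * fd F i f x;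
  fr_chain : forall x D f, fU F x -> pder x D -> cinf M f ->
    D f = \sum_i D (fc F i) * fd F i f x;
  fr_dc : forall i j x, fU F x -> fd F i (fc F j) x = (i == j)%:R;
  fr_eps : forall i V, bvf V -> cinf M (feps F i V);
  fr_Vc : forall i V x, bvf V -> fU F x -> V (fc F i) x = rho F i x * feps F i V x;
  fr_dense : forall g x, cinf M g -> fU F x ->
    bnear x (fun y => fc F ord0 y * g y = 0) -> g x = 0;
  fr_level : forall f i x, cinf M f -> i != ord0 -> fU F x ->
    bnear x (fun y => fc F ord0 y = fc F ord0 x -> f y = 0) -> fd F i f x = 0 }.

Section Build.
Variables (M : bspace R) (gM : gclosed M) (m : nat) (U : M -> Prop).
Variable (c : 'I_m.+1 -> M -> R).
Hypothesis cc : coords U c.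
Hypothesis critU : forall x, U x -> (crit M x <-> c ord0 x = 0).
Let C y : 'rV[R]_m.+1 := \row_i c i y.

Let cU x : U x -> bnear x U. Proof. by case: cc => + _ _ _; exact. Qed.
Let cci i : cinf M (c i). Proof. by case: cc. Qed.
Let crep f x : cinf M f -> U x -> exists2 phi, smooth phi & bnear x (fun y => f y = phi (C y)).
Proof. by case: cc => _ _ + _; exact. Qed.
Let csurj x (P : M -> Prop) : U x -> bnear x P -> \forall v \near C x, exists2 y, P y & C y = v.
Proof. by case: cc => _ _ _; exact. Qed.

(** The representing phi is not unique, but its germ at C x is, because the coordinate map is open;
    hence the derivative is a unique value. *)
Definition partial (i : 'I_m.+1) (f : M -> R) (x : M) : R :=
  xget 0 [set r | exists phi, [/\ smooth phi, bnear x (fun y => f y = phi (C y))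
                               & r = 'D_(unitv i) phi (C x)]].

Lemma partialE i f x phi : U x -> smooth phi -> bnear x (fun y => f y = phi (C y)) ->
  partial i f x = 'D_(unitv i) phi (C x).
Proof.
move=> Ux sp hf; apply: xget_unique; first by exists phi.
move=> r [psi [ss hg ->]]; apply: near_eq_derive.
have := csurj Ux (bnearI gM hf hg).
by apply: filterS => v [y [e1 e2] <-]; rewrite -e1.
Qed.

Lemma pder_partial i x : U x -> pder x (fun f => if `[< cinf M f >] then partial i f x else 0).
Proof.
move=> Ux; split=> [a f g cf cg|f g cf cg].
  have [phi sp hf] := crep cf Ux; have [psi ss hg] := crep cg Ux.
  have cfg : cinf M (fun y => a * f y + g y).
    by apply: cinfD => //; apply: cinfM => //; exact: cinf_cst.
  rewrite !asboolT//.
  rewrite (partialE i Ux sp hf) (partialE i Ux ss hg).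
  have sa : smooth (fun v => a * phi v) by apply: smoothM => //; exact: smooth_cst.
  rewrite (partialE i Ux (smoothD sa ss)); last by apply: bnearS (bnearI gM hf hg) => y [-> ->].
  rewrite deriveD; [|exact: smooth_derivable..]; congr (_ + _).
  by rewrite (@deriveZ _ _ _ phi a)//; exact: smooth_derivable.
have [phi sp hf] := crep cf Ux; have [psi ss hg] := crep cg Ux.
have cfg : cinf M (fun y => f y * g y) by exact: cinfM.
rewrite !asboolT//.
rewrite (partialE i Ux sp hf) (partialE i Ux ss hg).
rewrite (partialE i Ux (smoothM sp ss)); last by apply: bnearS (bnearI gM hf hg) => y [-> ->].
rewrite (@deriveM _ _ phi psi); [|exact: smooth_derivable..].
rewrite (bnear_self hf) (bnear_self hg) /GRing.scale /=; ring.
Qed.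

Lemma partial_near i f x : cinf M f -> U x ->
  exists2 phi, smooth phi & bnear x (fun y => f y = phi (C y) /\ partial i f y = 'D_(unitv i) phi (C y)).
Proof.
move=> cf Ux; have [phi sp hf] := crep cf Ux; exists phi => //.
apply: bnearS (bnearI gM (cU Ux) (bnear_near hf)) => y [Uy hy].
by split; [exact: bnear_self hy | exact: partialE].
Qed.

Lemma lcinf_partial i f x : cinf M f -> U x -> lcinf x (partial i f).
Proof.
move=> cf Ux; have [phi sp hf] := partial_near i cf Ux.
exists (fun y => 'D_(unitv i) phi (C y)); first by exact: (cinf_comp gM (smooth_derive i sp) cci).
by apply: bnearS hf => y [].
Qed.

Lemma partial_chain x D f : U x -> pder x D -> cinf M f ->
  D f = \sum_i D (c i) * partial i f x.
Proof.
move=> Ux DD cf; have [phi sp hf] := crep cf Ux.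
rewrite (pder_local gM DD cf (cinf_comp gM sp cci) hf) (pder_chain gM DD sp cci).
by apply: eq_bigr => i _; rewrite (partialE i Ux sp hf) mulrC.
Qed.

Lemma partial_coord i j x : U x -> partial i (c j) x = (i == j)%:R.
Proof.
move=> Ux; rewrite (partialE i Ux (smooth_coord j)).
  by have [_ ->] := derivable_coord (C x) (unitv i) j; rewrite mxE eq_sym.
by apply: bnearS (bnearT gM x) => y _; rewrite mxE.
Qed.

(** The coordinate line in a direction i other than 0 stays in the level set of c_0, where the
    representative of f vanishes. *)
Lemma partial_level f i x : cinf M f -> i != ord0 -> U x ->
  bnear x (fun y => c ord0 y = c ord0 x -> f y = 0) -> partial i f x = 0.
Proof.
move=> cf i0 Ux h0; have [phi sp hf] := crep cf Ux.
rewrite (partialE i Ux sp hf).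
have h : \forall v \near C x, (v : 'rV[R]_m.+1) 0 ord0 = c ord0 x -> phi v = 0.
  apply: filterS (csurj Ux (bnearI gM hf h0)) => v [y [e1 hy] <-].
  by rewrite -e1 mxE.
have hc : (fun h : R => h *: unitv i + C x) @ (0 : R) --> C x.
  rewrite -[X in _ --> X]add0r -(scale0r (unitv i)).
  by apply: cvgD; [apply: cvgZr_tmp | exact: cvg_cst].
have : is_derive (C x) (unitv i) phi 0.
  apply/is_derive_line0.
  have e : \forall t \near (0 : R), (fun=> 0 : R) t = phi (t *: unitv i + C x).
    have hh : \forall t \near (0 : R), (t *: unitv i + C x) 0 ord0 = c ord0 x ->
        phi (t *: unitv i + C x) = 0 := hc _ h.
    apply: filterS hh => t ->//.
    by rewrite !mxE /= eq_sym (negbTE i0) mulr0 add0r.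
  apply: near_eq_is_derive e _; exact: is_derive_cst.
by case.
Qed.

(** The hypersurface has dense complement: if g x were nonzero, c_0 would vanish at every nearby
    point, in particular along a segment in its own direction. *)
Lemma coord_dense g x : cinf M g -> U x -> bnear x (fun y => c ord0 y * g y = 0) -> g x = 0.
Proof.
move=> cg Ux h0; have [phi sp hf] := crep cg Ux.
apply/eqP/negPn/negP => gx.
have h : \forall v \near C x, (v : 'rV[R]_m.+1) 0 ord0 * phi v = 0.
  apply: filterS (csurj Ux (bnearI gM hf h0)) => v [y [e1 hy] <-].
  by rewrite -e1 mxE.
have h1 : \forall v \near C x, phi v != 0.
  have := @smooth_cvg R _ phi (C x) sp; rewrite (_ : phi (C x) = g x); last by rewrite (bnear_self hf).
  by move=> /ctsP /(_ `|g x|); rewrite normr_gt0 => /(_ gx); apply: filterS => v;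
    apply: contraTneq => ->; rewrite subr0 ltxx.
have [e e0 he] := (near_rVP _ _).1 (filterI h h1).
have key (t : R) : `|t| < e -> (c ord0 x + t) = 0.
  move=> te; have [] := he (t *: unitv ord0 + C x).
    move=> i; rewrite !mxE /= addrK; case: eqP => _; rewrite ?mulr1// mulr0 normr0//.
  by rewrite !mxE /= mulr1 addrC => /eqP; rewrite mulf_eq0 => /orP[/eqP//|] h2 /negP.
have := key 0; have := key (e / 2).
rewrite normr0 => h2 /(_ e0); rewrite addr0 => cx.
have e2 : 0 < e / 2 by rewrite divr_gt0.
have := h2; rewrite gtr0_norm// cx add0r => h3.
have : e / 2 = 0 by apply: h3; rewrite ltr_pdivrMr// ltr_pMr// ltr1n.
by move/eqP; rewrite gt_eqF.
Qed.

(** On the hypersurface the value is the limit of g / c_0 when g vanishes there. *)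
Definition quot (g : M -> R) (x : M) : R :=
  if c ord0 x == 0 then partial ord0 g x else g x / c ord0 x.

Lemma lcinf_quot g x : cinf M g -> (forall y, U y -> c ord0 y = 0 -> g y = 0) -> U x ->
  lcinf x (quot g).
Proof.
move=> cg g0 Ux; have [c0|c0] := eqVneq (c ord0 x) 0; last first.
  apply: (@lcinf_ext _ _ gM _ (fun y => g y * (c ord0 y)^-1)).
    by apply: bnearS (bnear_neq gM (cci ord0) c0) => y; rewrite /quot => /negbTE ->.
  by apply: lcinfM => //; [exact: lcinf_cinf | exact: lcinfV].
have [phi sp hf] := partial_near ord0 cg Ux.
pose psi := hadq ord0 0 0 (fun v => 'D_(unitv ord0) phi v).
have spsi : smooth psi by apply: smooth_hadq; exact: smooth_derive.
(* The point obtained from v by setting coordinate 0 to zero is again in the image of the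
   coordinates, by openness; g vanishes there, so Hadamard's formula has no constant term. *)
have h : \forall v \near C x, phi v = (v : 'rV[R]_m.+1) 0 ord0 * psi v.
  have [e e0 he] := (near_rVP _ _).1 (csurj Ux (bnearI gM hf (cU Ux))).
  apply/near_rVP; exists e => // v hv.
  rewrite -[v 0 ord0]subr0 -hadq_eq//.
  have [i|y [[gy _] Uy] Cy] := he (interp ord0 0 0 v).
    rewrite !mxE; case: eqP => [->|_]; first by rewrite c0 mul0r add0r subr0 normr0.
    by have := hv i; rewrite mxE.
  rewrite -Cy -gy g0 ?subr0//.
  by have /rowP/(_ ord0) := Cy; rewrite !mxE /= add0r mul0r.
exists (fun y => psi (C y)); first exact: (cinf_comp gM spsi cci).
apply: bnearS (bnearI gM hf (bnear_rV gM cci h)) => y [[gy py] hy].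
rewrite /quot; case: eqP => [cy|/eqP cy].
  by rewrite py /psi hadq_diag// mxE.
by rewrite gy hy mxE mulrC mulKf.
Qed.

(** Tangency in [bvf] is a statement about functions vanishing on the whole critical set;
    multiplication by a bump turns c_0 into such a function without changing its germ at x. *)
Lemma bvf_coord0 V x : bvf V -> U x -> c ord0 x = 0 -> V (c ord0) x = 0.
Proof.
move=> bV Ux cx; have [chi cchi [h1 h2]] := bump_exists gM (cU Ux).
have cf : cinf M (fun y => chi y * c ord0 y) by exact: cinfM.
rewrite (pder_local gM (bvf_pder x bV) (cci ord0) cf); last first.
  by apply: bnearS h1 => y ->; rewrite mul1r.
apply: (bvf_crit bV cf); last exact/critU.
move=> z cz; have [/bnear_self Uz|/bnear_self ->] := h2 z; last by rewrite mul0r.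
by rewrite ((critU Uz).1 cz) mulr0.
Qed.

(** Coordinate derivations and quotients by c_0 exist only over U; multiplied by a bump they become
    global operators, and the frame identities hold on the smaller set where the bump is 1. *)
Lemma frame_exists p : U p -> exists F : frame M m,
  [/\ is_frame F, coords (fU F) (fc F), fU F p, fc F = c & forall x, fU F x -> U x].
Proof.
move=> Up; have [chi cchi [h1 h2]] := bump_exists gM (cU Up).
have chiU x : ~ U x -> chi x = 0.
  by move=> nU; have [/bnear_self|/bnear_self] := h2 x.
pose U' x := bnear x (fun y => U y /\ chi y = 1).
have U'U x : U' x -> U x by move=> /bnear_self [].
have U'1 x : U' x -> chi x = 1 by move=> /bnear_self [].
pose rh (i : 'I_m.+1) x := if i == ord0 then c ord0 x else 1.
have crh i : cinf M (rh i) by rewrite /rh; case: eqP => _ //; exact: cinf_cst.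
pose e (i : 'I_m.+1) : op M := fun f x =>
  if `[< cinf M f >] then chi x * (rh i x * partial i f x) else 0.
have be i : bvf (e i).
  apply: bvf_intro => [f cf|x|f nf|f cf hf z cz].
  - rewrite /e asboolT//; apply: (cinf_bump gM cchi h2) => y Uy.
    by apply: lcinfM => //; [exact: lcinf_cinf | exact: lcinf_partial].
  - have [Ux|nU] := pselect (U x).
      have p0 : pder x (fun _ : M -> R => 0 : R) by split=> *; ring.
      have := pder_comb (chi x * rh i x) (pder_partial i Ux) p0.
      congr pder; apply/funext => f; rewrite addr0 /e.
      by case: asboolP => // _; rewrite ?mulr0 ?mulrA.
    have -> : (e i)^~ x = fun=> 0.
      by apply/funext => f; rewrite /e chiU// mul0r; case: ifP.
    by split=> *; ring.
  - by apply/funext => x; rewrite /e asboolF.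
  - rewrite /e asboolT//.
    have [Uz|nU] := pselect (U z); last by rewrite chiU// mul0r.
    have cz0 := (critU Uz).1 cz.
    rewrite /rh; case: (eqVneq i ord0) => [_|i0]; first by rewrite cz0 mul0r mulr0.
    rewrite partial_level// ?mulr0//.
    apply: bnearS (cU Uz) => y Uy cy; apply: hf; apply/critU => //.
    by rewrite cy.
(* [q V] is the coframe component along e_0: the quotient of V c_0 by c_0, extended across the
   hypersurface. *)
have /choice[q hq] : forall V : op M, exists q, bvf V -> cinf M q /\
    forall x, U' x -> V (c ord0) x = c ord0 x * q x.
  move=> V; have [bV|] := pselect (bvf V); last by exists (fun=> 0).
  have cg := bvf_cinf bV (cci ord0).
  have g0 y : U y -> c ord0 y = 0 -> V (c ord0) y = 0 by exact: bvf_coord0.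
  exists (fun x => chi x * quot (V (c ord0)) x) => _; split.
    by apply: (cinf_bump gM cchi h2) => y Uy; exact: lcinf_quot.
  move=> x Ux; rewrite U'1// mul1r /quot; case: eqP => [cx|/eqP cx].
    by rewrite cx mul0r g0//; exact: U'U.
  by rewrite mulrC divfK.
pose eps (i : 'I_m.+1) (V : op M) := if i == ord0 then q V else V (c i).
exists (Frame U' c partial e eps); split=> //; last first.
- exact: bnearI (cU Up) h1.
- split=> // [x|f x cf|x P]; first exact: bnear_near.
    by move/U'U; exact: crep.
  by move/U'U; exact: csurj.
split=> //=.
- by move=> x Ux; exact: bnear_near.
- by move=> i x f Ux cf; rewrite /e asboolT// U'1// mul1r.
- by move=> x D f Ux; apply: partial_chain; exact: U'U.
- by move=> i j x /U'U; exact: partial_coord.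
- move=> i V bV; rewrite /eps; case: eqP => _; first by case: (hq V bV).
  exact: bvf_cinf.
- move=> i V x bV Ux; rewrite /eps /rho /=; case: (eqVneq i ord0) => [->|_].
    by have [_ ->] := hq V bV.
  by rewrite mul1r.
- by move=> g x cg /U'U; exact: coord_dense.
- by move=> f i x cf i0 /U'U; exact: partial_level.
Qed.

End Build.
End Frame.

Section FrameTheory.
Context {R : realType}.
Variables (M : bspace R) (gM : gclosed M) (m : nat) (F : frame M m).
Hypothesis FF : is_frame F.

Lemma cinf_rho i : cinf M (rho F i).
Proof. by rewrite /rho; case: eqP => _; [exact: fr_c | exact: cinf_cst]. Qed.

(** For i = 0 the equation determines the component only where c_0 is nonzero; [fr_dense] carries
    the equality across the hypersurface. *)
Lemma eps_unique i V x h : bvf V -> fU F x -> cinf M h ->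
  bnear x (fun y => V (fc F i) y = rho F i y * h y) -> feps F i V x = h x.
Proof.
move=> bV Ux ch e; have ce := fr_eps FF i bV.
move: e; rewrite /rho; case: (eqVneq i ord0) => [->|i0] e; last first.
  by have := fr_Vc FF i bV Ux; rewrite /rho (negbTE i0) (bnear_self e) !mul1r.
apply/eqP; rewrite -subr_eq0; apply/eqP.
apply: (fr_dense FF (cinfB gM (fr_eps FF ord0 bV) ch) Ux).
apply: bnearS (bnearI gM e (fr_open FF Ux)) => y [e1 Uy].
by rewrite mulrBr -e1 (fr_Vc FF ord0 bV Uy) /rho eqxx subrr.
Qed.

Lemma bvf_frame V x f : bvf V -> fU F x -> cinf M f ->
  V f x = \sum_i feps F i V x * fe F i f x.
Proof.
move=> bV Ux cf; rewrite (fr_chain FF Ux (bvf_pder x bV) cf).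
by apply: eq_bigr => i _; rewrite (fr_Vc FF i bV Ux) (fr_eE FF i Ux cf); ring.
Qed.

Lemma covec_frame p a V : fU F p -> is_covec p a -> bvf V ->
  a V = \sum_i feps F i V p * a (fe F i).
Proof.
move=> Up ca bV.
rewrite -(covec_sum gM ca (fun i => fr_eps FF i bV) (fr_e FF)).
apply: (covec_local gM ca) => //.
  by apply: bvf_sum => // i; [exact: fr_eps | exact: fr_e].
by apply: bnearS (fr_open FF Up) => y Uy f cf; exact: bvf_frame.
Qed.

Lemma eps_comb i f V W x : cinf M f -> bvf V -> bvf W -> fU F x ->
  feps F i (op_comb f V W) x = f x * feps F i V x + feps F i W x.
Proof.
move=> cf bV bW Ux; have bc := bvf_comb gM cf bV bW.
have ch : cinf M (fun y => f y * feps F i V y + feps F i W y).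
  by apply: cinfD => //; [apply: cinfM => //|]; exact: fr_eps.
rewrite (eps_unique (i := i) bc Ux ch)//.
apply: bnearS (fr_open FF Ux) => y Uy.
rewrite /op_comb (fr_Vc FF i bV Uy) (fr_Vc FF i bW Uy); ring.
Qed.

Lemma eps_e i j x : fU F x -> feps F i (fe F j) x = (i == j)%:R.
Proof.
move=> Ux; rewrite (eps_unique (h := fun=> (i == j)%:R) (fr_e FF j) Ux (cinf_cst gM _))//.
apply: bnearS (fr_open FF Ux) => y Uy.
rewrite (fr_eE FF j Uy (fr_c FF i)) (fr_dc FF j i Uy) eq_sym.
by case: (eqVneq i j) => [->|]; rewrite ?mulr0.
Qed.

Lemma V_rho i V x : bvf V -> fU F x ->
  V (rho F i) x = if i == ord0 then rho F i x * feps F i V x else 0.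
Proof.
move=> bV Ux; have [->|i0] := eqVneq i ord0.
  by rewrite -(fr_Vc FF _ bV Ux).
have -> : rho F i = fun=> 1 by apply/funext => y; rewrite /rho (negbTE i0).
exact: (pder_cst gM (bvf_pder x bV)).
Qed.

(** This is closedness of the coframe, with dc_0 / c_0 among its members. For i = 0 the products of
    the two components of V and W along e_0 cancel by symmetry. *)
Lemma eps_lieb i V W x : bvf V -> bvf W -> fU F x ->
  feps F i (lieb V W) x = V (feps F i W) x - W (feps F i V) x.
Proof.
move=> bV bW Ux; have bl := bvf_lieb gM bV bW.
have cV := fr_eps FF i bV; have cW := fr_eps FF i bW.
have ch : cinf M (fun y => V (feps F i W) y - W (feps F i V) y).
  by apply: cinfB => //; exact: bvf_cinf.
rewrite (eps_unique (i := i) bl Ux ch)//.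
apply: bnearS (fr_open FF Ux) => y Uy.
have key A B (bA : bvf A) (bB : bvf B) : A (B (fc F i)) y =
   A (rho F i) y * feps F i B y + rho F i y * A (feps F i B) y.
  have cB := fr_eps FF i bB; have pA := bvf_pder y bA.
  rewrite -(pA.2 _ _ (cinf_rho i) cB).
  apply: (pder_local gM pA); first exact: (bvf_cinf bB (fr_c FF i)).
    by apply: cinfM => //; exact: cinf_rho.
  by apply: bnearS (fr_open FF Uy) => z Uz; exact: fr_Vc.
rewrite /lieb (key V W)// (key W V)// !V_rho//.
by case: eqP => _; ring.
Qed.

Definition mkcov_fun (p : M) (r : 'I_m.+1 -> R) : op M -> R :=
  fun V => if `[< bvf V >] then \sum_i feps F i V p * r i else 0.

Lemma mkcovP p r : fU F p -> is_covec p (mkcov_fun p r).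
Proof.
move=> Up; split=> [f V W cf bV bW|V nV]; last by rewrite /mkcov_fun asboolF.
have bc := bvf_comb gM cf bV bW.
rewrite /mkcov_fun !asboolT// mulr_sumr -big_split /=; apply: eq_bigr => i _.
by rewrite eps_comb// mulrDl mulrA.
Qed.

Definition mkcov p r (Up : fU F p) : covec M := Covec (mkcovP r Up).

Lemma mkcov_e p r (Up : fU F p) j : cv (mkcov r Up) (fe F j) = r j.
Proof.
rewrite /= /mkcov_fun asboolT; last exact: fr_e.
rewrite (bigD1 j)//= eps_e// eqxx mul1r big1 ?addr0// => i ij.
by rewrite eps_e// (negbTE ij) mul0r.
Qed.

End FrameTheory.

(** * Push-forward of b-vectors and pull-back of b-forms *)

Section Push.
Context {R : realType}.
Implicit Types M N : bspace R.

(* the two properties of a local defining function of the critical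
   hypersurface that the push-forward of b-vectors depends on *)
Definition bdef M (x : M) (c0 : M -> R) : Prop :=
  (forall V, bvf V -> exists2 h, cinf M h & bnear x (fun y => V c0 y = c0 y * h y)) /\
  (forall g, cinf M g -> bnear x (fun y => c0 y * g y = 0) -> g x = 0).

Lemma bdef_frame M m (F : frame M m) x : gclosed M -> is_frame F -> fU F x ->
  bdef x (fc F ord0).
Proof.
move=> gM FF Ux; split=> [V bV|g cg]; last exact: fr_dense.
exists (feps F ord0 V); first exact: fr_eps.
apply: bnearS (fr_open FF Ux) => y Uy.
by rewrite (fr_Vc FF ord0 bV Uy) /rho eqxx.
Qed.

Lemma bdef_ext M (x : M) (c c' : M -> R) : gclosed M -> cinf M c -> cinf M c' ->
  bnear x (fun y => c y = c' y) -> bdef x c -> bdef x c'.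
Proof.
move=> gM cc cc' e [h1 h2]; split=> [V bV|g cg h].
  have [h ch e1] := h1 V bV; exists h => //.
  apply: bnearS (bnearI gM e1 (bnear_near e)) => y [e2 e3].
  rewrite -(bnear_self e3) -e2; apply: (pder_local gM (bvf_pder y bV)) => //.
  by apply: bnearS e3 => z ->.
by apply: h2 => //; apply: bnearS (bnearI gM e h) => y [-> ->].
Qed.

Lemma bpush_val M N (h : M -> N) x V W f : bpush h x V W -> cinf N f ->
  V (f \o h) x = W f (h x).
Proof.
move=> [_ _ [u [k [c [Y [[_ ux] hc _ E]]]]]] cf.
have := E f cf x; rewrite ux !mul1r => ->.
by rewrite big1 ?addr0// => i _; have [_ ->] := hc i; rewrite mul0r.
Qed.

Lemma bpush_bvf M N (h : M -> N) x V W : bpush h x V W -> bvf V /\ bvf W.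
Proof. by case. Qed.

Section Through.
Variables (M N : bspace R) (gM : gclosed M) (gN : gclosed N).
Variables (h : M -> N) (sh : smooth_map h) (m : nat) (F : frame N m).
Hypothesis FF : is_frame F.

(* The component along [c_0 d/dc_0] is [V c_0 / c_0], which is not determined by
   the values of [V] at [x] but extends smoothly across the critical set. *)
Lemma bpush_eps0 x V W q : fU F (h x) -> bpush h x V W ->
  bdef x (fc F ord0 \o h) -> cinf M q ->
  bnear x (fun y => V (fc F ord0 \o h) y = fc F ord0 (h y) * q y) ->
  feps F ord0 W (h x) = q x.
Proof.
move=> Ux [bV bW [u [k [c [Y [[cu ux] hc bY E]]]]]] [_ dns] cq e.
(* The defect of the claimed equality, divided by c_0. The identity in [bpush] makes c_0 times g
   vanish near x, so g x = 0 by density, and u x = 1, c_i x = 0 reduce this to the claim. *)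
pose g y := u y * q y - u y * feps F ord0 W (h y)
   - \sum_(i < k) c i y * feps F ord0 (Y i) (h y).
have cg : cinf M g.
  have ce Z : bvf Z -> cinf M (fun y => feps F ord0 Z (h y)).
    by move=> bZ; exact: sh (fr_eps FF ord0 bZ).
  apply: cinfB => //; first by apply: cinfB => //; apply: cinfM => //; exact: ce.
  by apply: cinf_sum => // i _; apply: cinfM => //; [have [] := hc i|exact: ce].
have : g x = 0.
  apply: dns => //.
  apply: bnearS (bnearI gM e (bnear_smooth sh (fr_open FF Ux))) => y [e1 Uy] /=.
  have := E _ (fr_c FF ord0) y; rewrite e1 (fr_Vc FF ord0 bW Uy) /rho eqxx => e2.
  rewrite /g !mulrBr mulr_sumr.
  have -> : \sum_(i < k) fc F ord0 (h y) * (c i y * feps F ord0 (Y i) (h y)) =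
     \sum_(i < k) c i y * Y i (fc F ord0) (h y).
    by apply: eq_bigr => i _; rewrite (fr_Vc FF ord0 (bY i) Uy) /rho eqxx; ring.
  rewrite mulrCA e2; ring.
rewrite /g ux !mul1r big1 ?subr0; last by move=> i _; have [_ ->] := hc i; rewrite mul0r.
by move/eqP; rewrite subr_eq0 eq_sym => /eqP.
Qed.

Lemma bpush_eps x V W i : i != ord0 -> fU F (h x) -> bpush h x V W ->
  feps F i W (h x) = V (fc F i \o h) x.
Proof.
move=> i0 Ux p; have [bV bW] := bpush_bvf p.
rewrite (bpush_val p (fr_c FF i)) (fr_Vc FF i bW Ux) /rho (negbTE i0).
by rewrite mul1r.
Qed.

(** The image vector has its coefficients frozen at x; the remainder has coefficients q_i y - q_i x
    along the frame, which vanish at x, and the bump makes the identity global. *)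
Lemma bpush_intro x V (q : 'I_m.+1 -> M -> R) : fU F (h x) -> bvf V ->
  (forall i, cinf M (q i)) ->
  (forall i, bnear x (fun y => V (fc F i \o h) y = rho F i (h y) * q i y)) ->
  bpush h x V (op_sum (fun i _ => q i x) (fe F)).
Proof.
move=> Ux bV cq e.
have := bnearI gM (bnear_smooth sh (fr_open FF Ux)) (bnear_all gM e).
move=> /(bump_exists gM)[chi cchi [h1 h2]].
have ch i : cinf M (fun y => chi y * (q i y - q i x)).
  by apply: cinfM => //; apply: cinfB => //; exact: cinf_cst.
split=> //; first by apply: bvf_sum => // i; [exact: cinf_cst|exact: fr_e].
exists chi, m.+1, (fun i y => chi y * (q i y - q i x)), (fe F); split.
- by split=> //; exact: bnear_self h1.
- by move=> i; split=> //; rewrite subrr mulr0.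
- exact: fr_e.
move=> f cf y; have [/bnear_self[Uy ey]|/bnear_self c0] := h2 y; last first.
  by rewrite c0 !mul0r add0r big1// => i _; rewrite !mul0r.
rewrite (fr_chain FF Uy (pder_push sh (bvf_pder y bV)) cf) /op_sum !mulr_sumr -big_split /=.
apply: eq_bigr => i _; rewrite (fr_eE FF i Uy cf) ey; ring.
Qed.

Lemma bpush_exists x V : fU F (h x) -> bdef x (fc F ord0 \o h) -> bvf V ->
  exists W, bpush h x V W.
Proof.
move=> Ux [db _] bV; have [q0 cq0 e0] := db V bV.
pose q (i : 'I_m.+1) := if i == ord0 then q0 else V (fc F i \o h).
eexists; apply: (@bpush_intro x V q) => // i.
  by rewrite /q; case: eqP => // _; apply: bvf_cinf => //; apply: sh; exact: fr_c.
rewrite /q /rho; case: (eqVneq i ord0) => [->|_]; first exact: e0.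
by apply: bnearS (bnearT gM x) => y _; rewrite mul1r.
Qed.

End Through.

Section Iso.
Variables (M N : bspace R) (h : M -> N) (h' : N -> M).
Hypotheses (hh : diffeo h h') (ch : forall x, crit N (h x) <-> crit M x).
Let sh : smooth_map h. Proof. by case: hh. Qed.
Let sh' : smooth_map h'. Proof. by case: hh. Qed.
Let hK : cancel h h'. Proof. by case: hh. Qed.
Let hK' : cancel h' h. Proof. by case: hh. Qed.

Lemma diffeo_sym : diffeo h' h. Proof. by case: hh. Qed.

Lemma crit_sym y : crit M (h' y) <-> crit N y.
Proof. by rewrite -[X in crit N X]hK' ch. Qed.

Definition opush (V : op M) : op N := fun f y => V (f \o h) (h' y).

Lemma bvf_opush V : bvf V -> bvf (opush V).
Proof.
move=> bV; apply: bvf_intro => [f cf|y|f nf|f cf hf z cz].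
- by apply: sh'; apply: bvf_cinf => //; exact: sh.
- have := pder_push sh (bvf_pder (h' y) bV); rewrite hK'; exact.
- apply/funext => y; rewrite /opush (bvf_non bV)// => cf; apply: nf.
  suff -> : f = (f \o h) \o h' by exact: sh'.
  by apply/funext => z /=; rewrite hK'.
- apply: (bvf_crit bV); first exact: sh; last exact/crit_sym.
  by move=> x cx /=; apply: hf; apply/ch.
Qed.

Lemma opushE V f x : opush V f (h x) = V (f \o h) x.
Proof. by rewrite /opush hK. Qed.

Lemma opush_lieb V W : opush (lieb V W) = lieb (opush V) (opush W).
Proof.
apply/funext => f; apply/funext => y; rewrite /opush /lieb.
congr (V _ _ - W _ _); apply/funext => x /=; by rewrite hK.
Qed.

Lemma opush_comb f V W : opush (op_comb f V W) = op_comb (f \o h') (opush V) (opush W).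
Proof. by []. Qed.

Lemma bpush_opush V x : gclosed M -> bvf V -> bpush h x V (opush V).
Proof.
move=> gM bV; split=> //; first exact: bvf_opush.
exists (fun=> 1), 0%N, (fun _ _ => 0), (fun _ => @op0 R N); split.
- by split=> //; exact: cinf_cst.
- by case.
- by case.
- by move=> f cf y; rewrite big_ord0 addr0 opushE.
Qed.

(** Transported to the target, the relation says that u times the push-forward of V is u W plus
    fields with coefficients vanishing at h x; a covector at h x sees no difference. *)
Lemma bpush_iso_unique V W x a : gclosed N -> bpush h x V W -> is_covec (h x) a ->
  a W = a (opush V).
Proof.
move=> gN [bV bW [u [k [c [Y [[cu ux] hc bY E]]]]]] ca.
have bp := bvf_opush bV.
have cu' : cinf N (u \o h') by exact: sh'.
have cc' i : cinf N (c i \o h') by apply: sh'; have [] := hc i.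
have bs := bvf_sum gN cc' bY.
have bu := bvf_smul gN cu' bW.
have e : (fun f y => (u \o h') y * opush V f y) =
    op_comb (u \o h') W (op_sum (fun i => c i \o h') Y).
  apply/funext => f; apply/funext => y; have [cf|nf] := pselect (cinf N f).
    by have := E f cf (h' y); rewrite hK' /op_comb /op_sum /opush.
  rewrite (bvf_non bp nf) mulr0 /op_comb (bvf_non bW nf) (bvf_non bs nf).
  by rewrite mulr0 addr0.
have := covecZ gN ca cu' bp; rewrite e ca.1// /= hK ux !mul1r => <-.
rewrite (covec_sum gN ca cc' bY) big1 ?addr0// => i _ /=.
by rewrite hK; have [_ ->] := hc i; rewrite mul0r.
Qed.

End Iso.

(** With one argument fixed, a 2-form at a point is a covector once it is set to 0 off the b-vector
    fields; facts on covectors then apply to each argument in turn. *)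
Lemma form2_covec M (w : form2 M) W y : gclosed M -> is_form2 w -> bvf W ->
  is_covec y (fun V => if `[< bvf V >] then w V W y else 0).
Proof.
move=> gM [w1 w2 w3] bW; split=> [f V V' cf bV bV'|V nV]; last by rewrite asboolF.
have bc := bvf_comb gM cf bV bV'.
by rewrite !asboolT// w3.
Qed.

Lemma pull2_unique M N (h : M -> N) (w : form2 N) V V' x r W W' :
  bpush h x V W -> bpush h x V' W' ->
  (forall W W', bpush h x V W -> bpush h x V' W' -> w W W' (h x) = r) ->
  pull2 h w V V' x = r.
Proof.
move=> p p' E; apply: xget_unique.
  by exists W, W'; split=> //; rewrite E.
by move=> s [W1 [W2 [p1 p2 ->]]]; exact: E.
Qed.

Lemma pull2_iso M N (h : M -> N) (h' : N -> M) (w : form2 N) V V' x :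
  diffeo h h' -> (forall x, crit N (h x) <-> crit M x) -> gclosed M -> gclosed N ->
  is_form2 w -> bvf V -> bvf V' ->
  pull2 h w V V' x = w (opush h h' V) (opush h h' V') (h x).
Proof.
move=> hh ch gM gN fw bV bV'.
have bo := bvf_opush hh ch.
apply: (pull2_unique (bpush_opush hh ch x gM bV) (bpush_opush hh ch x gM bV')).
move=> W W' p p'; have [_ bW] := bpush_bvf p; have [_ bW'] := bpush_bvf p'.
have := bpush_iso_unique hh ch gN p (form2_covec (h x) gN fw bW').
rewrite !asboolT//; last exact: bo.
move=> ->; have [_ w2 _] := fw.
rewrite w2//; last exact: bo.
have := bpush_iso_unique hh ch gN p' (form2_covec (h x) gN fw (bo _ bV)).
rewrite !asboolT//; last exact: bo.
by move=> ->; have := congr1 (fun f => f (h x)) (w2 _ _ (bo _ bV) (bo _ bV')) => /= ->.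
Qed.
End Push.

(** * The b-cotangent bundle and its symplectic form *)

Section Fibre.
Context {R : realType}.
Variables (M B : bspace R) (b : B -> M) (m k : nat).
Variables (U : M -> Prop) (c : 'I_m -> M -> R) (P : 'I_k -> B -> R) (F0 : set (B -> R)).
Hypotheses (gM : gclosed M) (gB : gclosed B) (cc : coords U c).
Hypotheses (genB : forall f, cinf B f -> gen F0 f) (sb : smooth_map b).
Hypothesis cP : forall j, cinf B (P j).
Hypothesis F0P : forall f, F0 f -> (exists2 f', cinf M f' & f = f' \o b) \/
  (exists2 a : 'I_k -> M -> R, forall j, cinf M (a j) &
     forall z, U (b z) -> f z = \sum_j a j (b z) * P j z).
Hypothesis surj : forall y (p : 'I_k -> R), U y -> exists2 z, b z = y & forall j, P j z = p j.

(** Base coordinates followed by fibre coordinates. The setting serves three times: the b-cotangent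
    bundle over its base, the annihilator over G, and the product with the dual of the Lie algebra
    over the annihilator. *)
Definition fibc (i : 'I_(m + k)) : B -> R :=
  match fintype.split i with inl i => c i \o b | inr j => P j end.

Lemma fibc_l i : fibc (lshift k i) = c i \o b.
Proof. by rewrite /fibc (unsplitK (inl i)). Qed.

Lemma fibc_r j : fibc (rshift m j) = P j.
Proof. by rewrite /fibc (unsplitK (inr j)). Qed.

Let Cz z : 'rV[R]_(m + k) := \row_i fibc i z.
Let lp (v : 'rV[R]_(m + k)) : 'rV[R]_m := \row_i v 0 (lshift k i).

Let lpC z : lp (Cz z) = \row_i c i (b z).
Proof. by apply/rowP => i; rewrite !mxE fibc_l. Qed.

Lemma fibc_cinf i : cinf B (fibc i).
Proof.
rewrite /fibc; case: (fintype.split i) => [l|j] //.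
by apply: sb; case: cc.
Qed.

Let smooth_lp (phi : 'rV[R]_m -> R) : smooth phi -> smooth (fun v => phi (lp v)).
Proof. by move=> sp; apply: smooth_comp => // i; exact: smooth_coord. Qed.

(** The domain of validity has product form, a condition on the base point and a bound on the fibre
    coordinates. Openness of the coordinate map needs this shape, since [surj] produces points from
    a base point and prescribed fibre coordinates. *)
Lemma fibre_rep f z : cinf B f -> U (b z) ->
  exists phi : 'rV[R]_(m + k) -> R, exists W : M -> Prop, exists e : R,
  [/\ smooth phi, bnear (b z) W, 0 < e &
   forall z', W (b z') -> (forall j, `|P j z' - P j z| < e) -> f z' = phi (Cz z')].
Proof.
move=> cf Uz; have [cU cci crep csurj] := cc.
have [m' [g [phi [eps [eps0 Fg sphi E]]]]] := genB cf z.
have /choice[gm hgm] : forall i, exists gm : 'rV[R]_(m + k) -> R,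
    smooth gm /\ bnear (b z) (fun y => forall z', b z' = y -> g i z' = gm (Cz z')).
  move=> i; have [[f' cf' ->]|[a ca ea]] := F0P (Fg i).
    have [psi sp hp] := crep f' (b z) cf' Uz.
    exists (fun v => psi (lp v)); split; first exact: smooth_lp.
    by apply: bnearS hp => y hy z' bz /=; rewrite lpC bz.
  have /choice[ps hps] : forall j, exists ps : 'rV[R]_m -> R,
      smooth ps /\ bnear (b z) (fun y => a j y = ps (\row_i c i y)).
    by move=> j; have [ps ? ?] := crep _ _ (ca j) Uz; exists ps.
  exists (fun v => \sum_j ps j (lp v) * v 0 (rshift m j)); split.
    apply: smooth_sum => j _; apply: smoothM; last exact: smooth_coord.
    by apply: smooth_lp; have [] := hps j.
  apply: bnearS (bnearI gM (cU _ Uz) (bnear_all gM (fun j => (hps j).2))) => y [Uy hy] z' bz.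
  rewrite ea ?bz//; apply: eq_bigr => j _.
  by rewrite lpC bz hy mxE fibc_r.
pose psi (v : 'rV[R]_(m + k)) := phi (\row_i gm i v).
have spsi : smooth psi by apply: smooth_comp => // i; have [] := hgm i.
have : \forall v \near Cz z, forall i, `|gm i (Cz z) - gm i v| < eps.
  apply: (@filter_forall _ _ _ (nbhs (Cz z))) => i.
  by have /ctsP := @smooth_cvg R _ (gm i) (Cz z) (hgm i).1; exact.
move=> /near_rVP[e e0 he].
pose W y := U y /\ (forall i, forall z', b z' = y -> g i z' = gm i (Cz z'))
  /\ (forall i, `|c i y - c i (b z)| < e).
have hW : bnear (b z) W.
  apply: bnearI => //; first exact: cU.
  apply: bnearI => //; first by apply: bnear_all => // i; have [] := hgm i.
  apply: bnear_all => // i.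
  have := @bnear_rV R M gM (b z) 1 (fun=> c i) (fun v => `|v 0 0 - c i (b z)| < e) (fun=> cci i).
  move=> h; apply: bnearS (h _) => [y|]; first by rewrite mxE.
  apply/near_rVP; exists e => // w /(_ 0); by rewrite mxE.
exists psi, W, e; split=> // z' [Uz' [hg hc]] hP.
have gi i : g i z' = gm i (Cz z') by exact: hg.
rewrite E; first by congr phi; apply/rowP => i; rewrite !mxE.
have gi0 i : g i z = gm i (Cz z) by have [_ /bnear_self] := hgm i; exact.
move=> i; rewrite gi gi0 distrC; apply: he => l; rewrite !mxE /fibc.
by case: (fintype.split l) => j /=; [exact: hc | exact: hP].
Qed.

Lemma fibre_coords : coords (fun z => U (b z)) fibc.
Proof.
have [cU cci crep csurj] := cc.
split.
- by move=> z Uz; exact: bnear_smooth sb (cU _ Uz).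
- exact: fibc_cinf.
- move=> f z cf Uz; have [phi [W [e [sp hW e0 E]]]] := fibre_rep cf Uz.
  exists phi => //.
  have hP : bnear z (fun z' => forall j, `|P j z' - P j z| < e).
    apply: bnear_all => // j.
    have := @bnear_rV R B gB z 1 (fun=> P j) (fun v => `|v 0 0 - P j z| < e) (fun=> cP j).
    move=> h; apply: bnearS (h _) => [y|]; first by rewrite mxE.
    by apply/near_rVP; exists e => // w /(_ 0); rewrite mxE.
  by apply: bnearS (bnearI gB (bnear_smooth sb hW) hP) => z' [h1 h2]; exact: E.
move=> z Q Uz [f cf [fz hf]]; have [phi [W [e [sp hW e0 E]]]] := fibre_rep cf Uz.
have p0 : phi (Cz z) != 0.
  rewrite -E//; first exact: bnear_self hW.
  by move=> j; rewrite subrr normr0.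
have [d1 d10 hd1] : exists2 d : R, 0 < d & forall v, cube (Cz z) d v -> phi v != 0.
  have /ctsP /(_ `|phi (Cz z)|) := @smooth_cvg R _ phi (Cz z) sp.
  rewrite normr_gt0 => /(_ p0) /near_rVP[d d0 hd]; exists d => // v /hd.
  by apply: contraTneq => ->; rewrite subr0 ltxx.
have := csurj _ _ Uz (bnearI gM (cU _ Uz) hW).
move=> /near_rVP[d2 d20 hd2].
apply/near_rVP; exists (Num.min e (Num.min d1 d2)); first by rewrite !lt_min e0 d10.
move=> v hv.
have [i|y [Uy Wy] Cy] := hd2 (lp v).
  have := hv (lshift k i); rewrite !lt_min !mxE fibc_l => /andP[_ /andP[_]].
  exact.
have [z' bz Pz] := surj (fun j => v 0 (rshift m j)) Uy.
have Cv : Cz z' = v.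
  apply/rowP => i; rewrite mxE -[i]splitK; case: (fintype.split i) => l.
    by rewrite fibc_l /= bz; have /rowP/(_ l) := Cy; rewrite !mxE.
  by rewrite fibc_r Pz.
exists z' => //; apply: hf; rewrite E ?bz//.
  rewrite Cv; apply: hd1 => i; have := hv i; by rewrite !lt_min => /andP[_ /andP[]].
move=> j; rewrite Pz; have := hv (rshift m j); rewrite !lt_min => /andP[+ _].
by rewrite mxE fibc_r.
Qed.

End Fibre.

Section Framed.
Context {R : realType}.
Implicit Types M N B : bspace R.

Definition adapted M m (F : frame M m) : Prop :=
  [/\ is_frame F, coords (fU F) (fc F) & forall x, fU F x -> (crit M x <-> fc F ord0 x = 0)].

Lemma adapted_exists M m (U : M -> Prop) (c : 'I_m.+1 -> M -> R) x :
  gclosed M -> coords U c -> (forall x, U x -> (crit M x <-> c ord0 x = 0)) -> U x ->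
  exists F : frame M m, [/\ adapted F, fU F x, fc F = c & forall x, fU F x -> U x].
Proof.
move=> gM cc hc Ux; have [F [FF cF Fx Fc FU]] := frame_exists gM cc hc Ux.
by exists F; split=> //; split=> // y Fy; rewrite Fc; apply: hc; exact: FU.
Qed.

Section Over.
Variables (M N : bspace R) (gM : gclosed M) (gN : gclosed N) (h : M -> N) (sh : smooth_map h).
Variables (m n : nat) (FM : frame M m) (FN : frame N n) (s : 'I_n.+1 -> 'I_m.+1).
Hypotheses (AM : is_frame FM) (AN : is_frame FN).
Hypotheses (s0 : s ord0 = ord0) (sn0 : forall i, i != ord0 -> s i != ord0).
Variable x : M.
Hypotheses (Ux : fU FM x) (Uhx : fU FN (h x)).
Hypothesis e : forall i, bnear x (fun y => fc FM (s i) y = fc FN i (h y)).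

Let over_cinf i : cinf M (fc FN i \o h). Proof. by apply: sh; exact: fr_c. Qed.

Let over_V V i : bvf V -> bnear x (fun y => V (fc FM (s i)) y = V (fc FN i \o h) y).
Proof.
move=> bV; apply: bnearS (bnear_near (e i)) => y hy.
by apply: (pder_local gM (bvf_pder y bV)) => //; exact: fr_c.
Qed.

Lemma bdef_over : bdef x (fc FN ord0 \o h).
Proof.
apply: bdef_ext (bdef_frame gM AM Ux) => //; first exact: fr_c.
by have := e ord0; rewrite s0.
Qed.

(** In charts where h is a coordinate projection, push-forward selects components. For i = 0 this
    rests on c_0 of N pulling back to c_0 of M, so that both quotients by c_0 agree. *)
Lemma eps_over V W i : bpush h x V W -> feps FN i W (h x) = feps FM (s i) V x.
Proof.
move=> p; have [bV bW] := bpush_bvf p.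
have [->|i0] := eqVneq i ord0.
  rewrite s0; apply: (bpush_eps0 gM sh AN Uhx p bdef_over); first exact: fr_eps.
  have := over_V ord0 bV; have := e ord0; rewrite s0 => e0 eV.
  apply: bnearS (bnearI gM (bnearI gM e0 eV) (fr_open AM Ux)) => y [[e1 e2] Uy].
  by rewrite -e2 -e1 (fr_Vc AM ord0 bV Uy) /rho eqxx.
rewrite (bpush_eps AN i0 Uhx p) -(bnear_self (over_V i bV)).
by rewrite (fr_Vc AM (s i) bV Ux) /rho (negbTE (sn0 i0)) mul1r.
Qed.

Lemma push_over V : bvf V -> exists W, bpush h x V W.
Proof. exact: (bpush_exists gM gN sh AN Uhx bdef_over). Qed.

End Over.

Lemma bcot_gclosed M : gclosed (bcot M).
Proof. by move=> f; exact: gen_idem. Qed.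

Lemma base_smooth M : smooth_map (@base R M : bcot M -> M).
Proof. by move=> f cf; apply: gen_incl; left; exists f. Qed.

Lemma cv_smooth M V : bvf V -> cinf (bcot M) (fun a => cv a V).
Proof. by move=> bV; apply: gen_incl; right; exists V. Qed.

Lemma lshift0 m k : lshift k (ord0 : 'I_m.+1) = ord0 :> 'I_(m.+1 + k).
Proof. exact: val_inj. Qed.

Lemma lshift_neq0 m k (i : 'I_m.+1) : i != ord0 -> lshift k i != (ord0 : 'I_(m.+1 + k)).
Proof. by rewrite -!val_eqE. Qed.

Lemma rshift_neq0 m k (j : 'I_k) : rshift m.+1 j != (ord0 : 'I_(m.+1 + k)).
Proof. by rewrite -val_eqE. Qed.

Lemma bcot_frame M m (F : frame M m) (a : bcot M) : gclosed M -> adapted F -> fU F (base a) ->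
  exists FB : frame (bcot M) (m + m.+1), [/\ adapted FB, fU FB a,
    fc FB = @fibc R M (bcot M) (@base R M) _ _ (fc F) (fun j a => cv a (fe F j)) &
    forall z, fU FB z -> fU F (base z)].
Proof.
move=> gM [FF cF hF] Ua.
have cP j : cinf (bcot M) (fun a => cv a (fe F j)) by apply: cv_smooth; exact: fr_e.
have := @fibre_coords R M (bcot M) (@base R M) m.+1 m.+1 (fU F) (fc F)
  (fun j a => cv a (fe F j)) _ gM (@bcot_gclosed M) cF (fun f h => h) (@base_smooth M) cP.
move=> h; apply: (adapted_exists (@bcot_gclosed M) (h _ _)) => //.
- move=> f [[f' cf ->]|[V bV ->]]; first by left; exists f'.
  right; exists (fun j => feps F j V) => [j|z Uz]; first exact: fr_eps.
  exact: (covec_frame gM FF Uz (covecP z) bV).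
- move=> y p Uy; exists (mkcov gM FF p Uy) => // j; exact: mkcov_e.
- by move=> z Uz; rewrite -(lshift0 m m.+1) fibc_l; exact: hF.
Qed.

(* [l] is the form [sum_i q_i (coframe)^i] in the fibred coordinates of [F]. *)
Definition canonical_at N m (l : form1 N) (F : frame N (m + m.+1)) : Prop :=
  forall V x, bvf V -> fU F x ->
    l V x = \sum_(i < m.+1) feps F (lshift m.+1 i) V x * fc F (rshift m.+1 i) x.

(** The j-th fibre coordinate of a is its value on e_j. Every push-forward of V has the same
    components, so all candidate values in [liouville] coincide. *)
Lemma liouville_canonical M m (F : frame M m) (a : bcot M) : gclosed M -> adapted F ->
  fU F (base a) -> exists FB : frame (bcot M) (m + m.+1),
  [/\ adapted FB, fU FB a, canonical_at (@liouville R M) FB,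
   fc FB = @fibc R M (bcot M) (@base R M) _ _ (fc F) (fun j a => cv a (fe F j)) &
    forall z, fU FB z -> fU F (base z)].
Proof.
move=> gM AF Ua; have [FB [AB Ba Bc BU]] := bcot_frame gM AF Ua.
exists FB; split=> // V z bV Uz.
have [FF _ _] := AF; have [FFB _ _] := AB.
have e (i : 'I_m.+1) : bnear z (fun y => fc FB (lshift m.+1 i) y = fc F i (base y)).
  by apply: bnearS (bnearT (@bcot_gclosed M) z) => y _; rewrite Bc fibc_l.
have sb := @base_smooth M.
have ov := eps_over (@bcot_gclosed M) sb FFB FF (lshift0 m m.+1) (@lshift_neq0 m m.+1) Uz (BU z Uz) e.
have [W p] := push_over (@bcot_gclosed M) gM sb FFB FF (lshift0 m m.+1) Uz (BU z Uz) e bV.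
apply: xget_unique; first exists W => //.
  rewrite (covec_frame gM FF (BU z Uz) (covecP z) (bpush_bvf p).2).
  by apply: eq_bigr => i _; rewrite (ov _ _ i p) Bc fibc_r.
move=> r [W' p' ->].
rewrite (covec_frame gM FF (BU z Uz) (covecP z) (bpush_bvf p').2).
by apply: eq_bigr => i _; rewrite (ov _ _ i p') Bc fibc_r.
Qed.

End Framed.

(** * Darboux form, nondegeneracy and the Poisson bracket *)

Section Symplectic.
Context {R : realType}.
Variables (N : bspace R) (gN : gclosed N).

Lemma sum_lr m k (G : 'I_(m + k) -> R) :
  \sum_i G i = \sum_(i < m) G (lshift k i) + \sum_(j < k) G (rshift m j).
Proof. exact: big_split_ord. Qed.

Section Darboux.
Variables (m : nat) (l : form1 N).
Hypothesis hl : forall x, exists2 F : frame N (m + m.+1), adapted F /\ fU F x & canonical_at l F.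
Let w : form2 N := fun V W x => - d1 l V W x.
Let li (i : 'I_m.+1) : 'I_(m + m.+1).+1 := lshift m.+1 i.
Let ri (i : 'I_m.+1) : 'I_(m + m.+1).+1 := rshift m.+1 i.

Lemma canonical_cinf V : bvf V -> cinf N (l V).
Proof.
move=> bV; apply: cinf_local => // x; have [F [[FF _ _] Ux] cF] := hl x.
exists (fun y => \sum_(i < m.+1) feps F (li i) V y * fc F (ri i) y).
  by apply: cinf_sum => // i _; apply: cinfM => //; [exact: fr_eps | exact: fr_c].
by apply: bnearS (fr_open FF Ux) => y Uy; exact: cF.
Qed.

Lemma canonical_comb f V W x : cinf N f -> bvf V -> bvf W ->
  l (op_comb f V W) x = f x * l V x + l W x.
Proof.
move=> cf bV bW; have [F [[FF _ _] Ux] cF] := hl x.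
rewrite !cF//; last exact: bvf_comb.
rewrite mulr_sumr -big_split /=; apply: eq_bigr => i _.
by rewrite (eps_comb gN FF)//; ring.
Qed.

(** The coframe is closed ([eps_lieb]), so d of the sum of q_i eps_i only differentiates the fibre
    coordinates q_i. These have index different from 0, so V q_i is itself the coframe component of
    V. *)
Lemma darboux F V W x : is_frame F -> canonical_at l F -> fU F x -> bvf V -> bvf W ->
  w V W x = \sum_(i < m.+1) (feps F (li i) V x * feps F (ri i) W x
                              - feps F (li i) W x * feps F (ri i) V x).
Proof.
move=> FF cF Ux bV bW.
have bl := bvf_lieb gN bV bW.
have key A B : bvf A -> bvf B -> A (l B) x =
    \sum_(i < m.+1) (A (feps F (li i) B) x * fc F (ri i) x + feps F (li i) B x * feps F (ri i) A x).
  move=> bA bB; have pA := bvf_pder x bA.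
  have cs i : cinf N (fun y => feps F (li i) B y * fc F (ri i) y).
    by apply: cinfM => //; [exact: fr_eps | exact: fr_c].
  have -> : A (l B) x = A (fun y => \sum_(i < m.+1) feps F (li i) B y * fc F (ri i) y) x.
    apply: (pder_local gN pA); [exact: canonical_cinf|by apply: cinf_sum|].
    by apply: bnearS (fr_open FF Ux) => y Uy; exact: cF.
  rewrite (pder_sum gN pA)//; apply: eq_bigr => i _.
  rewrite pA.2; [|exact: fr_eps|exact: fr_c].
  by rewrite (fr_Vc FF (ri i) bA Ux) /rho (negbTE (rshift_neq0 m i)) mul1r.
rewrite /w /d1 (key V W)// (key W V)// (cF _ _ bl Ux) -!sumrB -sumrN.
apply: eq_bigr => i _; rewrite (eps_lieb gN FF)//; ring.
Qed.

Lemma canonical_form2 : is_form2 w.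
Proof.
split=> [V W bV bW|V W bV bW|f V V' W cf bV bV' bW].
- have cl := canonical_cinf.
  apply: cinfN => //; apply: cinfB => //; last by apply: cl; exact: bvf_lieb.
  by apply: cinfB => //; apply: bvf_cinf => //; exact: cl.
- apply/funext => x; have [F [[FF _ _] Ux] cF] := hl x.
  rewrite !(darboux FF cF Ux)// -sumrN; apply: eq_bigr => i _; ring.
- apply/funext => x; have [F [[FF _ _] Ux] cF] := hl x.
  rewrite !(darboux FF cF Ux)//; last exact: bvf_comb.
  rewrite mulr_sumr -big_split /=; apply: eq_bigr => i _.
  rewrite !(eps_comb gN FF)//; ring.
Qed.

Lemma canonical_closed V1 V2 V3 : bvf V1 -> bvf V2 -> bvf V3 -> d2 w V1 V2 V3 = fun=> 0.
Proof.
move=> b1 b2 b3; apply/funext => x.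
have cl := canonical_cinf; have bl := @bvf_lieb R N.
have E A B D : bvf A -> bvf B -> bvf D ->
    A (w B D) x = - (A (B (l D)) x - A (D (l B)) x - A (l (lieb B D)) x).
  move=> bA bB bD; have pA := bvf_pder x bA.
  have c1 : cinf N (B (l D)) by apply: bvf_cinf => //; exact: cl.
  have c2 : cinf N (D (l B)) by apply: bvf_cinf => //; exact: cl.
  have c3 : cinf N (l (lieb B D)) by apply: cl; exact: bl.
  rewrite /w /d1 (pderN gN pA) ?(pderB gN pA)//; first by apply: cinfB.
  by apply: cinfB => //; exact: cinfB.
(* The double derivatives cancel in d d l, leaving l on a Jacobi sum. As l is known to be linear
   only through [op_comb], the sum is assembled in that form and recognized as the zero field. *)
have jac : l (lieb (lieb V1 V2) V3) x + l (lieb (lieb V2 V3) V1) x + l (lieb (lieb V3 V1) V2) x = 0.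
  have c1 := cinf_cst gN 1.
  have b123 := bl _ _ gN (bl _ _ gN b1 b2) b3.
  have b231 := bl _ _ gN (bl _ _ gN b2 b3) b1.
  have b312 := bl _ _ gN (bl _ _ gN b3 b1) b2.
  have bc := bvf_comb gN c1 b123 b231.
  have e1 := canonical_comb x c1 bc b312.
  have e2 := canonical_comb x c1 b123 b231.
  rewrite e2 !mul1r in e1; rewrite -{}e1.
  have -> : op_comb (fun=> 1) (op_comb (fun=> 1) (lieb (lieb V1 V2) V3) (lieb (lieb V2 V3) V1))
     (lieb (lieb V3 V1) V2) = @op0 R N.
    apply/funext => f; apply/funext => y; rewrite /op_comb /op0 !mul1r.
    have [cf|nf] := pselect (cinf N f); last first.
      by rewrite (bvf_non b123 nf) (bvf_non b231 nf) (bvf_non b312 nf) !addr0.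
    have D A B D : bvf A -> bvf B -> bvf D ->
        A (fun x => B (D f) x - D (B f) x) y = A (B (D f)) y - A (D (B f)) y.
      move=> bA bB bD; apply: (pderB gN (bvf_pder y bA)); do 2!apply: bvf_cinf => //.
    have key A B C : bvf A -> bvf B -> bvf C -> lieb (lieb A B) C f y =
        A (B (C f)) y - B (A (C f)) y - (C (A (B f)) y - C (B (A f)) y).
      by move=> bA bB bC; rewrite -(D C A B).
    rewrite !key//; ring.
  have := canonical_comb x c1 (bvf_op0 gN) (bvf_op0 gN).
  have -> : op_comb (fun=> 1) (@op0 R N) (@op0 R N) = @op0 R N.
    by apply/funext => f; apply/funext => y; rewrite /op_comb /op0 mulr0 addr0.
  by rewrite mul1r => /eqP; rewrite -subr_eq subrr eq_sym => /eqP.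
rewrite /d2 !E// /w /d1.
have lE A B f : lieb A B f x = A (B f) x - B (A f) x by [].
rewrite !lE; move: jac.
set j1 := l (lieb (lieb V1 V2) V3) x; set j2 := l (lieb (lieb V2 V3) V1) x.
set j3 := l (lieb (lieb V3 V1) V2) x => jac.
by rewrite (_ : j3 = - j1 - j2); [ring | lra].
Qed.

(** Pairing with the frame vectors reads off, up to sign, the components of V in the conjugate
    directions. *)
Lemma canonical_nondeg p V : bvf V -> (forall W, bvf W -> w V W p = 0) ->
  forall a : covec N, base a = p -> cv a V = 0.
Proof.
move=> bV h a ap; have [F [[FF _ _] Ux] cF] := hl p.
have be := fr_e FF.
have lr i j : (li i == ri j) = false by exact: eq_lrshift.
have rl i j : (ri i == li j) = false by rewrite eq_sym lr.
have ll i j : (li i == li j) = (i == j) by exact: (inj_eq (@lshift_inj _ _)).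
have rr i j : (ri i == ri j) = (i == j) by exact: (inj_eq (@rshift_inj _ _)).
have hL i : feps F (li i) V p = 0.
  have := h _ (be (ri i)); rewrite (darboux FF cF Ux)// (bigD1 i)//= big1 => [|j ji].
    by rewrite !(eps_e gN FF)// lr eqxx mulr1 mul0r subr0 addr0.
  by rewrite !(eps_e gN FF)// lr rr (negbTE ji) mulr0 mul0r subr0.
have hR i : feps F (ri i) V p = 0.
  have := h _ (be (li i)); rewrite (darboux FF cF Ux)// (bigD1 i)//= big1 => [|j ji].
    by rewrite !(eps_e gN FF)// rl eqxx mulr0 mul1r sub0r addr0 => /eqP; rewrite oppr_eq0 => /eqP.
  by rewrite !(eps_e gN FF)// rl ll (negbTE ji) mulr0 mul0r subr0.
have ca := covecP a; rewrite ap in ca.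
rewrite (covec_frame gN FF Ux ca bV) big1// => i _.
by rewrite -[i](@splitK m.+1 m.+1); case: (fintype.split _) => j /=; rewrite ?hL ?hR mul0r.
Qed.

Lemma canonical_symplectic : bsymplectic w.
Proof.
split; [exact: canonical_form2|exact: canonical_closed|].
by move=> p V; exact: canonical_nondeg.
Qed.

(** The Darboux formula solved for X: the components of X are the derivatives of f in the conjugate
    directions. The frame fields are global, so X is a global b-vector field, Hamiltonian for f near
    x only. *)
Lemma canonical_ham f x : cinf N f ->
  exists2 X, bvf X & bnear x (fun y => forall V, bvf V -> w X V y = V f y).
Proof.
move=> cf; have [F [[FF _ _] Ux] cF] := hl x; have be := fr_e FF.
have ce i : cinf N (fe F i f) by exact: bvf_cinf.
pose Xl := op_sum (fun i => fe F (ri i) f) (fun i => fe F (li i)).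
pose Xr := op_sum (fun i y => - fe F (li i) f y) (fun i => fe F (ri i)).
have bl : bvf Xl by exact: bvf_sum.
have br : bvf Xr by apply: bvf_sum => // i; exact: cinfN.
have bX := bvf_comb gN (cinf_cst gN 1) bl br.
exists (op_comb (fun=> 1) Xl Xr) => //.
apply: bnearS (fr_open FF Ux) => y Uy V bV.
have lr i j : (li i == ri j) = false by exact: eq_lrshift.
have rl i j : (ri i == li j) = false by rewrite eq_sym lr.
have ll i j : (li i == li j) = (i == j) by exact: (inj_eq (@lshift_inj _ _)).
have rr i j : (ri i == ri j) = (i == j) by exact: (inj_eq (@rshift_inj _ _)).
(* Coframe components are viewed as covectors with coordinates 0 and 1, so that they distribute over
   [op_sum]. *)
have fcov k := mkcovP gN FF (fun j => (j == k)%:R) Uy.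
have epsE k A : bvf A -> feps F k A y = mkcov_fun F y (fun j => (j == k)%:R) A.
  move=> bA; rewrite /mkcov_fun asboolT// (bigD1 k)//= eqxx mulr1 big1 ?addr0// => j jk.
  by rewrite (negbTE jk) mulr0.
have eL i : feps F (li i) (op_comb (fun=> 1) Xl Xr) y = fe F (ri i) f y.
  rewrite (eps_comb gN FF)//; last exact: cinf_cst.
  rewrite mul1r !epsE// (covec_sum gN (fcov _)) ?(covec_sum gN (fcov _))//; last first.
    by move=> j; exact: cinfN.
  rewrite (bigD1 i)//= -!epsE// (eps_e gN FF)// eqxx mulr1 big1 => [|j ji]; last first.
    by rewrite -epsE// (eps_e gN FF)// ll eq_sym (negbTE ji) mulr0.
  rewrite big1 ?addr0// => j _.
  by rewrite -epsE// (eps_e gN FF)// lr mulr0.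
have eR i : feps F (ri i) (op_comb (fun=> 1) Xl Xr) y = - fe F (li i) f y.
  rewrite (eps_comb gN FF)//; last exact: cinf_cst.
  rewrite mul1r !epsE// (covec_sum gN (fcov _)) ?(covec_sum gN (fcov _))//; last first.
    by move=> j; exact: cinfN.
  rewrite big1 => [|j _]; last by rewrite -epsE// (eps_e gN FF)// rl mulr0.
  rewrite (bigD1 i)//= -!epsE// (eps_e gN FF)// eqxx mulr1 big1 ?addr0 ?add0r// => j ji.
  by rewrite -epsE// (eps_e gN FF)// rr eq_sym (negbTE ji) mulr0.
rewrite (darboux FF cF Uy)// (bvf_frame FF bV Uy cf); apply/esym.
apply: etrans (@sum_lr m.+1 m.+1 (fun i => feps F i V y * fe F i f y)) _.
rewrite -big_split /=; by apply: eq_bigr => i _; rewrite eL eR; ring.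
Qed.

End Darboux.

Section Poisson.
Variable w : form2 N.
Hypothesis sw : bsymplectic w.
Hypothesis ham_near : forall f x, cinf N f ->
  exists2 X, bvf X & bnear x (fun y => forall V, bvf V -> w X V y = V f y).

Let fw : is_form2 w. Proof. by case: sw. Qed.

(** Nondegeneracy speaks of covectors; it is applied to the difference of the fields and the
    covector that sends V to V g y. *)
Lemma ham_unique X X' y g : bvf X -> bvf X' -> (forall V, bvf V -> w X V y = w X' V y) ->
  cinf N g -> X g y = X' g y.
Proof.
move=> bX bX' h cg; have [w1 w2 w3] := fw; have [_ _ nd] := sw.
have cm := cinf_cst gN (-1).
have bZ := bvf_comb gN cm bX' bX.
have cE : is_covec y (fun V : op N => if `[< bvf V >] then V g y else 0).
  split=> [f V W cf bV bW|V nV]; last by rewrite asboolF.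
  by rewrite !asboolT//; exact: bvf_comb.
have := nd y _ bZ _ (Covec cE) erefl; rewrite /= asboolT//.
rewrite /op_comb mulN1r addrC => h1; apply/eqP; rewrite -subr_eq0; apply/eqP; apply: h1.
by move=> W bW; rewrite w3// h//; ring.
Qed.

(** The value at x is that of a local solution Y x chosen for x. By [ham_unique] these choices agree
    near every point with a single field, which makes the result smooth. Smoothness of f stands
    inside the existential so that [ham] is total. *)
Lemma ham_exists f : exists X, cinf N f -> bvf X /\ forall V, bvf V -> w X V = V f.
Proof.
have [cf|] := pselect (cinf N f); last by exists (@op0 R N).
have /choice[Y hY] : forall x, exists X, bvf X /\
    bnear x (fun y => forall V, bvf V -> w X V y = V f y).
  by move=> x; have [X ? ?] := ham_near x cf; exists X.
pose X : op N := fun g x => if `[< cinf N g >] then Y x g x else 0.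
have XY x : bnear x (fun y => forall g, cinf N g -> X g y = Y x g y).
  have [bx hx] := hY x; apply: bnearS hx => y hy g cg.
  have [b1 /bnear_self h1] := hY y.
  by rewrite /X asboolT//; apply: ham_unique => // V bV; rewrite h1// hy.
exists X => _.
have bX : bvf X.
  apply: bvf_intro => [g cg|x|g ng|g cg hg z cz].
  - apply: cinf_local => // x; exists (Y x g); first by apply: bvf_cinf => //; have [] := hY x.
    by apply: bnearS (XY x) => y; exact.
  - have [bY _] := hY x; have [p1 p2] := bvf_pder x bY; have e := bnear_self (XY x).
    split=> [a g g' cg cg'|g g' cg cg'].
      rewrite !e// ?p1//; apply: cinfD => //; apply: cinfM => //; exact: cinf_cst.
    by rewrite !e// ?p2//; exact: cinfM.
  - by apply/funext => x; rewrite /X asboolF.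
  - by rewrite /X asboolT//; have [bY _] := hY z; exact: (bvf_crit bY).
split=> // V bV; apply/funext => x; have [bY /bnear_self hx] := hY x.
rewrite -hx//; have [w1 w2 w3] := fw.
have cE : is_covec x (fun V' : op N => if `[< bvf V' >] then w V' V x else 0).
  exact: form2_covec.
have := covec_local gN cE bX bY; rewrite /= !asboolT//; apply.
exact: XY.
Qed.

Definition ham f : op N := projT1 (cid (ham_exists f)).

Lemma hamP f : cinf N f -> bvf (ham f) /\ forall V, bvf V -> w (ham f) V = V f.
Proof. by move=> cf; rewrite /ham; case: cid => X /=; exact. Qed.

Definition hbr : bracket N := fun f g => w (ham f) (ham g).

Lemma hbrE f g : cinf N f -> cinf N g -> hbr f g = ham g f.
Proof. by move=> /hamP[b1 h1] /hamP[b2 h2]; rewrite /hbr h1. Qed.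

Lemma hbr_dual : dual_poisson w hbr.
Proof.
move=> f g cf cg; have [b1 h1] := hamP cf; have [b2 h2] := hamP cg.
by exists (ham f), (ham g).
Qed.

Lemma hbr_anti f g : cinf N f -> cinf N g -> hbr f g = (fun x => - hbr g f x).
Proof. by move=> /hamP[b1 _] /hamP[b2 _]; have [_ w2 _] := fw; exact: w2. Qed.

Lemma hbr_cinf f g : cinf N f -> cinf N g -> cinf N (hbr f g).
Proof. by move=> /hamP[b1 _] /hamP[b2 _]; have [w1 _ _] := fw; exact: w1. Qed.

(** Linearity and the Leibniz rule hold because the bracket of f and h is X_h f, a derivation in f.
    The Jacobi identity is closedness of w on three Hamiltonian fields: all its terms become
    iterated brackets. *)
Lemma hbr_poisson : poisson hbr.
Proof.
split.
- exact: hbr_cinf.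
- move=> a f g h cf cg ch; have [bh _] := hamP ch.
  have cc : cinf N (fun x => a * f x + g x).
    by apply: cinfD => //; apply: cinfM => //; exact: cinf_cst.
  rewrite !hbrE//; apply/funext => x.
  by have [-> //] := bvf_pder x bh.
- exact: hbr_anti.
- move=> f g h cf cg ch; have [bh _] := hamP ch.
  rewrite !hbrE//; last exact: cinfM.
  by apply/funext => x; have [_ -> //] := bvf_pder x bh.
move=> f g h cf cg ch x.
have [bf hf] := hamP cf; have [bg hg] := hamP cg; have [bh hh] := hamP ch.
have [_ cl _] := sw; have [w1 w2 w3] := fw.
have := congr1 (fun F => F x) (cl _ _ _ bf bg bh); rewrite /d2.
have key A B D : bvf A -> bvf B -> bvf (ham D) -> cinf N D ->
    w (lieb A B) (ham D) x = - (A (B D) x - B (A D) x).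
  move=> bA bB bD cD; have bl := bvf_lieb gN bA bB.
  by rewrite w2//; have [_ ->] := hamP cD.
rewrite !key//.
have e A B : cinf N A -> cinf N B -> w (ham A) (ham B) = hbr A B by [].
rewrite !e//.
have c := hbr_cinf.
have en A B : cinf N A -> cinf N B -> ham A B x = - hbr A B x.
  by move=> cA cB; rewrite (hbr_anti cA cB) opprK hbrE.
have en2 A B D : cinf N A -> cinf N B -> cinf N D -> ham A (ham B D) x = hbr A (hbr B D) x.
  move=> cA cB cD.
  have -> : ham B D = fun y => - hbr B D y.
    by rewrite (hbr_anti cB cD); apply/funext => y; rewrite opprK hbrE.
  rewrite (pderN gN (bvf_pder x (hamP cA).1)); last exact: c.
  by rewrite en ?opprK//; exact: c.
rewrite !en2//.
rewrite (en f)//; last exact: c.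
rewrite (en g)//; last exact: c.
rewrite (en h)//; last exact: c.
have an A B D : cinf N A -> cinf N B -> cinf N D -> hbr A (hbr B D) x = - hbr A (hbr D B) x.
  move=> cA cB cD; rewrite -en2// (_ : ham B D = fun y => - ham D B y); last first.
    apply/funext => y; rewrite -(hbrE cD cB) -(hbrE cB cD) (hbr_anti cD cB).
    by [].
  rewrite (pderN gN (bvf_pder x (hamP cA).1)) ?en2//.
  by apply: bvf_cinf => //; have [] := hamP cD.
rewrite (an f h g)// (an g f h)// (an h g f)//.
set a := hbr f _ x; set b := hbr g _ x; set d := hbr h _ x => E.
by lra.
Qed.

End Poisson.
End Symplectic.

Section BracketIso.
Context {R : realType}.
Variables (M N : bspace R) (gM : gclosed M) (gN : gclosed N) (h : M -> N) (h' : N -> M).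
Hypotheses (hh : diffeo h h') (ch : forall x, crit N (h x) <-> crit M x).
Variables (wM : form2 M) (wN : form2 N).
Hypothesis inv : forall V W x, bvf V -> bvf W ->
  wN (opush h h' V) (opush h h' W) (h x) = wM V W x.
Hypotheses (sN : bsymplectic wN) (brM : bracket M) (brN : bracket N).
Hypotheses (dM : dual_poisson wM brM) (dN : dual_poisson wN brN).

(** The Hamiltonian field of g o h, pushed forward, solves the equation of the Hamiltonian field of
    g, which determines its values on functions. Stated for any dual brackets, so that it also
    applies to a symmetry of a single space. *)
Lemma bracket_iso f g : cinf N f -> cinf N g -> brM (f \o h) (g \o h) = brN f g \o h.
Proof.
move=> cf cg.
have sh : smooth_map h by case: hh.
have hK : cancel h h' by case: hh.
have hK' : cancel h' h by case: hh.
have [X [Y [bX bY hX hY ->]]] := dM (sh _ cf) (sh _ cg).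
have [X' [Y' [bX' bY' hX' hY' ->]]] := dN cf cg.
have bo := bvf_opush hh ch; have bo' := bvf_opush (diffeo_sym hh) (crit_sym hh ch).
apply/funext => x /=.
rewrite hX// hX'// -(opushE hh).
apply: (ham_unique gN sN) => //; first exact: bo.
move=> V bV; rewrite hY'//.
have e : V = opush h h' (opush h' h V).
  apply/funext => q; apply/funext => y; rewrite /opush hK'.
  by congr (V _ _); apply/funext => z /=; rewrite hK'.
rewrite [in LHS]e inv//; last exact: bo'.
rewrite hY; last exact: bo'.
rewrite /opush; congr (V _ _); apply/funext => z /=.
by rewrite hK'.
Qed.

End BracketIso.

(** * Slices for the action of H *)

Section Model.
Context {R : realType}.
Implicit Types L M N : bspace R.

(** R^m with empty critical set; charts, slices and their parameters then fall under the calculus of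
    smooth maps between spaces. *)
Definition RV m : bspace R := @BSpace R 'rV[R]_m (@smooth R m) set0.

Lemma half_pos (d : R) : 0 < d -> 0 < d / 2 /\ d / 2 < d.
Proof. by move=> d0; split; lra. Qed.

Lemma extl m (v : 'rV[R]_m) t l : ext v t 0 (lshift 1 l) = v 0 l.
Proof.
rewrite mxE; case: splitP => j /= e; first by congr (v 0 _); exact: val_inj.
by have := ltn_ord l; rewrite e ltnNge leq_addr.
Qed.

Lemma extr m (v : 'rV[R]_m) t l : ext v t 0 (rshift m l) = t.
Proof.
by rewrite mxE; case: splitP => j //= e; have := ltn_ord j; rewrite -e ltnNge leq_addr.
Qed.

Lemma RV_near m (x : RV m) (P : 'rV[R]_m -> Prop) : bnear x P -> \forall v \near (x : 'rV[R]_m), P v.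
Proof.
move=> [f cf [fx hf]].
have /ctsP /(_ `|f x|) := @smooth_cvg R _ f x cf; rewrite normr_gt0 => /(_ fx).
by apply: filterS => v h; apply: hf; apply: contraTneq h => ->; rewrite subr0 ltxx.
Qed.

Lemma RV_gclosed m : gclosed (RV m).
Proof.
move=> f gf; apply: smooth_loc => x; have [k [g [phi [e [e0 Fg sp E]]]]] := gf x.
have : \forall v \near (x : 'rV[R]_m), forall i, `|g i x - g i v| < e.
  apply: (@filter_forall _ _ _ (nbhs (x : 'rV[R]_m))) => i.
  by have /ctsP := @smooth_cvg R _ (g i) x (Fg i); exact.
move=> /near_rVP[d d0 hd]; exists (cube x d); first by move=> i; rewrite subrr normr0.
apply: (@smooth_on_ext _ _ _ (fun v => phi (\row_i g i v))); first exact: cube_open.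
  by move=> v /hd hv; rewrite E// => i; rewrite distrC.
by apply: smooth_smooth_on; exact: smooth_comp.
Qed.

Lemma RV_coord m i : cinf (RV m) (fun v : 'rV[R]_m => v 0 i).
Proof. exact: smooth_coord. Qed.

Lemma smooth_map_row L m (g : 'I_m -> L -> R) : gclosed L -> (forall i, cinf L (g i)) ->
  @smooth_map R L (RV m) (fun x => \row_i g i x).
Proof. by move=> gL cg f sf; exact: (cinf_comp gL sf cg). Qed.

Lemma smooth_map_comp L M N (f : L -> M) (g : M -> N) :
  smooth_map f -> smooth_map g -> smooth_map (fun x => g (f x)).
Proof. by move=> sf sg h ch; exact: sf _ (sg _ ch). Qed.

Lemma smooth_map_cst L M (y : M) : gclosed L -> @smooth_map R L M (fun=> y).
Proof. by move=> gL f _; exact: cinf_cst. Qed.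

Lemma smooth_map_id M : @smooth_map R M M id.
Proof. by []. Qed.

Lemma smooth_map_pair L M N (f : L -> M) (g : L -> N) : gclosed L ->
  smooth_map f -> smooth_map g -> @smooth_map R L (prodspace M N) (fun x => (f x, g x)).
Proof.
move=> gL sf sg F cF; apply: gL.
apply: (gen_bind (h := fun x => (f x, g x))) cF => k [[q cq ->]|[q cq ->]].
  by apply: gen_incl; exact: sf.
by apply: gen_incl; exact: sg.
Qed.

Lemma fst_smooth M N : @smooth_map R (prodspace M N) M fst.
Proof. by move=> f cf; apply: gen_incl; left; exists f. Qed.

Lemma snd_smooth M N : @smooth_map R (prodspace M N) N snd.
Proof. by move=> f cf; apply: gen_incl; right; exists f. Qed.

Lemma prod_gclosed M N : gclosed (prodspace M N).
Proof. by move=> f; exact: gen_idem. Qed.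

Lemma sub_gclosed M (A : set M) : gclosed (Defs.subspace A).
Proof. by move=> f; exact: gen_idem. Qed.

Lemma sval_smooth M (A : set M) : @smooth_map R (Defs.subspace A) M (@sval M A).
Proof. by move=> f cf; apply: gen_incl; exists f. Qed.

Lemma sub_smooth L M (A : set M) (f : L -> Defs.subspace A) : gclosed L ->
  @smooth_map R L M (fun x => @sval M A (f x)) -> smooth_map f.
Proof.
move=> gL sf F cF; apply: gL; apply: (gen_bind (h := f)) cF => k [q cq ->].
by apply: gen_incl; exact: sf.
Qed.

Lemma bcot_smooth L M (f : L -> bcot M) : gclosed L ->
  smooth_map (fun x => base (f x)) -> (forall V, bvf V -> cinf L (fun x => cv (f x) V)) ->
  smooth_map f.
Proof.
move=> gL sf sv F cF; apply: gL; apply: (gen_bind (h := f)) cF => k [[q cq ->]|[V bV ->]].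
  by apply: gen_incl; exact: sf.
by apply: gen_incl; exact: sv.
Qed.

End Model.

Section Quotient.
Context {R : realType}.
Variables (M : bspace R) (E : M -> M -> Prop).
Hypotheses (Er : forall x, E x x) (Es : forall x y, E x y -> E y x)
  (Et : forall x y z, E x y -> E y z -> E x z).

Lemma qmap_surj (y : quotspace E) : exists x, qmap E x = y.
Proof.
case: y => S [x e]; exists x; move: (ex_intro _ x e) => p; rewrite /qmap.
by subst S; congr exist; exact: Prop_irrelevance.
Qed.

Lemma qmap_eq x y : E x y -> qmap E x = qmap E y.
Proof.
move=> xy; have e : [set z | E x z] = [set z | E y z].
  by apply/seteqP; split=> z /= h; [exact: Et (Es xy) h | exact: Et xy h].
rewrite /qmap; move: (ex_intro _ x _) (ex_intro _ y _); rewrite e => p q.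
by congr exist; exact: Prop_irrelevance.
Qed.

Lemma qmap_inj x y : qmap E x = qmap E y -> E x y.
Proof.
move=> /(congr1 sval) /= e; have : [set z | E y z] y by exact: Er.
by rewrite -e.
Qed.

Lemma quot_gclosed : gclosed M -> gclosed (quotspace E).
Proof.
move=> gM f gf; apply: gM; apply: (gen_bind (h := qmap E)) gf => g cg.
exact: gen_incl.
Qed.

Lemma qlift (f : M -> R) : (forall x y, E x y -> f x = f y) ->
  exists fb : quotspace E -> R, forall x, fb (qmap E x) = f x.
Proof.
move=> hf; have /choice[r hr] := qmap_surj.
by exists (fun y => f (r y)) => x; apply: hf; apply: qmap_inj.
Qed.

Lemma quot_smooth (N : bspace R) (f : quotspace E -> N) :
  @smooth_map R M N (fun x => f (qmap E x)) -> smooth_map f.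
Proof. by move=> sf g cg; exact: sf. Qed.

End Quotient.

(** * Slices transverse to H *)

Section Group.
Context {R : realType}.
Variables (G : groupType) (C : set (G -> R)) (H : set G) (n : nat).
Hypothesis hG : blie_group C H n.
Notation GS := (gspace C H).

Lemma G_gclosed : gclosed GS.
Proof. by case: hG => -[[]]. Qed.

Lemma H1 : H 1%g. Proof. by case: hG => _ _ _ []. Qed.
Lemma HM x y : H x -> H y -> H (x * y)%g. Proof. by case: hG => _ _ _ [_ + _]; exact. Qed.
Lemma HV x : H x -> H (x^-1)%g. Proof. by case: hG => _ _ _ [_ _]; exact. Qed.
Lemma HMl x y : H x -> H (x * y)%g -> H y.
Proof. by move=> hx /(HM (HV hx)); rewrite mulgA mulVg mul1g. Qed.
Lemma Hdiv x y z : H (x * z^-1)%g -> H (y * z^-1)%g -> H (y * x^-1)%g.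
Proof. by move=> hx hy; have := HM hy (HV hx); rewrite invgM invgK mulgA divgK. Qed.

Lemma gmulS (L : bspace R) (f g : L -> GS) : gclosed L -> smooth_map f -> smooth_map g ->
  smooth_map (fun x => (f x * g x)%g : GS).
Proof.
move=> gL sf sg; have [_ sm _ _] := hG.
exact: smooth_map_comp (smooth_map_pair gL sf sg) sm.
Qed.

Lemma ginvS (L : bspace R) (f : L -> GS) : smooth_map f -> smooth_map (fun x => (f x)^-1%g : GS).
Proof. by move=> sf; have [_ _ si _] := hG; exact: smooth_map_comp sf si. Qed.

Lemma lmulS (h : G) : smooth_map (fun k : GS => (h * k)%g : GS).
Proof.
by apply: (gmulS G_gclosed); [exact: smooth_map_cst G_gclosed|exact: smooth_map_id].
Qed.

Lemma rmulS (h : G) : smooth_map (fun k : GS => (k * h)%g : GS).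
Proof.
by apply: (gmulS G_gclosed); [exact: smooth_map_id|exact: smooth_map_cst G_gclosed].
Qed.

Lemma notH_open (g : GS) : ~ H g -> bnear g (fun y => ~ H y).
Proof. by case: hG => -[_ _ + _ _] _ _ _ => h ng; exact: h. Qed.

Lemma chart_param (k : chart n.+1 GS) : is_chart k -> @smooth_map R (RV n.+1) GS (param k).
Proof. by case=> _ _ _ _ h f cf; exact: h. Qed.

(** Chart coordinates are arbitrary outside the domain of the chart; near x they are replaced by
    globally smooth functions. *)
Lemma chart_coord (k : chart n.+1 GS) (x : GS) : is_chart k -> cdom k x ->
  exists2 f : 'I_n.+1 -> GS -> R, (forall i, cinf GS (f i)) &
    bnear x (fun y => cdom k y /\ \row_i f i y = Defs.coord k y).
Proof.
move=> [ok _ _ hk _] kx.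
have /choice[f hf] : forall i, exists f, cinf GS f /\ bnear x (fun y => Defs.coord k y 0 i = f y).
  move=> i; have [f cf [V [oV Vx] e]] := hk i x kx; exists f; split=> //.
  exact: bnearS e (oV x Vx).
exists f => [i|]; first by case: (hf i).
apply: bnearS (bnearI G_gclosed (ok x kx) (bnear_all G_gclosed (fun i => (hf i).2))) => y [ky e].
by split=> //; apply/rowP => i; rewrite mxE e.
Qed.

Lemma G_chart (x : GS) : exists2 k : chart n.+1 GS, is_chart k & cdom k x.
Proof. by case: hG => -[[_ _ _ h] _ _ _ _] _ _ _; have [k [? ?]] := h x; exists k. Qed.

Lemma param_near (k : chart n.+1 GS) (x : GS) (f : 'I_n.+1 -> GS -> R) : is_chart k ->
  bnear x (fun y => cdom k y /\ \row_i f i y = Defs.coord k y) ->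
  bnear x (fun y => param k (\row_i f i y) = y).
Proof. by move=> [_ _ pk _ _]; apply: bnearS => y [ky ->]; exact: pk. Qed.

Lemma coord_param (k : chart n.+1 GS) v : is_chart k -> Defs.coord k (param k v) = v.
Proof. by move=> [_ [_ +] _ _ _]; exact. Qed.

Lemma cdom_param (k : chart n.+1 GS) v : is_chart k -> cdom k (param k v).
Proof. by move=> [_ [+ _] _ _ _]; exact. Qed.

Lemma chart1 : exists k : chart n.+1 GS,
  [/\ is_chart k, cdom k 1%g & forall y, cdom k y -> (H y <-> Defs.coord k y 0 ord0 = 0)].
Proof. by case: hG => -[_ _ _ h _] _ _ _; exact: h 1%g H1. Qed.

Section Slice.
Variable k : chart n.+1 GS.
Hypotheses (kc : is_chart k) (k1 : cdom k 1%g)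
  (kH : forall y, cdom k y -> (H y <-> Defs.coord k y 0 ord0 = 0)).
Variable f : 'I_n.+1 -> GS -> R.
Hypothesis cf : forall i, cinf GS (f i).
Let V1 y := cdom k y /\ \row_i f i y = Defs.coord k y.
Hypothesis fn : bnear (1%g : GS) V1.

Let v1 := Defs.coord k 1%g.
Let vt (t : R) : 'rV[R]_n.+1 := t *: unitv ord0 + v1.

(** The coordinate line through 1 in the direction of coordinate 0, the one that cuts out H. *)
Definition slice (t : R) : GS := param k (t *: unitv ord0 + Defs.coord k 1%g).

Lemma slice0 : slice 0 = 1%g.
Proof. by rewrite /slice scale0r add0r; case: kc => _ _ h _ _; exact: h. Qed.

Lemma sliceS (L : bspace R) (t : L -> R) : gclosed L -> cinf L t -> smooth_map (fun x => slice (t x)).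
Proof.
move=> gL ct.
have : @smooth_map R L (RV n.+1) (fun x => \row_i ((t x) * unitv ord0 0 i + v1 0 i)).
  apply: (smooth_map_row gL) => i; apply: cinfD => //; last exact: cinf_cst.
  by apply: cinfM => //; exact: cinf_cst.
move=> /smooth_map_comp/(_ (chart_param kc)).
congr smooth_map; apply/funext => x; rewrite /slice; congr (param k _).
by apply/rowP => i; rewrite !mxE.
Qed.

(** The point x s(t)^-1 for x with coordinates v. The function P is its coordinate 0, so where the
    chart applies P = 0 means that x lies in H s(t), and t is to be solved from this equation. *)
Let W : RV (n.+1 + 1) -> GS := fun w =>
  (param k (\row_i w 0 (lshift 1 i)) * (slice (w 0 (rshift n.+1 ord0)))^-1)%g.
Let P : 'rV[R]_(n.+1 + 1) -> R := fun w => f ord0 (W w).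

Let gL m : gclosed (RV m) := @RV_gclosed R m.

Let sW : smooth_map W.
Proof.
have sl : @smooth_map R (RV (n.+1 + 1)) GS (fun w : RV (n.+1 + 1) => param k (\row_i w 0 (lshift 1 i))).
  exact: (smooth_map_comp (smooth_map_row (@gL (n.+1 + 1)) (fun i : 'I_n.+1 => RV_coord (lshift 1 i))) (chart_param kc)).
have sr : @smooth_map R (RV (n.+1 + 1)) GS (fun w : RV (n.+1 + 1) => slice (w 0 (rshift n.+1 ord0))).
  by apply: (sliceS (@gL _)); exact: RV_coord.
exact: (gmulS (@gL _) sl (ginvS sr)).
Qed.

Let sP : smooth P. Proof. exact: (sW (cf ord0)). Qed.

Let WE v t : W (ext v t) = (param k v * (slice t)^-1)%g.
Proof.
rewrite /W; congr (param k _ * (slice _)^-1)%g.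
  apply/rowP => i; rewrite !mxE; case: splitP => l /= e; first by congr (v 0 _); exact: val_inj.
  by have := ltn_ord i; rewrite e ltnNge leq_addr.
rewrite mxE; case: splitP => l //= e.
by have := ltn_ord l; rewrite -e ltnNge leq_addr.
Qed.

Let f1 : f ord0 1%g = 0.
Proof.
have [_ e] := bnear_self fn; have := (kH k1).1 H1.
by rewrite -e mxE.
Qed.

Let Pdiag t : P (ext (vt t) t) = 0.
Proof. by rewrite /P WE -/(slice t) mulgV. Qed.

Let it : 'I_(n.+1 + 1) := rshift n.+1 ord0.

(** P vanishes along the diagonal, where x = s(t), so its derivatives in coordinate 0 and in t sum
    to zero; the first is 1, because for t = 0 the function P is coordinate 0 itself. *)
Let D0 : 'D_(unitv it) P (ext v1 0) = -1.
Proof.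
pose g (j : 'I_(n.+1 + 1)) (u : 'rV[R]_1) : R := ext (vt (u 0 0)) (u 0 0) 0 j.
pose dg (j : 'I_(n.+1 + 1)) : R := ext (unitv ord0) 1 0 j.
have gE j : g j = fun u => u 0 0 * dg j + ext v1 0 0 j.
  apply/funext => u; rewrite /g /dg !mxE; case: (fintype.split j) => l; rewrite ?mxE //=.
  by rewrite mulr1 addr0.
have sg j : smooth (g j).
  rewrite gE; apply: smoothD; last exact: smooth_cst.
  by apply: smoothM; [exact: smooth_coord|exact: smooth_cst].
have dgE j : 'D_(unitv 0) (g j) 0 = dg j.
  rewrite gE deriveD; [|exact: smooth_derivable (smoothM (smooth_coord 0) (smooth_cst _ _))|exact: derivable_cst].
  rewrite derive_cst addr0.
  rewrite deriveM; [|by have [] := derivable_coord (0 : 'rV[R]_1) (unitv 0) 0|exact: derivable_cst].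
  rewrite derive_cst scaler0 add0r; have [_ ->] := derivable_coord (0 : 'rV[R]_1) (unitv 0) 0.
  by rewrite mxE eqxx /= /GRing.scale /= mulr1.
have := smooth_chain 0 (0 : 'rV[R]_1) sP sg.
have -> : (fun v : 'rV[R]_1 => P (\row_j g j v)) = fun=> 0.
  apply/funext => u; rewrite -(Pdiag (u 0 0)); congr P.
  by apply/rowP => j; rewrite mxE.
have -> : \row_j g j 0 = ext v1 0.
  by apply/rowP => j; rewrite mxE gE mxE mul0r add0r.
rewrite derive_cst => /esym; rewrite sum_lr big_ord1 dgE.
rewrite (bigD1 ord0)//= big1 => [|i i0]; last first.
  rewrite dgE /dg mxE; case: splitP => l /= e; last by have := ltn_ord i; rewrite e ltnNge leq_addr.
  have -> : l = i by exact: val_inj.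
  by rewrite mxE (negbTE i0) mulr0.
rewrite dgE addr0.
have -> : dg (lshift 1 ord0) = 1.
  rewrite /dg mxE; case: splitP => l //= e.
  have -> : l = ord0 by exact: val_inj.
  by rewrite mxE.
have -> : dg (rshift n.+1 ord0) = 1.
  by rewrite /dg mxE; case: splitP => l //= e; have := ltn_ord l; rewrite -e ltnNge leq_addr.
suff -> : 'D_(unitv (lshift 1 ord0)) P (ext v1 0) = 1.
  by rewrite /it; set b := 'D_ _ P _; move=> e; lra.
have : is_derive (ext v1 0) (unitv (lshift 1 ord0)) P 1.
  apply/is_derive_line0.
  have e : \forall t \near (0 : R), t + 0 = P (t *: unitv (lshift 1 ord0) + ext v1 0).
    have sp := smooth_map_comp (smooth_map_row (@RV_gclosed R 1)
      (fun i : 'I_n.+1 => (cinfD (@RV_gclosed R 1) (cinfM (@RV_gclosed R 1) (RV_coord 0) (cinf_cst (@RV_gclosed R 1) (unitv ord0 0 i))) (cinf_cst (@RV_gclosed R 1) (v1 0 i))))) (chart_param kc).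
    have pE (u : 'rV[R]_1) : param k (\row_i (u 0 0 * unitv ord0 0 i + v1 0 i)) = slice (u 0 0).
      by congr (param k _); apply/rowP => i; rewrite !mxE.
    have h0 : param k (\row_i ((0 : 'rV[R]_1) 0 0 * unitv ord0 0 i + v1 0 i)) = 1%g.
      by rewrite pE mxE slice0.
    have : bnear (0 : RV 1) (fun u => V1 (slice (u 0 0))).
      have := @bnear_smooth R (RV 1) GS _ (0 : RV 1) V1 sp; rewrite h0 => /(_ fn).
      by apply: bnearS => u; rewrite pE.
    move=> /RV_near /near_rVP[e e0 he]; apply/nbhs_ballP; exists e => // t.
    rewrite -ball_normE /= sub0r normrN => te.
    have [|_ ee] := he (\row_i t); first by move=> i; rewrite !mxE subr0.
    rewrite -ext_line1 /P WE slice0 invg1 mulg1 addr0.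
    rewrite mxE in ee; have /rowP/(_ ord0) := ee; rewrite mxE => ->.
    by rewrite coord_param// !mxE /= mulr1 (kH k1).1 ?addr0//; exact: H1.
  apply: near_eq_is_derive e _.
  have := is_deriveD (is_derive_id (0 : R) (1 : R)) (is_derive_cst (0 : R) (0 : R) (1 : R)).
  by rewrite (addr0 (1 : R)).
by case.
Qed.

Let gG := G_gclosed.

(** The bound 3 d leaves room for the mean value theorem: for |t|, |r| < d, an intermediate point t
    + u with |u| <= |r - t| has absolute value below 3 d. *)
Lemma slice_radius : exists2 d : R, 0 < d & forall t r, `|t| < d + d + d -> `|r| < d + d + d ->
  'D_(unitv it) P (ext (vt t) r) != 0 /\ V1 (slice t * (slice r)^-1)%g.
Proof.
have sl (i : 'I_2) : @smooth_map R (RV 2) GS (fun u => slice (u 0 i)).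
  by apply: (sliceS (@gL 2)); exact: RV_coord.
have sW2 : @smooth_map R (RV 2) GS (fun u => slice (u 0 ord0) * (slice (u 0 ord_max))^-1)%g.
  exact: (gmulS (@gL 2) (sl _) (ginvS (sl _))).
have h1 : bnear (0 : RV 2) (fun u => V1 (slice (u 0 ord0) * (slice (u 0 ord_max))^-1)%g).
  apply: (@bnear_smooth R (RV 2) GS _ (0 : RV 2) V1 sW2).
  by rewrite !mxE mulgV.
pose g (j : 'I_(n.+1 + 1)) (u : 'rV[R]_2) : R := ext (vt (u 0 ord0)) (u 0 ord_max) 0 j.
have sg j : cinf (RV 2) (g j).
  case: (splitP j) => l e.
    have -> : g j = fun u => u 0 ord0 * unitv ord0 0 l + v1 0 l.
      have -> : j = lshift 1 l by exact: val_inj.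
      by apply/funext => u; rewrite /g extl !mxE.
    apply: (cinfD (@gL 2)); last exact: (cinf_cst (@gL 2) _).
    by apply: (cinfM (@gL 2)); [exact: RV_coord|exact: (cinf_cst (@gL 2) _)].
  have -> : g j = fun u => u 0 ord_max.
    have -> : j = rshift n.+1 l by exact: val_inj.
    by apply/funext => u; rewrite /g extr.
  exact: RV_coord.
have h2 : bnear (0 : RV 2) (fun u => 'D_(unitv it) P (\row_j g j u) != 0).
  apply: (bnear_neq (@gL 2)); first exact: (cinf_comp (@gL 2) (smooth_derive it sP) sg).
  have -> : \row_j g j 0 = ext v1 0.
    by apply/rowP => j; rewrite mxE /g !mxE /vt scale0r add0r.
  by rewrite D0 oppr_eq0 oner_eq0.
have /RV_near/near_rVP[e e0 he] := bnearI (@gL 2) h1 h2.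
exists (e / 3); first by rewrite divr_gt0.
move=> t r ht hr; have E : e / 3 + e / 3 + e / 3 = e by field.
rewrite E in ht hr.
have [|] := he (\row_(i < 2) (if i == ord0 then t else r)).
  by move=> i; rewrite !mxE subr0; case: ifP.
rewrite !mxE /= => hV; split=> //.
have -> : ext (vt t) r = \row_j g j (\row_(i < 2) (if i == ord0 then t else r)) => //.
by apply/rowP => j; rewrite mxE /g !mxE /=.
Qed.

Section Radius.
Variable d : R.
Hypotheses (d0 : 0 < d) (hd : forall t r, `|t| < d + d + d -> `|r| < d + d + d ->
  'D_(unitv it) P (ext (vt t) r) != 0 /\ V1 (slice t * (slice r)^-1)%g).

(** With x = s(t) fixed, P vanishes for both parameters t and r while its derivative is nonzero in
    between. *)
Lemma slice_inj t r : `|t| < d -> `|r| < d -> H (slice t * (slice r)^-1)%g -> t = r.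
Proof.
move=> ht hr hH.
have d3 (x : R) : `|x| < d -> `|x| < d + d + d by move=> h; apply: lt_trans h _; rewrite -addrA ltrDl addr_gt0.
have [_ [kd e]] := hd (d3 _ ht) (d3 _ hr).
have P0 : P (ext (vt t) r) = 0.
  by rewrite /P WE -/(slice t); have := (kH kd).1 hH; rewrite -e mxE.
have extE u : ext (vt t) (t + u) = u *: unitv it + ext (vt t) t.
  by rewrite -ext_line addrC.
have [u hu] := @MVT_line R _ P (ext (vt t) t) (unitv it) (r - t)
  (fun u _ => @smooth_derivable R _ P it _ sP).
rewrite -!extE Pdiag (addrC t) subrK P0 subrr.
have ht3 : `|t + u| < d + d + d.
  have := ler_normD t u; have := ler_normB r t; lra.
have [D _] := hd (d3 _ ht) ht3.
by move=> /esym/eqP; rewrite mulf_eq0 (negbTE D) orbF subr_eq0 => /eqP.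
Qed.

Definition in_slice (g : GS) (t : R) := `|t| < d /\ H (g * (slice t)^-1)%g.

Lemma in_slice_inj g t r : in_slice g t -> in_slice g r -> t = r.
Proof.
move=> [ht Ht] [hr Hr]; apply: slice_inj => //.
by have := HM (HV Ht) Hr; rewrite invgM invgK mulgA divgK.
Qed.

Lemma in_slice_inv h g t : H h -> in_slice (h * g)%g t <-> in_slice g t.
Proof.
move=> hh; rewrite /in_slice -mulgA; split=> -[? h2]; split=> //; first exact: HMl hh h2.
exact: HM.
Qed.

(* The parameter [t] with [g \in H s(t)] depends smoothly on [g]: solve
   [f ord0 (h0^-1 g s(t)^-1) = 0] for [t]. *)
Lemma in_slice_near g0 t0 : in_slice g0 t0 -> exists2 tau, cinf GS tau &
  bnear g0 (fun g => in_slice g (tau g)).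
Proof.
move=> [ht Ht]; set h0 := (g0 * _)%g in Ht.
have d3 (x : R) : `|x| < d -> `|x| < d + d + d by move=> h; apply: lt_trans h _; rewrite -addrA ltrDl addr_gt0.
have [D _] := hd (d3 _ ht) (d3 _ ht).
have [T sT [Tv hT]] := implicit_function sP (Pdiag t0) D.
have hg0 : (h0^-1 * g0)%g = slice t0 by rewrite /h0 invgM invgK divgK.
have ks : cdom k (slice t0) by exact: cdom_param.
have [f' cf' nf'] := chart_coord kc ks.
have f'0 : \row_i f' i (slice t0) = vt t0 by have [_ ->] := bnear_self nf'; rewrite coord_param.
have sm := lmulS h0^-1%g.
pose tau g := T (\row_i f' i (h0^-1 * g)%g).
have ct : cinf GS tau by apply: (cinf_comp gG sT) => i; exact: sm.
have tau0 : tau g0 = t0 by rewrite /tau hg0 f'0.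
exists tau => //.
have n1 : bnear g0 (fun g => param k (\row_i f' i (h0^-1 * g)%g) = (h0^-1 * g)%g).
  apply: (@bnear_smooth R GS GS _ g0 (fun y => param k (\row_i f' i y) = y) sm).
  by rewrite hg0; exact: param_near nf'.
have n2 : bnear g0 (fun g => P (ext (\row_i f' i (h0^-1 * g)%g) (tau g)) = 0).
  apply: (@bnear_rV R GS gG g0 _ (fun i g => f' i (h0^-1 * g)%g) (fun v => P (ext v (T v)) = 0)).
    by move=> i; exact: sm.
  by rewrite hg0 f'0.
have sq : @smooth_map R GS GS (fun g => (h0^-1 * g) * (slice (tau g))^-1)%g.
  by apply: (gmulS gG sm); apply: ginvS; exact: sliceS.
have n3 : bnear g0 (fun g => V1 (h0^-1 * g * (slice (tau g))^-1)%g).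
  by apply: (@bnear_smooth R GS GS _ g0 V1 sq); rewrite tau0 hg0 mulgV.
have n4 : bnear g0 (fun g => `|tau g| < d).
  have := bnearI gG (@bnear_lt R GS gG g0 tau d ct _) (@bnear_gt R GS gG g0 tau (- d) ct _).
  rewrite tau0; move: ht; rewrite ltr_norml => /andP[l1 l2] /(_ l2 l1).
  by apply: bnearS => y [h1 h2]; rewrite ltr_norml h1 h2.
apply: bnearS (bnearI gG (bnearI gG n1 n2) (bnearI gG n3 n4)) => g [[e1 e2] [[kd e3] e4]].
split=> //; apply: (HMl (HV Ht)); rewrite mulgA; apply/(kH kd).
by rewrite -e3 mxE; move: e2; rewrite /P WE e1.
Qed.

(* compactness of [-d/2, d/2] *)
Lemma out_slice_near g0 : (forall t, ~ in_slice g0 t) ->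
  bnear g0 (fun g => forall t, `|t| < d / 2 -> ~ in_slice g t).
Proof.
move=> h0; have [k' kc' kg] := G_chart g0.
have [f' cf' nf'] := chart_coord kc' kg.
pose q (w : RV (n.+1 + 1)) : GS :=
  (param k' (\row_i w 0 (lshift 1 i)) * (slice (w 0 (rshift n.+1 ord0)))^-1)%g.
have sq : @smooth_map R (RV (n.+1 + 1)) GS q.
  apply: (gmulS (@gL _)); last by apply: ginvS; apply: (sliceS (@gL _)); exact: RV_coord.
  exact: (smooth_map_comp (smooth_map_row (@gL (n.+1 + 1)) (fun i : 'I_n.+1 => RV_coord (lshift 1 i))) (chart_param kc')).
have qE v t : q (ext v t) = (param k' v * (slice t)^-1)%g.
  congr (param k' _ * (slice _)^-1)%g; last exact: extr.
  by apply/rowP => i; rewrite mxE extl.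
pose v0 := Defs.coord k' g0.
have pv0 : param k' v0 = g0 by case: kc' => _ _ + _ _; exact.
(* A compact interval inside |t| < d. This loss is why the functions glued below are required to
   vanish unless |t| < d / 2. *)
pose K : set R := `[- (d / 2), d / 2]%classic.
have cK : compact K by exact: segment_compact.
have hK : \forall v \near v0, K `<=` (fun t => ~ H (param k' v * (slice t)^-1)%g).
  apply: ((compact_near_coveringP K).1 cK _ (nbhs v0) (fun v t => ~ H (param k' v * (slice t)^-1)%g)) => // t; rewrite /K /= in_itv /= -ler_norml => ht.
  have nH : ~ H (q (ext v0 t)).
    by rewrite qE pv0 => hH; apply: (h0 t); split=> //; apply: le_lt_trans ht (half_pos d0).2.
  have := bnear_smooth sq (notH_open nH) => /RV_near/near_rVP[e e0 he].
  exists ([set t' | `|t - t'| < e], cube v0 e).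
    by split=> /=; [apply/nbhs_ballP; exists e|exact: cube_near].
  move=> [t' v] /= [ht' hv]; rewrite -qE; apply: he => i.
  rewrite !mxE; case: (fintype.split i) => l; first exact: hv.
  by rewrite distrC.
have : bnear g0 (fun g => K `<=` (fun t => ~ H (param k' (\row_i f' i g) * (slice t)^-1)%g)).
  apply: (@bnear_rV R GS gG g0 _ f' (fun v => K `<=` (fun t => ~ H (param k' v * (slice t)^-1)%g))) => //.
  by have [_ ->] := bnear_self nf'.
move=> /(bnearI gG (param_near kc' nf')); apply: bnearS => g [e hg] t ht [_].
by rewrite e in hg; apply: hg; rewrite /K /= in_itv /= -ler_norml ltW.
Qed.

(* [F g] is [beta t] on the orbit of [s(t)]; it is extended by [0]. *)
Lemma slice_glue (beta : 'rV[R]_1 -> R) : smooth beta ->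
  (forall u : 'rV[R]_1, ~ `|u 0 0| < d / 2 -> beta u = 0) ->
  exists2 F, cinf GS F & [/\ forall h g, H h -> F (h * g)%g = F g,
    forall g t, in_slice g t -> F g = beta (\row_(i < 1) t)
    & forall g, F g != 0 -> exists t, in_slice g t].
Proof.
move=> sb hb.
have /choice[F hF] : forall g, exists r, (forall t, in_slice g t -> r = beta (\row_(i < 1) t)) /\
    ((forall t, ~ in_slice g t) -> r = 0).
  move=> g; have [[t ht]|h] := pselect (exists t, in_slice g t).
    exists (beta (\row_(i < 1) t)); split=> [t' ht'|/(_ t)//].
    by rewrite (in_slice_inj ht ht').
  by exists 0; split=> // t ht; exfalso; apply: h; exists t.
exists F; last split.
- apply: (cinf_local gG) => g0; have [[t0 ht0]|h] := pselect (exists t, in_slice g0 t).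
    have [tau ct nt] := in_slice_near ht0.
    exists (fun g => beta (\row_(i < 1) tau g)); first exact: (cinf_comp gG sb (fun=> ct)).
    by apply: bnearS nt => g; exact: (hF g).1.
  exists (fun=> 0); first exact: cinf_cst.
  apply: bnearS (out_slice_near (fun t ht => h (ex_intro _ t ht))) => g hg.
  have [[t ht]|h'] := pselect (exists t, in_slice g t); last first.
    by apply: (hF g).2 => t ht; apply: h'; exists t.
  by rewrite ((hF g).1 t ht) hb// mxE => /hg; exact.
- move=> h g hh; have [[t ht]|h'] := pselect (exists t, in_slice g t).
    by rewrite ((hF g).1 t ht) ((hF _).1 t)//; apply/in_slice_inv.
  rewrite ((hF g).2) ?(hF _).2// => t ht; apply: h'; exists t => //.
  by apply/(in_slice_inv g t hh).
- by move=> g t ht; exact: (hF g).1.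
- move=> g Fg; apply: contrapT => h; move/eqP: Fg; apply; apply: (hF g).2 => t ht.
  by apply: h; exists t.
Qed.

(** T is the slice parameter cut off by the bump b, and chi comes from a narrower bump supported
    where b = 1; on the nonvanishing set of chi the value of T is therefore the true parameter. *)
Lemma slice_functions : exists T chi, [/\ cinf GS T, cinf GS chi,
  (forall h g, H h -> T (h * g)%g = T g /\ chi (h * g)%g = chi g),
  chi 1%g != 0 & exists2 e : R, 0 < e & (forall t, `|t| < e -> T (slice t) = t) /\
    forall g, chi g != 0 -> H (g * (slice (T g))^-1)%g /\ `|T g| < e].
Proof.
have bn (e : R) : 0 < e -> bnear (0 : RV 1) (fun u => `|(u : 'rV[R]_1) 0 0| < e).
  move=> e0; have c0 : cinf (RV 1) (fun u : 'rV[R]_1 => u 0 0) by exact: RV_coord.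
  have := bnearI (@gL 1) (bnear_lt (@gL 1) (x := 0) c0 (a := e) _) (bnear_gt (@gL 1) (x := 0) c0 (a := - e) _).
  rewrite mxE oppr_lt0 => /(_ e0 e0); apply: bnearS => u [h1 h2].
  by rewrite ltr_norml h1 h2.
have bmp (e : R) : 0 < e -> exists2 b : 'rV[R]_1 -> R, smooth b &
    bnear (0 : RV 1) (fun u => b u = 1) /\ forall u : 'rV[R]_1, ~ `|u 0 0| < e -> b u = 0.
  move=> /bn ne; have [b sb [b1 hb]] := @bump_exists R (RV 1) (@gL 1) 0 _ ne; exists b => //; split=> // u hu.
  by have [/bnear_self|/bnear_self] := hb u.
have [d20 d2d] := half_pos d0.
have [b sb [b1 hb]] := bmp _ d20.
have /RV_near/near_rVP[e1 e10 he1] := b1.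
pose e := Num.min e1 (d / 2).
have e0 : 0 < e by rewrite lt_min e10.
have [b' sb' [b'1 hb']] := bmp _ e0.
have [|T cT [Ti Ts Tn]] := slice_glue (smoothM sb (smooth_coord 0)).
  by move=> u hu; rewrite hb// mul0r.
have [|chi cc [ci cs cn]] := slice_glue sb'.
  by move=> u hu; apply: hb' => h; apply: hu; apply: lt_le_trans h _; rewrite ge_min lexx orbT.
have bE t : `|t| < e -> b (\row_(i < 1) t) = 1.
  by move=> ht; apply: he1 => i; rewrite !mxE subr0; apply: lt_le_trans ht _; rewrite ge_min lexx.
have ed t : `|t| < e -> `|t| < d.
  by move=> ht; apply: lt_trans (lt_le_trans ht (_ : e <= d / 2)) d2d; rewrite ge_min lexx orbT.
have ins t : `|t| < e -> in_slice (slice t) t by move=> /ed ht; split=> //; rewrite mulgV; exact: H1.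
exists T, chi; split=> //.
- by move=> h g hh; rewrite Ti// ci.
- rewrite -slice0 (cs _ 0 (ins _ _)) ?normr0//.
  have -> : \row_(i < 1) (0 : R) = 0 by apply/rowP => i; rewrite !mxE.
  by rewrite (bnear_self b'1) oner_eq0.
- exists e => //; split=> [t ht|g cg].
    by rewrite (Ts _ t (ins _ ht)) bE// mul1r mxE.
  have [t ht] := cn _ cg; move: cg; rewrite (cs _ _ ht) => cg.
  have te : `|t| < e.
    by apply: contrapT => h; move: cg; rewrite hb' ?eqxx//= mxE.
  by rewrite (Ts _ _ ht) bE// mul1r mxE; split=> //; case: ht.
Qed.

End Radius.
End Slice.
End Group.

(** * Simultaneous charts of G and of G/H *)

Section Charts.
Context {R : realType}.
Variables (G : groupType) (C : set (G -> R)) (H : set G) (n : nat).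
Hypothesis hG : blie_group C H n.
Notation GS := (gspace C H).
Notation GQ := (GmodH C H).
Notation pi := (@piG R G C H).

Let gG : gclosed GS := G_gclosed hG.

Lemma orbG_refl (x : GS) : orbG x x.
Proof. by exists 1%g; [exact: H1 hG|rewrite mul1g]. Qed.

Lemma orbG_sym (x y : GS) : orbG x y -> orbG y x.
Proof. by move=> [h hh ->]; exists h^-1%g; [exact: HV hG _ hh|rewrite mulKg]. Qed.

Lemma orbG_trans (x y z : GS) : orbG x y -> orbG y z -> orbG x z.
Proof. by move=> [h hh ->] [h' hh' ->]; exists (h' * h)%g; [exact: HM hG _ _ hh' hh|rewrite mulgA]. Qed.

Lemma orbGP (x y : GS) : orbG x y <-> H (y * x^-1)%g.
Proof.
split=> [[h hh ->]|hh]; first by rewrite mulgK.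
by exists (y * x^-1)%g => //; rewrite divgK.
Qed.

Lemma piG_eq (x y : GS) : H (y * x^-1)%g -> pi x = pi y.
Proof. by move=> h; apply: qmap_eq; [exact: orbG_sym|exact: orbG_trans|exact/orbGP]. Qed.

Lemma piG_mul (h : G) (x : GS) : H h -> pi (h * x)%g = pi x.
Proof. by move=> hh; apply/esym/piG_eq; rewrite mulgK. Qed.

Lemma piG_inj (x y : GS) : pi x = pi y -> H (y * x^-1)%g.
Proof. by move=> e; apply/orbGP; apply: (@qmap_inj R GS (@orbG R G C H)) e; exact: orbG_refl. Qed.

Lemma piG_surj (q : GQ) : exists x : GS, pi x = q.
Proof. exact: qmap_surj. Qed.

Lemma piG_smooth : @smooth_map R GS GQ pi.
Proof. by []. Qed.

Lemma piG_lift (f : GS -> R) : (forall h x, H h -> f (h * x)%g = f x) ->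
  exists fb : GQ -> R, forall x, fb (pi x) = f x.
Proof.
move=> hf; apply: (@qlift R GS (@orbG R G C H)); first exact: orbG_refl.
by move=> x y [h hh ->]; rewrite hf.
Qed.

Lemma GQ_gclosed : gclosed GQ.
Proof. exact: quot_gclosed. Qed.
Let gQ := GQ_gclosed.

Lemma crit_piG (x : GS) : crit GQ (pi x) <-> H x.
Proof.
split=> [[h hh /piG_inj e]|hx]; last by exists x.
by have := HM hG e hh; rewrite divgK.
Qed.

(** The last condition puts each level of coordinate 0 inside a single orbit; the frame vectors
    tangent to the levels are then vertical. *)
Definition bundle_charts (FG : frame GS n) (FQ : frame GQ 0) :=
  [/\ adapted FG, adapted FQ, forall x, fU FG x -> fU FQ (pi x),
      forall x, fc FG ord0 x = fc FQ ord0 (pi x)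
    & forall x y, fU FG x -> fU FG y -> fc FG ord0 x = fc FG ord0 y -> H (y * x^-1)%g].

Section Slice.
Variable k : chart n.+1 GS.
Hypotheses (kc : is_chart k) (k1 : cdom k 1%g)
  (kH : forall y, cdom k y -> (H y <-> Defs.coord k y 0 ord0 = 0)).
Variable f : 'I_n.+1 -> GS -> R.
Hypothesis cf : forall i, cinf GS (f i).
Let V1 (y : GS) := cdom k y /\ \row_i f i y = Defs.coord k y.
Hypothesis fn : bnear (1%g : GS) V1.
Notation s := (slice k).
Variables (T chi : GS -> R) (e : R).
Hypotheses (cT : cinf GS T) (cchi : cinf GS chi)
  (inv : forall h g, H h -> T (h * g)%g = T g /\ chi (h * g)%g = chi g)
  (chi1 : chi 1%g != 0) (e0 : 0 < e) (Ts : forall t, `|t| < e -> T (s t) = t)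
  (chin : forall g, chi g != 0 -> H (g * (s (T g))^-1)%g /\ `|T g| < e).

Let T1 : T 1%g = 0.
Proof. by rewrite -(slice0 kc k1) Ts// normr0. Qed.

(** An H-invariant function vanishing at 1 but not at g is needed. Right translates of chi and T
    stay invariant: chi(x g^-1) is nonzero at g. If T(g^-1) = 0, then chi(g^-1) = 0, as otherwise
    g^-1 would lie in H; if not, the factor T(x g^-1) - T(g^-1) is added. *)
Lemma nocrit_open (q : GQ) : ~ crit GQ q -> bnear q (fun y => ~ crit GQ y).
Proof.
have [g <-] := piG_surj q; rewrite crit_piG => ng.
suff [F [cF Fi Fg F1]] : exists F : GS -> R, [/\ cinf GS F, forall h x, H h -> F (h * x)%g = F x,
    F g != 0 & F 1%g = 0].
  have [Fb hb] := piG_lift Fi; exists Fb; first by congr (cinf GS _): cF; apply/funext => x; rewrite hb.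
  rewrite hb; split=> // y; have [x <-] := piG_surj y; rewrite hb crit_piG => Fx hx.
  by move/negP: Fx; apply; rewrite -(mulg1 x) Fi// F1.
have sr := rmulS hG g^-1%g.
have [Tg|Tg] := eqVneq (T g^-1%g) 0.
  exists (fun x => chi (x * g^-1)%g); split.
  - exact: sr.
  - by move=> h x hh; rewrite -mulgA; exact: (inv _ hh).2.
  - by rewrite mulgV.
  - rewrite mul1g; apply/eqP/negPn/negP => /chin[+ _].
    by rewrite Tg (slice0 kc k1) invg1 mulg1 => /(HV hG); rewrite invgK.
exists (fun x => chi (x * g^-1)%g * (T (x * g^-1)%g - T g^-1%g)); split.
- by apply: cinfM => //; [exact: sr|apply: cinfB => //; [exact: sr|exact: cinf_cst]].
- by move=> h x hh; rewrite -mulgA !(inv _ hh).1 (inv _ hh).2.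
- by rewrite mulgV T1 sub0r mulf_neq0// oppr_eq0.
- by rewrite mul1g subrr mulr0.
Qed.

Variable g0 : GS.
Let T0 g := T (g * g0^-1)%g.
Let chi0 g := chi (g * g0^-1)%g.
Let T0i h g : H h -> T0 (h * g)%g = T0 g.
Proof. by move=> hh; rewrite /T0 -mulgA (inv _ hh).1. Qed.
Let chi0i h g : H h -> chi0 (h * g)%g = chi0 g.
Proof. by move=> hh; rewrite /chi0 -mulgA (inv _ hh).2. Qed.
Let cT0 : cinf GS T0. Proof. exact: (rmulS hG g0^-1%g). Qed.
Let cchi0 : cinf GS chi0. Proof. exact: (rmulS hG g0^-1%g). Qed.
Let T0s t : `|t| < e -> T0 (s t * g0)%g = t.
Proof. by move=> h; rewrite /T0 mulgK Ts. Qed.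
Let chi0n g : chi0 g != 0 -> H (g * (s (T0 g) * g0)^-1)%g /\ `|T0 g| < e.
Proof. by move=> /chin[h1 h2]; split=> //; rewrite invgM mulgA. Qed.

(* Shifting the coordinate by [e] away from [H] keeps it nonzero there. *)
Let kap : R := if `[< H g0 >] then 0 else e.

Let sst (L : bspace R) (t : L -> R) : gclosed L -> cinf L t ->
  smooth_map (fun x => s (t x - kap) * g0 : GS)%g.
Proof.
move=> gL ct; apply: (gmulS hG gL); last exact: smooth_map_cst.
by apply: (sliceS kc gL); apply: cinfB => //; exact: cinf_cst.
Qed.

Let near_e (u : R) (m : nat) (i : 'I_m) (v : 'rV[R]_m) : `|u| < e -> v 0 i = u + kap ->
  \forall w \near v, `|(w : 'rV[R]_m) 0 i - kap| < e.
Proof.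
move=> ue vi; apply/near_rVP; exists (e - `|u|); first by rewrite subr_gt0.
move=> w /(_ i); rewrite vi ltrBrDr => h; apply: le_lt_trans h.
by rewrite -{1}(subrK (u + kap) (w 0 i)) -addrA addrK ler_normD.
Qed.

(** The invariant function T0 + kap descends, with inverse the projected curve s(t - kap) g0. Around
    a point outside H the critical point is removed from the domain, and |T0| < e keeps T0 + e away
    from 0. *)
Lemma quotient_chart : exists FQ : frame GQ 0, [/\ adapted FQ, fU FQ (pi g0),
  (forall x, fc FQ ord0 (pi x) = T0 x + kap) & forall x, fU FQ (pi x) -> chi0 x != 0].
Proof.
have [Tb hT] := piG_lift T0i; have [chib hc] := piG_lift chi0i.
have cTb : cinf GQ Tb by congr (cinf GS _): cT0; apply/funext => x; rewrite hT.
have cchib : cinf GQ chib by congr (cinf GS _): cchi0; apply/funext => x; rewrite hc.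
pose U (q : GQ) := chib q != 0 /\ (H g0 \/ ~ crit GQ q).
pose c (i : 'I_1) (q : GQ) := Tb q + kap.
have hU x : U (pi x) -> `|T0 x| < e /\ pi (s (T0 x) * g0)%g = pi x.
  by move=> [+ _]; rewrite hc => /chi0n[hh he]; split=> //; exact: piG_eq.
have cc : coords U c.
  split.
  - move=> q [q1 q2]; apply: bnearI => //; first exact: bnear_neq.
    case: q2 => q2; first by apply: bnearS (bnearT gQ q) => y _; left.
    by apply: bnearS (nocrit_open q2) => y; right.
  - by move=> i; apply: cinfD => //; exact: cinf_cst.
  - move=> q y cq Uy; exists (fun v : 'rV[R]_1 => q (pi (s (v 0 0 - kap) * g0)%g)).
      exact: (@sst (RV 1) _ (@RV_gclosed R 1) (RV_coord 0) _ cq).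
    have Un : bnear y U.
      apply: bnearI => //; first by apply: bnear_neq => //; case: Uy.
      case: (Uy) => _ [] q2; first by apply: bnearS (bnearT gQ y) => z _; left.
      by apply: bnearS (nocrit_open q2) => z; right.
    apply: bnearS Un => z; have [x <-] := piG_surj z => /hU[_ hx].
    by rewrite mxE /c addrK hT hx.
  - move=> y P; have [x <-] := piG_surj y => Ux nP; have [hx px] := hU _ Ux.
    have st := @sst (RV 1) _ (@RV_gclosed R 1) (RV_coord 0).
    have := @bnear_smooth R (RV 1) GQ _ (\row_i c i (pi x) : RV 1) P (smooth_map_comp st piG_smooth).
    rewrite mxE /c addrK hT px => /(_ nP)/RV_near h.
    have n3 := @near_e (T0 x) 1 0 (\row_(i < 1) (T0 x + kap)) hx.
    rewrite mxE in n3; move: (n3 erefl) => {}n3.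
    apply: filterS (filterI h n3) => v [Pv hv].
    exists (pi (s (v 0 0 - kap) * g0)%g) => //.
    by apply/rowP => i; rewrite mxE hT T0s// subrK ord1.
have cU q : U q -> (crit GQ q <-> c ord0 q = 0).
  have [x <-] := piG_surj q => Ux; have [hx _] := hU _ Ux; rewrite crit_piG /c hT /kap.
  case: asboolP => h0.
    rewrite addr0; split=> [hh|tx].
      by rewrite -(mulg1 x) T0i// /T0 mul1g -(mulg1 g0^-1%g) (inv _ (HV hG h0)).1.
    have [+ _] := Ux; rewrite hc => /chi0n[+ _]; rewrite tx (slice0 kc k1) mul1g => h1.
    by have := HM hG h1 h0; rewrite divgK.
  split=> [hh|/eqP]; first by case: Ux => _ [|]// /(_ (ex_intro2 _ _ x hh erefl)).
  by rewrite addr_eq0 => /eqP h; move: hx; rewrite h normrN gtr0_norm// ltxx.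
have Ug : U (pi g0).
  split; first by rewrite hc /chi0 mulgV.
  by have [|h] := pselect (H g0); [left|right; rewrite crit_piG].
have [FQ [A F0 Fc FU]] := adapted_exists gQ cc cU Ug.
exists FQ; split=> //; first by move=> x; rewrite Fc /c hT.
by move=> x /FU[]; rewrite hc.
Qed.

(** Near g0 one has g = w(g) s(T0 g) g0 with w(g) in H. The coordinates are T0 + kap and the
    coordinates 1 to n of w(g) in the chart at 1, where coordinate 0 of w(g) vanishes; y is the
    inverse map. *)
Lemma bundle_chart_at : exists FG FQ, bundle_charts FG FQ /\ fU FG g0.
Proof.
have [FQ [AQ FQg FQc FQU]] := quotient_chart.
have oQ q : fU FQ q -> bnear q (fU FQ) by case: AQ => _ [+ _ _ _] _; exact.
pose w (g : GS) : GS := (g * (s (T0 g) * g0)^-1)%g.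
have sw : @smooth_map R GS GS w.
  have s1 : @smooth_map R GS GS (fun g => s (T0 g) * g0)%g.
    by apply: (gmulS hG gG); [exact: (sliceS kc gG cT0)|exact: smooth_map_cst].
  exact: (gmulS hG gG (@smooth_map_id R GS) (ginvS hG s1)).
pose U g := bnear (w g) V1 /\ fU FQ (pi g).
have UH g : U g -> H (w g) /\ `|T0 g| < e by move=> [_ /FQU]; exact: chi0n.
pose c (i : 'I_n.+1) (g : GS) := if i == ord0 then T0 g + kap else f i (w g).
(* Coordinate 0 is reset to 0, so that the point with coordinates z v lies in H. *)
pose z (v : 'rV[R]_n.+1) : 'rV[R]_n.+1 := \row_i if i == ord0 then 0 else v 0 i.
pose y (v : RV n.+1) : GS := (param k (z v) * (s (v 0 ord0 - kap) * g0))%g.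
have sz : @smooth_map R (RV n.+1) GS (fun v => param k (z v)).
  apply: (smooth_map_comp (smooth_map_row (@RV_gclosed R n.+1) _) (chart_param kc)) => i.
  by case: eqP => _; [exact: (cinf_cst (@RV_gclosed R n.+1))|exact: RV_coord].
have sy : @smooth_map R (RV n.+1) GS y.
  by apply: (gmulS hG (@RV_gclosed R n.+1) sz); apply: sst; [exact: RV_gclosed|exact: RV_coord].
have Hz v : H (param k (z v)).
  by apply/(kH (cdom_param _ kc)); rewrite coord_param// mxE.
have wE g : U g -> param k (z (\row_i c i g)) = w g.
  move=> Ug; have [hw _] := UH _ Ug; have [kd fE] := bnear_self Ug.1.
  have -> : z (\row_i c i g) = Defs.coord k (w g).
    apply/rowP => i; rewrite !mxE /c; case: eqP => [->|_]; last by rewrite -fE mxE.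
    by rewrite (kH kd).1.
  by case: kc => _ _ + _ _; exact.
have yE g : U g -> y (\row_i c i g) = g.
  by move=> Ug; rewrite /y wE// mxE /c eqxx addrK divgK.
have cU g : U g -> bnear g U.
  move=> [u1 u2]; apply: bnearI => //; last exact: (bnear_smooth piG_smooth (oQ _ u2)).
  exact: (@bnear_smooth R GS GS _ g (fun y => bnear y V1) sw (bnear_near u1)).
have cc : coords U c.
  split=> //.
  - move=> i; rewrite /c; case: eqP => _; last exact: sw.
    by apply: cinfD => //; exact: cinf_cst.
  - move=> q g cq Ug; exists (fun v : 'rV[R]_n.+1 => q (y v)); first exact: sy.
    by apply: bnearS (cU _ Ug) => g' /yE ->.
  - move=> g P Ug nP; have [hw hT] := UH _ Ug.
    have n1 : bnear (\row_i c i g : RV n.+1) (fun v => P (y v)).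
      by apply: (@bnear_smooth R (RV n.+1) GS _ _ P sy); rewrite yE.
    have n2 : bnear (\row_i c i g : RV n.+1) (fun v => V1 (param k (z v))).
      by apply: (@bnear_smooth R (RV n.+1) GS _ _ V1 sz); rewrite wE//; case: Ug.
    have n3 := @near_e (T0 g) n.+1 ord0 (\row_i c i g) hT.
    rewrite mxE /c eqxx in n3; move: (n3 erefl) => {}n3.
    apply: filterS2 (RV_near (bnearI (@RV_gclosed R n.+1) n1 n2)) n3 => v [Pv [kd fE]] hv.
    exists (y v) => //.
    have Ty : T0 (y v) = v 0 ord0 - kap by rewrite /y T0i// T0s.
    apply/rowP => i; rewrite mxE /c; case: eqP => [->|/eqP i0]; first by rewrite Ty subrK.
    have -> : w (y v) = param k (z v) by rewrite /w Ty mulgK.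
    have := congr1 (fun u : 'rV[R]_n.+1 => u 0 i) fE.
    by rewrite coord_param// !mxE (negbTE i0).
have crU g : U g -> (crit GS g <-> c ord0 g = 0).
  move=> [_ hq]; rewrite /c eqxx -FQc; case: AQ => _ _ /(_ _ hq) <-.
  by rewrite crit_piG.
have Ug : U g0.
  split=> //; suff -> : w g0 = 1%g by exact: fn.
  by rewrite /w /T0 mulgV T1 (slice0 kc k1) mul1g mulgV.
have [FG [A F0 Fc FU]] := adapted_exists gG cc crU Ug.
exists FG, FQ; split=> //; split=> //.
- by move=> x /FU[].
- by move=> x; rewrite Fc /c eqxx FQc.
- move=> x x' /FU/UH[hx _] /FU/UH[hx' _]; rewrite Fc /c eqxx => /addIr et.
  by apply: (Hdiv hG hx); rewrite /w et.
Qed.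

End Slice.

Lemma bundle_chart (g0 : GS) : exists FG FQ, bundle_charts FG FQ /\ fU FG g0.
Proof.
have [k [kc k1 kH]] := chart1 hG.
have [f cf fn] := chart_coord hG kc k1.
have [d d0 hd] := slice_radius hG kc k1 kH cf fn.
have [T [chi [cT cc inv c1 [e e0 [Ts cn]]]]] := slice_functions hG kc k1 kH cf fn d0 hd.
exact: (bundle_chart_at kc k1 kH cf fn cT cc inv c1 e0 Ts cn).
Qed.

End Charts.

(** * Vertical vectors, the annihilator and the map psi *)

Section LieAlgebra.
Context {R : realType}.
Variables (G : groupType) (C : set (G -> R)) (H : set G) (n : nat).
Hypothesis hG : blie_group C H n.
Notation GS := (gspace C H).
Notation GQ := (GmodH C H).
Notation pi := (@piG R G C H).
Let gG : gclosed GS := G_gclosed hG.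

Lemma rmul_cinf (f : GS -> R) (x : G) : cinf GS (fun k => f (k * x)%g) <-> cinf GS f.
Proof.
split=> cf; last exact: (rmulS hG x).
have := rmulS hG x^-1%g cf; congr (cinf GS _); apply/funext => k /=.
by rewrite divgK.
Qed.

Lemma lieH_pder (X : tvec G) : lieH C H X -> pder (1%g : GS) X.
Proof. by case. Qed.

Lemma lieH_cst X f : lieH C H X -> C f -> (forall h, H h -> f h = f 1%g) -> X f = 0.
Proof.
move=> lX cf hf; have DX := lieH_pder lX.
have e : X (fun k => f k - f 1%g) = 0.
  case: lX => _ _ _; apply=> [|h hh]; last by rewrite hf// subrr.
  by apply: (cinfB gG) => //; exact: (cinf_cst gG).
by move: e; rewrite (pderB gG DX)//; [rewrite (pder_cst gG DX) subr0|exact: (cinf_cst gG)].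
Qed.

(** X acts on y in f(y x) with x as a parameter. In coordinates f(y x) is a smooth Q of both points,
    and the chain rule expresses the result by partial derivatives of Q, smooth in x, times
    constants. *)
Lemma zeta_cinf X f : lieH C H X -> C f -> cinf GS (zeta X f).
Proof.
move=> lX cf; apply: (cinf_local gG) => g.
have [k [kc k1 _]] := chart1 hG; have [c cc nc] := chart_coord hG kc k1.
have [k' kc' kg] := G_chart hG g; have [c' cc' nc'] := chart_coord hG kc' kg.
pose N := n.+1.
have sl : @smooth_map R (RV (N + N)) GS (fun w => param k (\row_i w 0 (lshift N i))).
  exact: (smooth_map_comp (smooth_map_row (@RV_gclosed R (N + N)) (fun i : 'I_N => RV_coord (lshift N i))) (chart_param kc)).
have sr : @smooth_map R (RV (N + N)) GS (fun w => param k' (\row_i w 0 (rshift N i))).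
  exact: (smooth_map_comp (smooth_map_row (@RV_gclosed R (N + N)) (fun i : 'I_N => RV_coord (rshift N i))) (chart_param kc')).
pose Q : 'rV[R]_(N + N) -> R := fun w =>
  f (param k (\row_i w 0 (lshift N i)) * param k' (\row_i w 0 (rshift N i)))%g.
have sQ : smooth Q by exact: (gmulS hG (@RV_gclosed R (N + N)) sl sr cf).
pose phi (y x : G) (j : 'I_(N + N)) : R := match fintype.split j with inl i => c i y | inr i => c' i x end.
have phil y x : \row_i (\row_j phi y x j) 0 (lshift N i) = \row_i c i y.
  by apply/rowP => i; rewrite !mxE /phi -[lshift N i]/(unsplit (inl i)) unsplitK.
have phir y x : \row_i (\row_j phi y x j) 0 (rshift N i) = \row_i c' i x.
  by apply/rowP => i; rewrite !mxE /phi -[rshift N i]/(unsplit (inr i)) unsplitK.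
have cphi1 x j : cinf GS (fun y => phi y x j).
  by rewrite /phi; case: (fintype.split j) => i; [exact: cc|exact: (cinf_cst gG)].
have cphi2 y j : cinf GS (fun x => phi y x j).
  by rewrite /phi; case: (fintype.split j) => i; [exact: (cinf_cst gG)|exact: cc'].
exists (fun x => \sum_j 'D_(unitv j) Q (\row_j phi 1%g x j) * X (fun y => phi y x j)).
  apply: (cinf_sum gG) => j _; apply: (cinfM gG).
    exact: (cinf_comp gG (smooth_derive j sQ) (cphi2 1%g)).
  rewrite /phi; case: (fintype.split j) => i; first exact: (cinf_cst gG).
  under eq_fun do rewrite (pder_cst gG (lieH_pder lX)).
  exact: (cinf_cst gG).
apply: bnearS (param_near kc' nc') => x ex; rewrite /zeta.
have e1 : bnear (1%g : GS) (fun y => f (y * x)%g = Q (\row_j phi y x j)).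
  by apply: bnearS (param_near kc nc) => y ey; rewrite /Q phil phir ex ey.
rewrite (pder_local gG (lieH_pder lX) _ _ e1); last first.
- exact: (cinf_comp gG sQ (cphi1 x)).
- exact/rmul_cinf.
by rewrite (pder_chain gG (lieH_pder lX) sQ (cphi1 x)).
Qed.

Lemma zeta_bvf X : lieH C H X -> bvf (zeta X : op GS).
Proof.
move=> lX; have [lD lM lN lH] := lX; apply: bvf_intro.
- by move=> f cf; exact: zeta_cinf.
- move=> x; split=> [a f g cf cg|f g cf cg]; rewrite /zeta.
    by rewrite lD//; exact/rmul_cinf.
  by rewrite lM ?mul1g//; exact/rmul_cinf.
- by move=> f nf; apply/funext => x; rewrite /zeta lN//; move/rmul_cinf.
- move=> f cf f0 x Hx; rewrite /zeta lH//; first exact/rmul_cinf.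
  by move=> h hh; rewrite f0//; exact: HM hG _ _ hh Hx.
Qed.

Lemma zeta_tcomb a X Y : zeta (tcomb a X Y) = op_comb (fun=> a) (zeta X) (zeta Y) :> op GS.
Proof. by []. Qed.

Definition tsum m (a : 'I_m -> R) (X : 'I_m -> tvec G) : tvec G := fun f => \sum_i a i * X i f.

Lemma tsumS m (a : 'I_m.+1 -> R) (X : 'I_m.+1 -> tvec G) :
  tsum a X = tcomb (a ord0) (X ord0) (tsum (fun i => a (lift ord0 i)) (fun i => X (lift ord0 i))).
Proof. by apply/funext => f; rewrite /tsum big_ord_recl. Qed.

Lemma tcomb_lie a X Y : lieH C H X -> lieH C H Y -> lieH C H (tcomb a X Y).
Proof.
move=> [XD XM XN XH] [YD YM YN YH]; rewrite /tcomb; split=> [b f g cf cg|f g cf cg|f nf|f cf f0].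
- by rewrite XD// YD//; ring.
- by rewrite XM// YM//; ring.
- by rewrite XN// YN// mulr0 addr0.
- by rewrite XH// YH// mulr0 addr0.
Qed.

Lemma lie0 : lieH C H (fun=> 0).
Proof. by split=> // *; rewrite ?mulr0 ?mul0r addr0. Qed.

Lemma tsum_lie m (a : 'I_m -> R) X : (forall i, lieH C H (X i)) -> lieH C H (tsum a X).
Proof.
elim: m a X => [|m IH] a X hX.
  have -> : tsum a X = (fun=> 0) by apply/funext => f; rewrite /tsum big_ord0.
  exact: lie0.
by rewrite tsumS; apply: tcomb_lie => //; exact: IH.
Qed.

Lemma evP (mu : dualH C H) : (forall a X Y, lieH C H X -> lieH C H Y ->
         ev mu (tcomb a X Y) = a * ev mu X + ev mu Y) /\ (forall X, ~ lieH C H X -> ev mu X = 0).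
Proof. by case: mu. Qed.

Lemma dualH_eq (mu nu : dualH C H) : (forall X, lieH C H X -> ev mu X = ev nu X) -> mu = nu.
Proof.
move=> h; have e : ev mu = ev nu.
  apply/funext => X; have [/h//|nX] := pselect (lieH C H X).
  by rewrite (evP mu).2// (evP nu).2.
case: mu nu h e => [m pm] [v pv] _ /= e; subst v; congr DualH; exact: Prop_irrelevance.
Qed.

Lemma ev_tsum (mu : dualH C H) m (a : 'I_m -> R) X : (forall i, lieH C H (X i)) ->
  ev mu (tsum a X) = \sum_i a i * ev mu (X i).
Proof.
elim: m a X => [|m IH] a X hX.
  have e : tsum a X = tcomb (-1) (fun=> 0) (fun=> 0).
    by apply/funext => f; rewrite /tsum big_ord0 /tcomb mulr0 addr0.
  by rewrite big_ord0 e (evP mu).1; [rewrite mulN1r addNr|exact: lie0|exact: lie0].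
rewrite tsumS (evP mu).1//; last exact: tsum_lie.
by rewrite IH// big_ord_recl.
Qed.

Lemma cv_zeta_comb (a : bcot GS) b X Y : lieH C H X -> lieH C H Y ->
  cv a (zeta (tcomb b X Y)) = b * cv a (zeta X) + cv a (zeta Y).
Proof.
move=> lX lY; rewrite zeta_tcomb (covecP a).1//; first exact: (cinf_cst gG).
- exact: zeta_bvf.
- exact: zeta_bvf.
Qed.

Definition mkdual_fun (u : tvec G -> R) : tvec G -> R := fun X => if `[< lieH C H X >] then u X else 0.

Lemma mkdualP u : (forall a X Y, lieH C H X -> lieH C H Y -> u (tcomb a X Y) = a * u X + u Y) ->
  (forall a X Y, lieH C H X -> lieH C H Y ->
     mkdual_fun u (tcomb a X Y) = a * mkdual_fun u X + mkdual_fun u Y) /\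
  (forall X, ~ lieH C H X -> mkdual_fun u X = 0).
Proof.
move=> hu; split=> [a X Y lX lY|X /asboolPn/negbTE nX]; last by rewrite /mkdual_fun nX.
by rewrite /mkdual_fun !asboolT//; [exact: hu|exact: tcomb_lie].
Qed.

Definition mkdual u hu : dualH C H := DualH (@mkdualP u hu).

Lemma mkdualE u hu X : lieH C H X -> ev (@mkdual u hu) X = u X.
Proof. by move=> lX; rewrite /= /mkdual_fun asboolT. Qed.

Lemma lieH_basis : exists (E : 'I_n -> tvec G) (c : 'I_n -> GS -> R),
  [/\ forall j, lieH C H (E j), forall j, C (c j), forall i j, E i (c j) = (i == j)%:R &
      forall X, lieH C H X -> X = tsum (fun j => X (c j)) E].
Proof.
have [FG [FQ [[[FF cc cr] AQ FGQ e0 lev] F1]]] := bundle_chart hG (1%g : GS).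
exists (fun j f => fe FG (lift ord0 j) f 1%g), (fun j => fc FG (lift ord0 j)).
have lE j : lieH C H (fun f => fe FG (lift ord0 j) f 1%g).
  have bE := fr_e FF (lift ord0 j); have [DD DM] := bvf_pder (1%g : GS) bE.
  split=> [a f g cf cg|f g cf cg|f nf|f cf f0]; [exact: DD|exact: DM| |].
    by rewrite (bvf_non bE nf).
  by apply: (bvf_crit bE cf f0); exact: H1 hG.
split=> // [j|i j|X lX]; first exact: (fr_c FF).
  by rewrite (fr_eE FF _ F1 (fr_c FF _)) /rho /= mul1r (fr_dc FF)// (inj_eq (@lift_inj _ ord0)).
apply/funext => f; have [cf|nf] := pselect (C f); last first.
  have [_ _ lN _] := lX; rewrite lN// /tsum big1// => j _.
  by rewrite (bvf_non (fr_e FF _) nf) mulr0.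
rewrite (fr_chain FF F1 (lieH_pder lX) cf) big_ord_recl.
have -> : X (fc FG ord0) = 0.
  apply: lieH_cst => //; first exact: (fr_c FF).
  by move=> h hh; rewrite !e0 -(mulg1 h) (piG_mul hG).
rewrite mul0r add0r; apply: eq_bigr => j _.
by rewrite (fr_eE FF _ F1 cf) /rho /= mul1r.
Qed.

Section Vertical.
Variables (FG : frame GS n) (FQ : frame GQ 0).
Hypothesis bc : bundle_charts FG FQ.

Let FF : is_frame FG. Proof. by case: bc => -[]. Qed.

Lemma zeta_c0 X : lieH C H X -> zeta X (fc FG ord0) = fun=> 0.
Proof.
have [_ _ _ e0 _] := bc; move=> lX; apply/funext => x; rewrite /zeta.
apply: lieH_cst => //; first by apply/rmul_cinf; exact: (fr_c FF).
by move=> h hh; rewrite !e0 mul1g (piG_mul hG).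
Qed.

Lemma zeta_eps0 X x : lieH C H X -> fU FG x -> feps FG ord0 (zeta X) x = 0.
Proof.
move=> lX Ux; apply: (eps_unique gG FF (h := fun=> 0) (zeta_bvf lX) Ux); first exact: (cinf_cst gG).
by apply: bnearS (bnearT gG x) => y _; rewrite zeta_c0// mulr0.
Qed.

(* [X] is the right translate of [e_i] at [x] to the identity; it is tangent to
   [H] because [fc FG ord0] is constant along the orbit of [x]. *)
Lemma e_vertical i x : i != ord0 -> fU FG x ->
  exists2 X, lieH C H X & forall a : bcot GS, base a = x -> cv a (zeta X) = cv a (fe FG i).
Proof.
move=> i0 Ux; have bE := fr_e FF i; have [DD DM] := bvf_pder x bE.
pose X : tvec G := fun f => fe FG i (fun y => f (y * x^-1)%g) x.
have lX : lieH C H X.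
  split=> [a f g cf cg|f g cf cg|f nf|f cf f0].
  - by apply: DD; exact/rmul_cinf.
  - by rewrite /X DM ?mulgV//; exact/rmul_cinf.
  - by rewrite /X (bvf_non bE)// => /rmul_cinf.
  have cfx : cinf GS (fun y => f (y * x^-1)%g) by exact/rmul_cinf.
  rewrite /X (fr_eE FF _ Ux cfx) (fr_level FF cfx i0 Ux) ?mulr0//.
  apply: bnearS (fr_open FF Ux) => y Uy ey; apply: f0.
  by case: bc => _ _ _ _; apply.
exists X => // a ax; rewrite (covec_frame gG FF (p := x) Ux _ (zeta_bvf lX)); last first.
  by rewrite -ax; exact: covecP.
have zX f : zeta X f x = fe FG i f x.
  by rewrite /zeta /X; congr (fe FG i _ x); apply/funext => y; rewrite divgK.
rewrite (bigD1 i)//= big1 ?addr0 => [|j ji]; last first.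
  have [->|j0] := eqVneq j ord0; first by rewrite zeta_eps0// mul0r.
  have := fr_Vc FF j (zeta_bvf lX) Ux; rewrite zX (fr_eE FF _ Ux (fr_c FF j)) (fr_dc FF)//.
  by rewrite eq_sym (negbTE ji) mulr0 /rho (negbTE j0) mul1r => <-; rewrite mul0r.
have := fr_Vc FF i (zeta_bvf lX) Ux; rewrite zX (fr_eE FF _ Ux (fr_c FF i)) (fr_dc FF)//.
by rewrite eqxx mulr1 /rho (negbTE i0) mul1r => <-; rewrite mul1r.
Qed.

(** Fundamental fields have no component along e_0, and by [e_vertical] they attain each of the
    other frame vectors. *)
Lemma vann_frame (a : bcot GS) : fU FG (base a) ->
  vann a <-> forall i, i != ord0 -> cv a (fe FG i) = 0.
Proof.
move=> Ua; split=> [va i i0|ha X lX].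
  by have [X lX <-//] := e_vertical i0 Ua; exact: va.
rewrite (covec_frame gG FF Ua (covecP a) (zeta_bvf lX)) big1// => j _.
have [->|j0] := eqVneq j ord0; first by rewrite zeta_eps0// mul0r.
by rewrite ha// mulr0.
Qed.

End Vertical.
End LieAlgebra.

(** * The annihilator of the vertical bundle and [pibar] *)

Section Annihilator.
Context {R : realType}.
Variables (G : groupType) (C : set (G -> R)) (H : set G) (n : nat).
Hypothesis hG : blie_group C H n.
Notation GS := (gspace C H).
Notation GQ := (GmodH C H).
Notation HA := (Hann C H).
Notation PS := (Pspace C H).
Notation pi := (@piG R G C H).
Notation tau := (@tauH R G C H).
Let gG : gclosed GS := G_gclosed hG.
Let gQ : gclosed GQ := GQ_gclosed hG.

Definition acov (b : HA) : bcot GS := sval b.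

Lemma acovP (b : HA) : vann (acov b).
Proof. exact: (svalP b). Qed.

Lemma acov_inj (b b' : HA) : acov b = acov b' -> b = b'.
Proof.
case: b b' => [b vb] [b' vb'] /= e; rewrite /acov /= in e; subst b'.
by congr exist; exact: Prop_irrelevance.
Qed.

Lemma hann_gclosed : gclosed HA.
Proof. exact: sub_gclosed. Qed.

Lemma acov_smooth : @smooth_map R HA (bcot GS) acov.
Proof. exact: sval_smooth. Qed.

Lemma tau_smooth : @smooth_map R HA GS tau.
Proof. exact: smooth_map_comp acov_smooth (@base_smooth R GS). Qed.

Lemma acov_cinf V : bvf V -> cinf HA (fun b => cv (acov b) V).
Proof. by move=> bV; exact: (acov_smooth (cv_smooth bV)). Qed.

Let F0 : set (HA -> R) := [set f | (exists2 f', cinf GS f' & f = f' \o tau) \/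
  (exists2 V, bvf V & f = fun b => cv (acov b) V)].

Let hann_gen f : cinf HA f -> gen F0 f.
Proof.
move=> cf; apply: (@gen_bind R HA HA id) cf => k [q cq ->].
apply: (@gen_bind R HA (bcot GS) acov) cq => l [[f' cf' ->]|[V bV ->]]; apply: gen_incl.
  by left; exists f'.
by right; exists V.
Qed.

Section Chart.
Variables (FG : frame GS n) (FQ : frame GQ 0).
Hypothesis bc : bundle_charts FG FQ.
Let FF : is_frame FG. Proof. by case: bc => -[]. Qed.

Lemma acov_frame b V : bvf V -> fU FG (tau b) ->
  cv (acov b) V = feps FG ord0 V (tau b) * cv (acov b) (fe FG ord0).
Proof.
move=> bV Ub; rewrite (covec_frame gG FF Ub (covecP (acov b)) bV) (bigD1 ord0)//= big1 ?addr0//.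
move=> j j0; have /(vann_frame hG bc (a := acov b) Ub) -> := acovP b; rewrite ?mulr0//.
Qed.

Definition hannc := @fibc R GS HA tau n.+1 1 (fc FG) (fun _ b => cv (acov b) (fe FG ord0)).

Lemma hann_frame (b : HA) : fU FG (tau b) -> exists FH : frame HA (n + 1),
  [/\ adapted FH, fU FH b, fc FH = hannc & forall z, fU FH z -> fU FG (tau z)].
Proof.
move=> Ub; have [[_ cG cr] _ _ _ _] := bc.
have h := @fibre_coords R GS HA tau n.+1 1 (fU FG) (fc FG)
  (fun _ b => cv (acov b) (fe FG ord0)) F0 gG hann_gclosed cG hann_gen tau_smooth
  (fun=> acov_cinf (fr_e FF ord0)).
apply: (@adapted_exists R HA (n + 1) (fun z => fU FG (tau z))) hann_gclosed (h _ _) _ Ub.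
- move=> f [[f' cf ->]|[V bV ->]]; first by left; exists f'.
  right; exists (fun=> feps FG ord0 V) => [_|z Uz]; first exact: fr_eps.
  by rewrite big_ord1; exact: acov_frame.
(* A prescribed fibre coordinate is realized by the covector with that value on e_0 and 0 on the
   vertical frame vectors. *)
- move=> y p Uy; pose r (i : 'I_n.+1) := if i == ord0 then p ord0 else 0.
  have va : vann (mkcov gG FF r Uy).
    by apply/(vann_frame hG bc) => // i i0; rewrite mkcov_e /r (negbTE i0).
  exists (exist _ _ va : HA) => // j.
  by rewrite -[LHS]/(cv (mkcov gG FF r Uy) (fe FG ord0)) mkcov_e /r eqxx (ord1 j).
- move=> z Uz; have -> : (ord0 : 'I_(n + 1).+1) = lshift 1 (ord0 : 'I_n.+1) by exact: val_inj.
  by rewrite fibc_l; exact: cr.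
Qed.

Lemma push_pi x V : fU FG x -> bvf V -> exists W, bpush pi x V W.
Proof.
have [[_ _ _] [AQ _ _] hU e0 _] := bc; move=> Ux bV.
apply: (@push_over R GS GQ gG gQ pi (@piG_smooth R G C H) n 0 FG FQ (fun=> ord0) FF AQ) => //.
- exact: hU.
- by move=> i; apply: bnearS (bnearT gG x) => y _; rewrite ord1.
Qed.

Lemma eps_pi x V W : fU FG x -> bpush pi x V W -> feps FQ ord0 W (pi x) = feps FG ord0 V x.
Proof.
have [[_ _ _] [AQ _ _] hU e0 _] := bc; move=> Ux.
apply: (@eps_over R GS GQ gG pi (@piG_smooth R G C H) n 0 FG FQ (fun=> ord0) FF AQ) => //.
- by move=> i; rewrite ord1.
- exact: hU.
- by move=> i; apply: bnearS (bnearT gG x) => y _; rewrite ord1.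
Qed.

Lemma is_pibar_e pibar b : @is_pibar R G C H pibar -> fU FG (tau b) ->
  cv (pibar b) (fe FQ ord0) = cv (acov b) (fe FG ord0).
Proof.
move=> /(_ b)[be he] Ub; have [W hW] := push_pi Ub (fr_e FF ord0).
rewrite -(he _ _ hW); have [_ [AQ _ _] hU _ _] := bc.
have := covec_frame gQ AQ (hU _ Ub) _ (bpush_bvf hW).2 => /(_ (cv (pibar b))) ->.
  by rewrite big_ord1 (eps_pi Ub hW) (eps_e gG FF) ?eqxx ?mul1r.
by rewrite -be; exact: covecP.
Qed.

Lemma is_pibar_cv pibar b W : @is_pibar R G C H pibar -> fU FG (tau b) -> bvf W ->
  cv (pibar b) W = feps FQ ord0 W (pi (tau b)) * cv (acov b) (fe FG ord0).
Proof.
move=> hp Ub bW; have [_ [AQ _ _] hU _ _] := bc; rewrite -(is_pibar_e hp Ub).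
rewrite (covec_frame gQ AQ (hU _ Ub) _ bW) ?big_ord1//.
by have [<- _] := hp b; exact: covecP.
Qed.

End Chart.

(** Chosen point by point: in a chart, [eps_pi] verifies the requirement for every related pair at
    once, so the choices need no compatibility. Smoothness is obtained afterwards from the defining
    property. *)
Lemma pibar_exists : exists pibar, @is_pibar R G C H pibar.
Proof.
suff /choice[f hf] : forall b, exists q : bcot GQ, base q = pi (tau b) /\
    forall V W, bpush pi (tau b) V W -> cv q W = cv (acov b) V by exists f.
move=> b; have [FG [FQ [bc Ub]]] := bundle_chart hG (tau b).
have [_ [AQ _ _] hU _ _] := bc.
exists (mkcov gQ AQ (fun=> cv (acov b) (fe FG ord0)) (hU _ Ub)); split=> // V W hVW.
have [bV bW] := bpush_bvf hVW.
rewrite /= /mkcov_fun asboolT// big_ord1 (eps_pi bc Ub hVW).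
by rewrite -(acov_frame bc bV Ub).
Qed.

Lemma pibar_smooth pibar : @is_pibar R G C H pibar -> smooth_map pibar.
Proof.
move=> hp; apply: (bcot_smooth hann_gclosed).
  have -> : (fun x => base (pibar x)) = fun x => pi (tau x) by apply/funext => b; have [] := hp b.
  exact: smooth_map_comp tau_smooth (@piG_smooth R G C H).
move=> V bV; apply: (cinf_local hann_gclosed) => b.
have [FG [FQ [bc Ub]]] := bundle_chart hG (tau b).
have [[FF _ _] [AQ _ _] hU _ _] := bc.
exists (fun b => feps FQ ord0 V (pi (tau b)) * cv (acov b) (fe FG ord0)).
  apply: (cinfM hann_gclosed); last exact: (acov_cinf (fr_e FF ord0)).
  exact: (tau_smooth (piG_smooth (fr_eps AQ ord0 bV))).
apply: bnearS (bnear_smooth tau_smooth (fr_open FF Ub)) => b' Ub'.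
exact: (is_pibar_cv bc hp Ub' bV).
Qed.

End Annihilator.

(** * The splitting of the b-cotangent bundle defined by a connection *)

Section Psi.
Context {R : realType}.
Variables (G : groupType) (C : set (G -> R)) (H : set G) (n : nat).
Hypothesis hG : blie_group C H n.
Variable theta : hform1 C H.
Hypothesis ht : bconnection theta.
Notation GS := (gspace C H).
Notation HA := (Hann C H).
Notation PS := (Pspace C H).
Notation tau := (@tauH R G C H).
Let gG : gclosed GS := G_gclosed hG.

Lemma theta_lie V g : bvf V -> lieH C H (theta V g).
Proof. by case: ht => + _ _ _ _ bV; exact. Qed.

Lemma theta_comb (f : GS -> R) V W g : C f -> bvf V -> bvf W ->
  theta (op_comb f V W) g = tcomb (f g) (theta V g) (theta W g).
Proof. by case: ht => _ _ + _ _; exact. Qed.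

Lemma theta_zeta X g : lieH C H X -> theta (zeta X) g = X.
Proof. by case: ht => _ _ _ + _; exact. Qed.

Lemma theta_covec (mu : dualH C H) (g : GS) :
  is_covec g (fun V => if `[< bvf V >] then ev mu (theta V g) else 0).
Proof.
split=> [f V W cf bV bW|V /asboolPn/negbTE -> //].
rewrite !asboolT//; last exact: bvf_comb.
by rewrite theta_comb// (evP mu).1//; exact: theta_lie.
Qed.

Lemma zeta_theta_covec (a : bcot GS) :
  is_covec (base a) (fun V => if `[< bvf V >] then cv a (zeta (theta V (base a))) else 0).
Proof.
split=> [f V W cf bV bW|V /asboolPn/negbTE -> //].
rewrite !asboolT//; last exact: bvf_comb.
by rewrite theta_comb// (cv_zeta_comb hG)//; exact: theta_lie.
Qed.

Lemma psi1P (a : bcot GS) : is_covec (base a)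
  (fun V => if `[< bvf V >] then cv a V - cv a (zeta (theta V (base a))) else 0).
Proof.
have [hD _] := zeta_theta_covec a; have [aD _] := covecP a.
split=> [f V W cf bV bW|V /asboolPn/negbTE -> //].
have := hD f V W cf bV bW; rewrite !asboolT//; try exact: bvf_comb.
by move=> ->; rewrite aD//; ring.
Qed.

Lemma psi1_vann a : vann (Covec (psi1P a) : bcot GS).
Proof.
move=> X lX; have bX := zeta_bvf hG lX.
by rewrite /= asboolT// theta_zeta// subrr.
Qed.

Lemma psi2P (a : bcot GS) b X Y : lieH C H X -> lieH C H Y ->
  cv a (zeta (tcomb b X Y)) = b * cv a (zeta X) + cv a (zeta Y).
Proof. exact: (cv_zeta_comb hG). Qed.

Definition psi (a : bcot GS) : PS :=
  (exist _ (Covec (psi1P a) : bcot GS) (psi1_vann a) : HA, mkdual (psi2P a)).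

Lemma psi_is : is_psi theta psi.
Proof.
move=> a; split=> // [V bV|X lX]; first by rewrite /= asboolT.
exact: mkdualE.
Qed.

Lemma psi'P (x : PS) : is_covec (tau x.1)
  (fun V => if `[< bvf V >] then cv (acov x.1) V + ev x.2 (theta V (tau x.1)) else 0).
Proof.
have [hD _] := theta_covec x.2 (tau x.1); have [aD _] := covecP (acov x.1).
split=> [f V W cf bV bW|V /asboolPn/negbTE -> //].
have := hD f V W cf bV bW; rewrite !asboolT//; try exact: bvf_comb.
by move=> ->; rewrite aD//; rewrite /tauH /acov; ring.
Qed.

Definition psi' (x : PS) : bcot GS := Covec (psi'P x).

Lemma psi'E x V : bvf V -> cv (psi' x) V = cv (acov x.1) V + ev x.2 (theta V (tau x.1)).
Proof. by move=> bV; rewrite /= asboolT. Qed.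

Lemma psiK : cancel psi psi'.
Proof.
move=> a; apply: covec_eq => // V bV; rewrite psi'E//.
have [_ -> // ->] := psi_is a; last exact: theta_lie.
by rewrite /tauH /= subrK.
Qed.

Lemma psi'K : cancel psi' psi.
Proof.
move=> x; have [h1 h2 h3] := psi_is (psi' x).
have zE X : lieH C H X -> cv (psi' x) (zeta X) = ev x.2 X.
  move=> lX; rewrite psi'E ?theta_zeta//; last exact: (zeta_bvf hG).
  by rewrite (acovP x.1) ?add0r.
rewrite [psi _]surjective_pairing [RHS]surjective_pairing; congr pair.
  apply: acov_inj; apply: covec_eq => // V bV; rewrite /acov h2//.
  by rewrite zE ?psi'E ?addrK//; exact: theta_lie.
by apply: dualH_eq => X lX; rewrite h3// zE.
Qed.

Lemma P_gclosed : gclosed PS.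
Proof. exact: prod_gclosed. Qed.

Lemma prP_smooth : @smooth_map R PS HA (@prP R G C H).
Proof. exact: fst_smooth. Qed.

Lemma ev_cinf X : lieH C H X -> cinf PS (fun x => ev x.2 X).
Proof.
move=> lX; exact: (@snd_smooth R HA (dualHspace C H) (fun mu => ev mu X) (gen_incl (ex_intro2 _ _ X lX erefl))).
Qed.

(** Smoothness of theta is given only after pairing with elements of the dual. Evaluation on a
    coordinate c_j is such an element, and a basis turns theta into finitely many scalar b-forms. *)
Lemma theta_coord : exists (E : 'I_n -> tvec G) (th : 'I_n -> op GS -> GS -> R),
  [/\ forall j, lieH C H (E j), forall j V, bvf V -> cinf GS (th j V)
    & forall V g, bvf V -> theta V g = tsum (fun j => th j V g) E].
Proof.
have [E [c [lE cc _ hE]]] := lieH_basis hG.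
exists E, (fun j V g => theta V g (c j)); split=> // [j V bV|V g bV]; last exact: hE _ (theta_lie _ bV).
case: ht => _ hs _ _ _.
have hu : forall a X Y, lieH C H X -> lieH C H Y ->
    (fun X : tvec G => X (c j)) (tcomb a X Y) = a * X (c j) + Y (c j) by [].
have := hs (mkdual hu) V bV; congr (cinf GS _); apply/funext => g.
by rewrite mkdualE//; exact: theta_lie.
Qed.

Lemma psi_smooth : smooth_map psi.
Proof.
have [E [th [lE cth hth]]] := theta_coord; have gB := @bcot_gclosed R GS.
apply: (smooth_map_pair gB).
  apply: (sub_smooth gB); apply: (bcot_smooth gB); first exact: base_smooth.
  move=> V bV.
  have -> : (fun a => cv (Covec (psi1P a)) V) = fun a => cv a V - \sum_j th j V (base a) * cv a (zeta (E j)).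
    apply/funext => a; rewrite /= asboolT//; congr (_ - _).
    have -> : cv a (zeta (theta V (base a))) = ev (mkdual (psi2P a)) (theta V (base a)).
      by rewrite mkdualE//; exact: theta_lie.
    rewrite hth// ev_tsum//; apply: eq_bigr => j _; congr (_ * _); exact: mkdualE.
  apply: (cinfB gB); first exact: cv_smooth.
  apply: (cinf_sum gB) => j _; apply: (cinfM gB).
    by apply: (@base_smooth R GS); exact: cth.
  by apply: cv_smooth; exact: (zeta_bvf hG).
move=> F cF; apply: gB; apply: (gen_bind (h := fun a => mkdual (psi2P a) : dualHspace C H)) cF => k [X lX ->].
apply: gen_incl; have := cv_smooth (zeta_bvf hG lX); congr (cinf _ _); apply/funext => a.
by rewrite /= /mkdual_fun asboolT.
Qed.

Lemma psi'_smooth : smooth_map psi'.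
Proof.
have [E [th [lE cth hth]]] := theta_coord; have gP := P_gclosed.
apply: (bcot_smooth gP).
  exact: smooth_map_comp prP_smooth (@tau_smooth R G C H).
move=> V bV.
have -> : (fun x => cv (psi' x) V) =
    fun x => cv (acov x.1) V + \sum_j th j V (tau x.1) * ev x.2 (E j).
  by apply/funext => x; rewrite psi'E// hth// ev_tsum.
apply: (cinfD gP); first exact: (prP_smooth (acov_cinf bV)).
apply: (cinf_sum gP) => j _; apply: (cinfM gP); last exact: ev_cinf.
exact: (prP_smooth (@tau_smooth R G C H _ (cth j V bV))).
Qed.

Lemma psi_diffeo : diffeo psi psi'.
Proof. by split; [exact: psi_smooth|exact: psi'_smooth|exact: psiK|exact: psi'K]. Qed.

Lemma psi_crit a : crit PS (psi a) <-> crit (bcot GS) a.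
Proof. by split=> [[]|] //; left. Qed.

End Psi.

(** * The pull-back of the canonical form *)

Section Identity.
Context {R : realType}.
Variables (G : groupType) (C : set (G -> R)) (H : set G) (n : nat).
Hypothesis hG : blie_group C H n.
Variable theta : hform1 C H.
Hypothesis ht : bconnection theta.
Notation GS := (gspace C H).
Notation GQ := (GmodH C H).
Notation HA := (Hann C H).
Notation PS := (Pspace C H).
Notation pi := (@piG R G C H).
Notation tau := (@tauH R G C H).
Notation prP := (@prP R G C H).
Notation psi := (psi hG ht).
Notation psi' := (psi' hG ht).
Let gG : gclosed GS := G_gclosed hG.
Let gQ : gclosed GQ := GQ_gclosed hG.
Let gH : gclosed HA := @hann_gclosed R G C H.
Let gP : gclosed PS := @P_gclosed R G C H.
Let dpsi : diffeo psi' psi := diffeo_sym (psi_diffeo hG ht).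
Let cpsi x : crit (bcot GS) (psi' x) <-> crit PS x.
Proof. by rewrite -{2}[x](psi'K hG ht); apply: iff_sym; exact: psi_crit. Qed.

Variable pibar : HA -> bcot GQ.
Hypothesis hp : is_pibar pibar.

Lemma liouville_GS (a : bcot GS) : exists2 F : frame (bcot GS) (n + n.+1),
  adapted F /\ fU F a & canonical_at (@liouville R GS) F.
Proof.
have [FG [FQ [[AG _ _ _ _] Ua]]] := bundle_chart hG (base a).
by have [FB [AB Ba cB _ _]] := liouville_canonical gG AG Ua; exists FB.
Qed.

Lemma liouville_GQ (a : bcot GQ) : exists2 F : frame (bcot GQ) (0 + 1),
  adapted F /\ fU F a & canonical_at (@liouville R GQ) F.
Proof.
have [x xa] := piG_surj (base a); have [FG [FQ [[_ AQ hU _ _] Ux]]] := bundle_chart hG x.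
have Ua : fU FQ (base a) by rewrite -xa; exact: hU.
by have [FB [AB Ba cB _ _]] := liouville_canonical gQ AQ Ua; exists FB.
Qed.

Lemma omega_can_symplectic : bsymplectic (omega_can GS).
Proof.
exact: canonical_symplectic (@bcot_gclosed R GS) n _ liouville_GS.
Qed.

Lemma pspace_frame (x : PS) m (FH : frame HA m) : adapted FH -> fU FH x.1 ->
  exists (E : 'I_n -> tvec G) (FP : frame PS (m + n)),
  [/\ adapted FP, fU FP x, fc FP = @fibc R HA PS prP _ _ (fc FH) (fun j y => ev y.2 (E j))
    & forall y, fU FP y -> fU FH y.1].
Proof.
move=> [FF cH cr] Ux; have [E [c [lE cc dE hE]]] := lieH_basis hG.
pose F0 : set (PS -> R) := [set f | (exists2 f', cinf HA f' & f = f' \o prP) \/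
  (exists2 X, lieH C H X & f = fun y => ev y.2 X)].
have genP f : cinf PS f -> gen F0 f.
  move=> cf; apply: (@gen_bind R PS PS id) cf => k [[q cq ->]|[q cq ->]].
    by apply: gen_incl; left; exists q.
  apply: (@gen_bind R PS (dualHspace C H) snd) cq => l [X lX ->].
  by apply: gen_incl; right; exists X.
have h := @fibre_coords R HA PS prP m.+1 n (fU FH) (fc FH) (fun j y => ev y.2 (E j)) F0
  gH gP cH genP (@prP_smooth R G C H) (fun j => ev_cinf (lE j)).
exists E.
apply: (@adapted_exists R PS (m + n) (fun z => fU FH (prP z))) gP (h _ _) _ Ux.
- move=> f [[f' cf ->]|[X lX ->]]; first by left; exists f'.
  right; exists (fun j _ => X (c j)) => [j|z _]; first exact: cinf_cst.
  by rewrite {1}(hE _ lX) ev_tsum.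
- move=> y p Uy.
  have hu : forall a X Y, lieH C H X -> lieH C H Y ->
      (fun X : tvec G => \sum_j X (c j) * p j) (tcomb a X Y) =
      a * (\sum_j X (c j) * p j) + \sum_j Y (c j) * p j.
    move=> a X Y _ _; rewrite mulr_sumr -big_split; apply: eq_bigr => j _.
    by rewrite /tcomb mulrDl mulrA.
  exists (y, mkdual hu) => // j; rewrite mkdualE// (bigD1 j)//= big1 ?addr0 ?dE ?eqxx ?mul1r//.
  by move=> i ij; rewrite dE eq_sym (negbTE ij) mul0r.
- move=> z Uz; have -> : (ord0 : 'I_(m + n).+1) = lshift n (ord0 : 'I_m.+1) by exact: val_inj.
  by rewrite fibc_l -cr//; split=> [[]|] //; left.
Qed.

Section At.
Variables (FG : frame GS n) (FQ : frame GQ 0).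
Hypothesis bc : bundle_charts FG FQ.
Variable FH : frame HA (n + 1).
Hypotheses (AH : adapted FH) (cFH : fc FH = hannc FG) (UH : forall z, fU FH z -> fU FG (tau z)).
Variables (E : 'I_n -> @tvec R G) (FP : frame PS (n + 1 + n)).
Hypotheses (AP : adapted FP)
  (cFP : fc FP = @fibc R HA PS prP _ _ (fc FH) (fun j y => ev y.2 (E j)))
  (UP : forall y, fU FP y -> fU FH y.1).

Let FFG : is_frame FG. Proof. by case: bc => -[]. Qed.
Let FFH : is_frame FH. Proof. by case: AH. Qed.
Let FFP : is_frame FP. Proof. by case: AP. Qed.

(** Of the coordinates of the product, those of index [li i] come from G, the one of index [p] is
    the value of the annihilating covector on e_0, and the last n are the components of mu. *)
Let li (i : 'I_n.+1) : 'I_(n + 1 + n).+1 := lshift n (lshift 1 i : 'I_(n + 1).+1).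
Let p : 'I_(n + 1 + n).+1 := lshift n (rshift n.+1 (ord0 : 'I_1) : 'I_(n + 1).+1).

Let li0 : li ord0 = ord0. Proof. exact: val_inj. Qed.

Let cli i : fc FP (li i) = fun y => fc FG i (tau y.1).
Proof. by rewrite cFP /li fibc_l cFH /hannc fibc_l. Qed.

Let cp : fc FP p = fun y => cv (acov y.1) (fe FG ord0).
Proof. by rewrite cFP /p fibc_l cFH /hannc fibc_r. Qed.

Lemma push_prP y V : fU FP y -> bvf V -> exists2 W, bpush prP y V W &
  forall i, feps FH i W y.1 = feps FP (lshift n i) V y.
Proof.
move=> Uy bV.
have s0 : lshift n (ord0 : 'I_(n + 1).+1) = ord0 :> 'I_(n + 1 + n).+1 by exact: val_inj.
have e (i : 'I_(n + 1).+1) : bnear y (fun z => fc FP (lshift n i) z = fc FH i (prP z)).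
  by apply: bnearS (bnearT gP y) => z _; rewrite cFP fibc_l.
have [W hW] := push_over gP gH (@prP_smooth R G C H) FFP FFH s0 Uy (UP Uy) e bV.
exists W => // i.
by apply: (eps_over gP (@prP_smooth R G C H) FFP FFH s0 _ Uy (UP Uy) e i hW).
Qed.

Lemma eps_prP y V W i : fU FP y -> bpush prP y V W -> feps FH i W y.1 = feps FP (lshift n i) V y.
Proof.
move=> Uy.
have s0 : lshift n (ord0 : 'I_(n + 1).+1) = ord0 :> 'I_(n + 1 + n).+1 by exact: val_inj.
have e (j : 'I_(n + 1).+1) : bnear y (fun z => fc FP (lshift n j) z = fc FH j (prP z)).
  by apply: bnearS (bnearT gP y) => z _; rewrite cFP fibc_l.
by apply: (eps_over gP (@prP_smooth R G C H) FFP FFH s0 _ Uy (UP Uy) e i).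
Qed.

Let tau0 : lshift 1 (ord0 : 'I_n.+1) = ord0 :> 'I_(n + 1).+1.
Proof. exact: val_inj. Qed.
Let taue (b : HA) (i : 'I_n.+1) : bnear b (fun z => fc FH (lshift 1 i) z = fc FG i (tau z)).
Proof. by apply: bnearS (bnearT gH b) => z _; rewrite cFH /hannc fibc_l. Qed.

Lemma push_tau b V : fU FH b -> bvf V -> exists W, bpush tau b V W.
Proof.
by move=> Ub; exact: (push_over gH gG (@tau_smooth R G C H) FFH FFG tau0 Ub (UH Ub) (@taue b)).
Qed.

Lemma eps_tau b V W i : fU FH b -> bpush tau b V W ->
  feps FG i W (tau b) = feps FH (lshift 1 i) V b.
Proof.
move=> Ub.
by apply: (eps_over gH (@tau_smooth R G C H) FFH FFG tau0 _ Ub (UH Ub) (@taue b) i).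
Qed.

(** The composite of mu and theta is a covector at the base point, hence sees only the components of
    a push-forward, and these do not depend on the intermediate choices W and U. *)
Lemma lambda_theta_frame V y : bvf V -> fU FP y ->
  lambda_theta theta V y = \sum_(i < n.+1) feps FP (li i) V y * ev y.2 (theta (fe FG i) (tau y.1)).
Proof.
move=> bV Uy; have Ub := UP Uy.
have hval W U : bpush prP y V W -> bpush tau y.1 W U -> ev y.2 (theta U (tau y.1)) =
    \sum_(i < n.+1) feps FP (li i) V y * ev y.2 (theta (fe FG i) (tau y.1)).
  move=> hW hU; have [_ bU] := bpush_bvf hU.
  have := covec_frame gG FFG (UH Ub) (theta_covec hG ht y.2 (tau y.1)) bU.
  rewrite asboolT// => ->; apply: eq_bigr => i _.
  by rewrite asboolT; [rewrite (eps_tau _ Ub hU) (eps_prP _ Uy hW)|exact: fr_e].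
have [W hW _] := push_prP Uy bV; have [_ bW] := bpush_bvf hW.
have [U hU] := push_tau Ub bW.
apply: xget_unique; first by exists W, U; split=> //; rewrite (hval _ _ hW hU).
by move=> r [W' [U' [h1 h2 ->]]]; exact: (hval _ _ h1 h2).
Qed.

Lemma liouville_frame V y : bvf V -> fU FP y ->
  @liouville R GS (opush psi' psi V) (psi' y) =
  feps FP ord0 V y * fc FP p y + lambda_theta theta V y.
Proof.
move=> bV Uy; have Ub := UP Uy; have bV' := bvf_opush dpsi cpsi bV.
have [AG _ _ _ _] := bc.
have [FB [[FFB _ _] UB can cFB _]] := liouville_canonical (a := psi' y) gG AG (UH Ub).
rewrite (can _ _ bV' UB) lambda_theta_frame//.
(* [psi'] covers the identity of G, so base coordinates correspond and [eps_unique] identifies the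
   components of V with those of its push-forward. *)
have eE (i : 'I_n.+1) : feps FB (lshift n.+1 i) (opush psi' psi V) (psi' y) = feps FP (li i) V y.
  have cE (j : 'I_n.+1) : fc FB (lshift n.+1 j) \o psi' = fc FP (li j).
    by rewrite cFB fibc_l cli.
  have sp := psi'_smooth hG ht.
  symmetry; apply: (eps_unique gP FFP (h := fun z => feps FB (lshift n.+1 i) (opush psi' psi V) (psi' z)) bV Uy).
    exact: (sp _ (fr_eps FFB _ bV')).
  apply: bnearS (bnear_smooth sp (fr_open FFB UB)) => z Uz.
  have := fr_Vc FFB (lshift n.+1 i) bV' Uz; rewrite (opushE dpsi) cE => ->; congr (_ * _).
  rewrite /rho -li0 -(cE ord0) /=.
  have -> : (ord0 : 'I_(n + n.+1).+1) = lshift n.+1 (ord0 : 'I_n.+1) by exact: val_inj.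
  by congr (if _ then _ else _); rewrite -val_eqE -[RHS]val_eqE.
under eq_bigr => i _.
  rewrite eE cFB fibc_r psi'E; last exact: fr_e.
  rewrite mulrDr; over.
rewrite big_split /=; congr (_ + _); rewrite (bigD1 ord0)//= big1 ?addr0 ?li0 ?cp// => i i0.
by have /(vann_frame hG bc (a := acov y.1) (UH Ub)) -> := acovP y.1; rewrite ?mulr0.
Qed.

(** G/H has dimension one, so the Darboux form on its b-cotangent bundle has a single term, and in
    the charts [pibar] is the projection to coordinate 0 and the momentum. *)
Lemma pull_omega_frame V W y : bvf V -> bvf W -> fU FP y ->
  pull2 prP (pull2 pibar (omega_can GQ)) V W y =
  feps FP ord0 V y * feps FP p W y - feps FP ord0 W y * feps FP p V y.
Proof.
move=> bV bW Uy; have Ub := UP Uy; have [_ AQ hU e0 _] := bc.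
have Uq : fU FQ (base (pibar y.1)) by have [-> _] := hp y.1; exact: hU _ (UH Ub).
have [FB [[FFB _ _] UB can cFB _]] := liouville_canonical gQ AQ Uq.
have sp := pibar_smooth hG hp.
(* The coordinate of the annihilator that corresponds to the j-th coordinate of the target: base
   coordinate to coordinate 0, fibre coordinate to the value on e_0. *)
pose s (j : 'I_(0 + 1).+1) : 'I_(n + 1).+1 := if j == ord0 then ord0 else rshift n.+1 (ord0 : 'I_1).
have sn0 j : j != ord0 -> s j != ord0 by rewrite /s => /negbTE ->.
have e j : bnear y.1 (fun z => fc FH (s j) z = fc FB j (pibar z)).
  apply: bnearS (bnear_smooth (@tau_smooth R G C H) (fr_open FFG (UH Ub))) => z Uz.
  rewrite /s; case: eqP => [->|/eqP j0].
    rewrite -tau0 cFH /hannc fibc_l /= e0.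
    have -> : (ord0 : 'I_(0 + 1).+1) = lshift 1 (ord0 : 'I_1) by exact: val_inj.
    by rewrite cFB fibc_l /=; have [-> _] := hp z.
  have -> : j = rshift 1 (ord0 : 'I_1).
    by apply: val_inj; case: j j0 => -[|[]].
  by rewrite cFB fibc_r cFH /hannc fibc_r; apply/esym/(is_pibar_e hG bc hp Uz).
have key W1 W2 : bpush prP y V W1 -> bpush prP y W W2 -> pull2 pibar (omega_can GQ) W1 W2 y.1 =
    feps FP ord0 V y * feps FP p W y - feps FP ord0 W y * feps FP p V y.
  move=> h1 h2; have [_ b1] := bpush_bvf h1; have [_ b2] := bpush_bvf h2.
  have [Z1 z1] := push_over gH (@bcot_gclosed R GQ) sp FFH FFB (erefl : s ord0 = ord0) Ub UB e b1.
  have [Z2 z2] := push_over gH (@bcot_gclosed R GQ) sp FFH FFB (erefl : s ord0 = ord0) Ub UB e b2.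
  apply: (pull2_unique z1 z2) => Y1 Y2 y1 y2; have [_ c1] := bpush_bvf y1; have [_ c2] := bpush_bvf y2.
  have eps := eps_over gH sp FFH FFB (erefl : s ord0 = ord0) sn0 Ub UB e.
  have := darboux (@bcot_gclosed R GQ) liouville_GQ FFB can UB c1 c2; rewrite /omega_can => ->.
  rewrite big_ord1 !(eps _ _ _ y1) !(eps _ _ _ y2).
  have -> : s (lshift 1 (ord0 : 'I_1)) = ord0 by [].
  have -> : s (rshift 1 (ord0 : 'I_1)) = rshift n.+1 (ord0 : 'I_1) by [].
  rewrite !(eps_prP _ Uy h1) !(eps_prP _ Uy h2).
  by have -> : lshift n (ord0 : 'I_(n + 1).+1) = ord0 :> 'I_(n + 1 + n).+1 by exact: val_inj.
have [W1 h1 _] := push_prP Uy bV; have [W2 h2 _] := push_prP Uy bW.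
by apply: (pull2_unique h1 h2) => *; exact: key.
Qed.

End At.

Lemma chart_point (x : PS) : exists FG FQ FH E FP, [/\ @bundle_charts R G C H n FG FQ,
  [/\ adapted FH, fc FH = hannc FG & forall z, fU FH z -> fU FG (tau z)],
  [/\ adapted FP, fc FP = @fibc R HA PS prP (n + 1).+1 n (fc FH) (fun j y => ev y.2 (E j))
    & forall y, fU FP y -> fU FH y.1] & fU FP x].
Proof.
have [FG [FQ [bc Ub]]] := bundle_chart hG (tau x.1).
have [FH [AH Hx cH HU]] := hann_frame hG bc Ub.
have [E [FP [AP Px cP PU]]] := pspace_frame AH Hx.
by exists FG, FQ, FH, E, FP; split.
Qed.

Lemma lambda_theta_cinf V : bvf V -> cinf PS (lambda_theta theta V).
Proof.
move=> bV; apply: (cinf_local gP) => x.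
have [FG [FQ [FH [E [FP [bc [AH cH HU] [AP cP PU] Px]]]]]] := chart_point x.
have [[FFG _ _] _ _ _ _] := bc; have [FFP _ _] := AP.
have [E' [th [lE cth hth]]] := theta_coord hG ht.
exists (fun y => \sum_(i < n.+1) feps FP (lshift n (lshift 1 i : 'I_(n + 1).+1)) V y *
  ev y.2 (theta (fe FG i) (tau y.1))).
  apply: (cinf_sum gP) => i _; apply: (cinfM gP); first exact: fr_eps.
  have -> : (fun y : PS => ev y.2 (theta (fe FG i) (tau y.1))) =
      fun y => \sum_j th j (fe FG i) (tau y.1) * ev y.2 (E' j).
    by apply/funext => y; rewrite hth; [rewrite ev_tsum|exact: fr_e].
  apply: (cinf_sum gP) => j _; apply: (cinfM gP); last exact: ev_cinf.
  exact: (@prP_smooth R G C H _ (@tau_smooth R G C H _ (cth j _ (fr_e FFG i)))).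
by apply: bnearS (fr_open FFP Px) => y Uy; exact: (lambda_theta_frame bc AH cH HU AP cP PU).
Qed.

(** Minus d of [liouville_frame]: since eps_0 is closed, the first summand gives the form of
    [pull_omega_frame], and the second gives minus d of lambda^theta. *)
Lemma eq_omega_theta : eq_form2 (pull2 psi' (omega_can GS)) (omega_theta theta pibar).
Proof.
move=> V W bV bW; apply/funext => x.
have [FG [FQ [FH [E [FP [bc [AH cH HU] [AP cP PU] Px]]]]]] := chart_point x.
have [FFP _ _] := AP; have [fw _ _] := omega_can_symplectic.
have gB := @bcot_gclosed R GS.
rewrite (pull2_iso _ dpsi cpsi gP gB fw bV bW).
rewrite /omega_theta (pull_omega_frame bc AH cH HU AP cP PU bV bW Px).
rewrite /omega_can /d1 -(opush_lieb dpsi) !(opushE dpsi).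
pose p : 'I_(n + 1 + n).+1 := lshift n (rshift n.+1 (ord0 : 'I_1) : 'I_(n + 1).+1).
have VL V' W' : bvf V' -> bvf W' -> V' (@liouville R GS (opush psi' psi W') \o psi') x =
    V' (feps FP ord0 W') x * fc FP p x + feps FP ord0 W' x * feps FP p V' x
    + V' (lambda_theta theta W') x.
  move=> bV' bW'; have DV := bvf_pder x bV'.
  have ce := fr_eps FFP ord0 bW'; have cq := fr_c FFP p; have cl := lambda_theta_cinf bW'.
  have e : bnear x (fun y => (@liouville R GS (opush psi' psi W') \o psi') y =
      feps FP ord0 W' y * fc FP p y + lambda_theta theta W' y).
    by apply: bnearS (fr_open FFP Px) => y Uy; exact: (liouville_frame bc AH cH HU AP cP PU).
  have cm := cinfM gP ce cq; have cs := cinfD gP cm cl.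
  have cL : cinf PS (@liouville R GS (opush psi' psi W') \o psi').
    apply: (psi'_smooth hG ht).
    exact: (canonical_cinf (@bcot_gclosed R GS) liouville_GS (bvf_opush dpsi cpsi bW')).
  rewrite (pder_local gP DV cL cs e) (pderD DV cm cl) DV.2//; congr (_ + _ * _ + _).
  by rewrite (fr_Vc FFP p bV' Px) /rho /= mul1r.
rewrite !VL// (liouville_frame bc AH cH HU AP cP PU (bvf_lieb gP bV bW) Px).
rewrite (eps_lieb gP FFP _ bV bW Px) -/p; ring.
Qed.

End Identity.

(** * Reduction by H *)

Section Transport.
Context {R : realType}.

(** The data u, c_i, Y_i witnessing the relation are transported along with the fields. Applied to
    the bundle projection and the lifted action, this yields invariance of the Liouville form. *)
Lemma bpush_natural (M N : bspace R) (h : M -> N) (f f' : M -> M) (k k' : N -> N) x V W :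
  diffeo f f' -> (forall x, crit M (f x) <-> crit M x) ->
  diffeo k k' -> (forall y, crit N (k y) <-> crit N y) ->
  (forall x, h (f x) = k (h x)) ->
  bpush h x V W -> bpush h (f x) (opush f f' V) (opush k k' W).
Proof.
move=> df cf dk ck e [bV bW [u [m [c [Y [[cu ux] hc bY hf]]]]]].
have [sf sf' fK fK'] := df; have [sk sk' kK kK'] := dk.
have e' y : h (f' y) = k' (h y) by rewrite -{2}(fK' y) e kK.
split; [exact: bvf_opush|exact: bvf_opush|].
exists (u \o f'), m, (fun i => c i \o f'), (fun i => opush k k' (Y i)); split.
- by split; [exact: sf'|rewrite /= fK].
- by move=> i; have [h1 h2] := hc i; split; [exact: sf'|rewrite /= fK].
- by move=> i; exact: bvf_opush.
move=> q cq y; have := hf _ (sk _ cq) (f' y).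
rewrite /opush /= e'.
have -> : (q \o h) \o f = (q \o k) \o h by apply/funext => z /=; rewrite e.
by move=> ->; congr (_ + _); apply: eq_bigr => i _; rewrite e'.
Qed.

Lemma opushK (M N : bspace R) (h : M -> N) (h' : N -> M) (V : op N) :
  diffeo h h' -> opush h h' (opush h' h V) = V.
Proof.
move=> [_ _ hK hK']; apply/funext => f; apply/funext => y; rewrite /opush hK'.
by congr (V _ y); apply/funext => z /=; rewrite hK'.
Qed.

Lemma poisson_transport (M N : bspace R) (h : M -> N) (h' : N -> M) (br : bracket N) :
  diffeo h h' -> poisson br -> poisson (pull_bracket h h' br).
Proof.
move=> [sh sh' hK hK'] [b1 b2 b3 b4 b5].
have E (f : N -> R) : (f \o h) \o h' = f by apply/funext => y; rewrite /= hK'.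
split=> [f g cf cg|a f g k cf cg ck|f g cf cg|f g k cf cg ck|f g k cf cg ck x].
- by apply: sh; apply: b1; exact: sh'.
- by apply/funext => x; have := b2 a _ _ _ (sh' _ cf) (sh' _ cg) (sh' _ ck) => /(congr1 (fun q => q (h x))).
- by apply/funext => x; have := b3 _ _ (sh' _ cf) (sh' _ cg) => /(congr1 (fun q => q (h x))).
- apply/funext => x; have := b4 _ _ _ (sh' _ cf) (sh' _ cg) (sh' _ ck) => /(congr1 (fun q => q (h x))).
  by rewrite /pull_bracket /= hK.
- by rewrite /pull_bracket !E; apply: b5; exact: sh'.
Qed.

Section Form.
Variables (M N : bspace R) (gM : gclosed M) (gN : gclosed N) (h : M -> N) (h' : N -> M).
Hypotheses (dh : diffeo h h') (ch : forall x, crit N (h x) <-> crit M x).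
Variables (w : form2 M) (w' : form2 N).
Hypothesis sw : bsymplectic w.
Hypothesis ww : eq_form2 (pull2 h' w) w'.
Let dh' : diffeo h' h := diffeo_sym dh.
Let ch' y : crit M (h' y) <-> crit N y := crit_sym dh ch y.
Notation pl := (opush h' h).

Let wE V W : bvf V -> bvf W -> w' V W = w (pl V) (pl W) \o h'.
Proof.
move=> bV bW; rewrite -ww//; apply/funext => y.
by rewrite (pull2_iso _ dh' ch' gN gM)//; case: sw.
Qed.

Let bp V : bvf V -> bvf (pl V). Proof. by move=> bV; exact: (bvf_opush dh' ch' bV). Qed.

Let plE V f y : pl V f (h' y) = V (f \o h') y. Proof. exact: opushE dh' V f y. Qed.

Lemma symplectic_transport : bsymplectic w'.
Proof.
have [[w1 w2 w3] dw nd] := sw; have [sh sh' hK hK'] := dh.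
split.
- split=> [V W bV bW|V W bV bW|f V V' W cf bV bV' bW].
  + by rewrite wE//; apply: sh'; apply: w1; exact: bp.
  + rewrite !wE//; apply/funext => y /=.
    by have := w2 _ _ (bp bV) (bp bW) => /(congr1 (fun q => q (h' y))).
  + rewrite !wE//; last exact: bvf_comb.
    apply/funext => y /=; rewrite opush_comb.
    have := w3 _ _ _ _ (sh _ cf) (bp bV) (bp bV') (bp bW) => /(congr1 (fun q => q (h' y))) ->.
    by rewrite /= hK'.
- move=> V1 V2 V3 b1 b2 b3; apply/funext => y.
  have := dw _ _ _ (bp b1) (bp b2) (bp b3) => /(congr1 (fun q => q (h' y))).
  rewrite /d2 !wE//; try exact: bvf_lieb.
  by rewrite -!(opush_lieb dh') !plE.
- move=> p V bV h0 a ap.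
  (* Nondegeneracy is tested by covectors, so a is first pulled back to a covector on M. *)
  have ca : is_covec (h' p) (fun Z => if `[< bvf Z >] then cv a (opush h h' Z) else 0).
    have [aD _] := covecP a.
    split=> [f Z Z' cf bZ bZ'|Z /asboolPn/negbTE -> //].
    rewrite !asboolT//; last exact: bvf_comb.
    rewrite opush_comb aD; [by rewrite ap|exact: sh'|exact: bvf_opush|exact: bvf_opush].
  have := nd (h' p) (pl V) (bp bV) _ (Covec ca) erefl.
  rewrite /= asboolT; last exact: bp.
  rewrite opushK//; apply=> W bW.
  have bW' := bvf_opush dh ch bW; have := h0 _ bW'; rewrite wE// /= => <-.
  by rewrite (opushK _ dh').
Qed.

Lemma dual_transport br : dual_poisson w br -> dual_poisson w' (pull_bracket h' h br).
Proof.
move=> db f g cf cg; have [sh sh' hK hK'] := dh.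
have [X [Y [bX bY hX hY e]]] := db _ _ (sh _ cf) (sh _ cg).
have pX : pl (opush h h' X) = X by exact: opushK dh'.
have pY : pl (opush h h' Y) = Y by exact: opushK dh'.
have E (q : N -> R) : (q \o h) \o h' = q by apply/funext => y; rewrite /= hK'.
exists (opush h h' X), (opush h h' Y).
have bX' := bvf_opush dh ch bX; have bY' := bvf_opush dh ch bY.
split=> // [V bV|V bV|].
- by rewrite wE// pX hX; [apply/funext => y; rewrite /= plE E|exact: bp].
- by rewrite wE// pY hY; [apply/funext => y; rewrite /= plE E|exact: bp].
- by rewrite wE// pX pY /pull_bracket e.
Qed.

End Form.

(** Functions on the quotient are smooth when their pull-backs are, so the bracket can be evaluated
    at chosen representatives; invariance removes the choice and the axioms are inherited from M. *)
Lemma quotient_poisson (M : bspace R) (E : M -> M -> Prop) (br : bracket M) :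
  poisson br ->
  (forall f g x y, cinf (quotspace E) f -> cinf (quotspace E) g -> E x y ->
     br (f \o (qmap E : M -> quotspace E)) (g \o (qmap E : M -> quotspace E)) x = br (f \o (qmap E : M -> quotspace E)) (g \o (qmap E : M -> quotspace E)) y) ->
  (forall x, E x x) ->
  exists2 brQ : bracket (quotspace E), poisson brQ & @poisson_map R M (quotspace E) (qmap E) br brQ.
Proof.
move=> [b1 b2 b3 b4 b5] inv Er.
have /choice[r hr] := @qmap_surj R M E.
pose brQ : bracket (quotspace E) := fun f g q => br (f \o (qmap E : M -> quotspace E)) (g \o (qmap E : M -> quotspace E)) (r q).
have bE f g : cinf (quotspace E) f -> cinf (quotspace E) g ->
    brQ f g \o (qmap E : M -> quotspace E) = br (f \o (qmap E : M -> quotspace E)) (g \o (qmap E : M -> quotspace E)).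
  move=> cf cg; apply/funext => x; rewrite /brQ /=; apply: inv => //.
  exact: qmap_inj (hr _).
exists brQ; last by move=> f g cf cg; rewrite bE.
split=> [f g cf cg|a f g k cf cg ck|f g cf cg|f g k cf cg ck|f g k cf cg ck q].
- by rewrite -[cinf _ _]/(cinf M (brQ f g \o (qmap E : M -> quotspace E))) bE//; exact: b1.
- by apply/funext => q; have := b2 a _ _ _ cf cg ck => /(congr1 (fun F => F (r q))).
- by apply/funext => q; have := b3 _ _ cf cg => /(congr1 (fun F => F (r q))).
- apply/funext => q; have := b4 _ _ _ cf cg ck => /(congr1 (fun F => F (r q))).
  by rewrite /brQ /= hr.
- by rewrite /brQ -/(brQ g k) -/(brQ k f) -/(brQ f g) !bE//; exact: b5.
Qed.

End Transport.

(** * The lifted action of H and its orbit spaces *)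

Section Action.
Context {R : realType}.
Variables (G : groupType) (C : set (G -> R)) (H : set G) (n : nat).
Hypothesis hG : blie_group C H n.
Notation GS := (gspace C H).
Notation TS := (bcot GS).
Notation PS := (Pspace C H).
Notation TS_orb := (@Defs.orbT R G C H).
Let gG : gclosed GS := G_gclosed hG.
Let gT : gclosed TS := @bcot_gclosed R GS.

Lemma Lpush_mul k l (V : op GS) : Lpush k (Lpush l V) = Lpush (k * l)%g V.
Proof.
apply/funext => f; apply/funext => x; rewrite /Lpush invgM !mulgA.
by congr (V _ _); apply/funext => y; rewrite mulgA.
Qed.

Lemma Lpush_1 (V : op GS) : Lpush 1%g V = V.
Proof.
apply/funext => f; apply/funext => x; rewrite /Lpush invg1 mul1g.
by congr (V _ _); apply/funext => y; rewrite mul1g.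
Qed.

Lemma Ad_mul k l (X : @tvec R G) : Ad k (Ad l X) = Ad (k * l)%g X.
Proof.
by apply/funext => f; rewrite /Ad; congr X; apply/funext => y; rewrite invgM !mulgA.
Qed.

Lemma Ad_1 (X : @tvec R G) : Ad 1%g X = X.
Proof. by apply/funext => f; rewrite /Ad; congr X; apply/funext => y; rewrite invg1 mulg1 mul1g. Qed.

Lemma lmul_diffeo h : diffeo (fun x : GS => (h * x)%g : GS) (fun x : GS => (h^-1 * x)%g : GS).
Proof. by split; [exact: (lmulS hG)|exact: (lmulS hG)|exact: mulKg|exact: mulVKg]. Qed.

Lemma lmul_crit h : H h -> forall x : GS, crit GS (h * x)%g <-> crit GS x.
Proof. by move=> hh x; split=> [/(HMl hG hh)|/(HM hG hh)]. Qed.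

Lemma bvf_Lpush h (V : op GS) : H h -> bvf V -> bvf (Lpush h V).
Proof. by move=> hh; exact: (bvf_opush (lmul_diffeo h) (lmul_crit hh)). Qed.

Lemma zeta_Ad h X : zeta (Ad h X) = Lpush h (zeta X) :> op GS.
Proof.
apply/funext => f; apply/funext => x; rewrite /zeta /Ad /Lpush; congr X.
by apply/funext => y; rewrite !mulgA.
Qed.

Lemma Ad_lie h X : H h -> lieH C H X -> lieH C H (Ad h X).
Proof.
move=> hh [lD lM lN lH].
have cj f : C f -> C (fun k => f (h * k * h^-1)%g).
  by move=> cf; exact: (lmulS hG h (rmulS hG h^-1%g cf)).
split=> [a f g cf cg|f g cf cg|f nf|f cf f0]; rewrite /Ad.
- by rewrite lD//; exact: cj.
- by rewrite lM ?mulg1 ?mulgV//; exact: cj.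
- rewrite lN// => cf; apply: nf.
  have := lmulS hG h^-1%g (rmulS hG h cf); congr (cinf GS _); apply/funext => k /=.
  by rewrite !mulgA mulgV mul1g mulgK.
- rewrite lH//; first exact: cj.
  by move=> k hk; apply: f0; apply: (HM hG); [exact: (HM hG)|exact: (HV hG)].
Qed.

Lemma lactP h (a : TS) : H h -> @is_covec R GS (h * base a)%g (fun V => cv a (Lpush h^-1%g V)).
Proof.
move=> hh; have [aD a0] := covecP a; split=> [f V W cf bV bW|V nV].
  have := opush_comb (fun x : GS => (h^-1 * x)%g : GS) (fun x : GS => (h^-1^-1 * x)%g : GS) f V W.
  rewrite -[LHS]/(Lpush h^-1%g (op_comb f V W)) => ->.
  rewrite aD; first by rewrite /Lpush /opush /= !invgK.
  - by have [_ s _ _] := lmul_diffeo h^-1%g; exact: s.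
  - exact: (bvf_Lpush (HV hG hh)).
  - exact: (bvf_Lpush (HV hG hh)).
by apply: a0 => /(bvf_Lpush hh); rewrite Lpush_mul mulgV Lpush_1.
Qed.

Definition lact h (hh : H h) (a : TS) : TS := Covec (lactP a hh).

Lemma lact_cact h (hh : H h) a : cact h a (lact hh a).
Proof. by []. Qed.

Lemma cact_lact h (hh : H h) a a' : cact h a a' -> a' = lact hh a.
Proof. by move=> [e1 e2]; apply: covec_eq. Qed.

Lemma lact_smooth h (hh : H h) : smooth_map (lact hh).
Proof.
apply: (bcot_smooth gT); first exact: (smooth_map_comp (@base_smooth R GS) (lmulS hG h)).
by move=> V bV; apply: cv_smooth; exact: (bvf_Lpush (HV hG hh)).
Qed.

Lemma cact_1 a : cact (C := C) (H := H) 1%g a a.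
Proof. by split=> [|V]; rewrite ?mul1g// invg1 Lpush_1. Qed.

Lemma cact_V h a a' : cact (C := C) (H := H) h a a' -> cact h^-1%g a' a.
Proof.
by move=> [e1 e2]; split=> [|V]; rewrite ?e1 ?mulKg// e2 Lpush_mul invgK mulVg Lpush_1.
Qed.

Lemma cact_M h k a b c : cact (C := C) (H := H) h a b -> cact k b c -> cact (k * h)%g a c.
Proof.
move=> [e1 e2] [f1 f2]; split=> [|V]; first by rewrite f1 e1 mulgA.
by rewrite f2 e2 Lpush_mul -invgM.
Qed.

Lemma lact_diffeo h (hh : H h) : diffeo (lact hh) (lact (HV hG hh)).
Proof.
split; [exact: lact_smooth|exact: lact_smooth| |] => a.
  exact/esym/cact_lact/cact_V/lact_cact.
apply/esym/cact_lact; have := cact_V (lact_cact (HV hG hh) a); by rewrite invgK.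
Qed.

Lemma lact_crit h (hh : H h) a : crit TS (lact hh a) <-> crit TS a.
Proof. exact: (lmul_crit hh). Qed.

(** The bundle projection intertwines the lifted action with left translation, so [bpush_natural]
    identifies the two sets of candidate values; no uniqueness of the value is involved. *)
Lemma liouville_lact h (hh : H h) V a :
  @liouville R GS (opush (lact hh) (lact (HV hG hh)) V) (lact hh a) = @liouville R GS V a.
Proof.
rewrite /liouville; congr xget; apply/seteqP; split=> r [W hW ->].
  exists (Lpush h^-1%g W); last by [].
  have := bpush_natural (lact_diffeo (HV hG hh)) (lact_crit (HV hG hh)) (lmul_diffeo h^-1%g)
    (lmul_crit (HV hG hh)) (fun=> erefl) hW.
  have [_ _ lK _] := lact_diffeo hh; rewrite lK.
  congr (bpush _ _ _ _); apply/funext => f; apply/funext => b; rewrite /opush.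
  (* The reverse inclusion uses the action of h^-1, whose inverse is indexed by (h^-1)^-1 and has to
     be identified with the action of h. *)
  have e c : lact (HV hG hh) (lact (HV hG (HV hG hh)) c) = c.
    by have [_ _ _ ->] := lact_diffeo (HV hG hh).
  rewrite e; congr (V _ b); apply/funext => c /=; congr f; exact: lK.
exists (Lpush h W).
  exact: (bpush_natural (lact_diffeo hh) (lact_crit hh) (lmul_diffeo h) (lmul_crit hh) (fun=> erefl) hW).
by rewrite /= Lpush_mul mulVg Lpush_1.
Qed.

Lemma omega_lact h (hh : H h) V W a :
  omega_can GS (opush (lact hh) (lact (HV hG hh)) V) (opush (lact hh) (lact (HV hG hh)) W) (lact hh a) =
  omega_can GS V W a.
Proof.
have dl := lact_diffeo hh.
rewrite /omega_can /d1 -(opush_lieb dl) !(opushE dl) liouville_lact.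
have e Z : @liouville R GS (opush (lact hh) (lact (HV hG hh)) Z) \o lact hh = @liouville R GS Z.
  by apply/funext => b; rewrite /= liouville_lact.
by rewrite !e.
Qed.

(** [bracket_iso] for the symmetry [lact] of the canonical form; invariance of f and g absorbs the
    pull-backs. *)
Lemma cact_bracket br f g h a a' : dual_poisson (omega_can GS) br ->
  cinf TS f -> cinf TS g -> (forall k b b', H k -> cact k b b' -> f b = f b' /\ g b = g b') ->
  H h -> cact h a a' -> br f g a = br f g a'.
Proof.
move=> db cf cg inv hh /(cact_lact hh) ->.
have := bracket_iso gT (lact_diffeo hh) (lact_crit hh) (fun V W x _ _ => omega_lact hh V W x)
  (omega_can_symplectic hG) db db cf cg => /(congr1 (fun q => q a)) /= <-.
by congr (br _ _ a); apply/funext => b /=; have [] := inv h b _ hh (lact_cact hh b).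
Qed.

Lemma orbT_refl (a : TS) : TS_orb a a.
Proof. by exists 1%g; [exact: H1 hG|exact: cact_1]. Qed.

Lemma orbT_sym (a b : TS) : TS_orb a b -> TS_orb b a.
Proof. by move=> [h hh /cact_V ac]; exists h^-1%g => //; exact: HV hG _ hh. Qed.

Lemma orbT_trans (a b c : TS) : TS_orb a b -> TS_orb b c -> TS_orb a c.
Proof. by move=> [h hh ab] [k hk bc]; exists (k * h)%g; [exact: HM hG _ _ hk hh|exact: cact_M ab bc]. Qed.

Variable theta : hform1 C H.
Hypothesis ht : bconnection theta.
Notation psi := (psi hG ht).
Notation psi' := (psi' hG ht).

Lemma theta_Lpush h V g : H h -> bvf V -> theta (Lpush h V) (h * g)%g = Ad h (theta V g).
Proof. by case: ht => _ _ _ _; exact. Qed.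

(** Equivariance of theta moves the translation into Ad, and [zeta_Ad] moves it back. Off the
    b-vector fields and off the Lie algebra both sides are 0 by convention, which the translations
    preserve. *)
Lemma psi_equivariant h a a' : H h -> cact h a a' -> pact h (psi a) (psi a').
Proof.
move=> hh [e1 e2]; have [p1 p2 p3] := psi_is hG ht a; have [q1 q2 q3] := psi_is hG ht a'.
have hV := HV hG hh.
split; first (split; first by rewrite q1 e1 p1).
  move=> V; have [bV|nV] := pselect (bvf V); last first.
    rewrite (covecP _).2// (covecP _).2// => /(bvf_Lpush hh).
    by rewrite Lpush_mul mulgV Lpush_1.
  have bL := bvf_Lpush hV bV.
  rewrite q2// p2// !e2 -zeta_Ad; congr (_ - cv a (zeta _)).
  by rewrite -theta_Lpush// e1 mulKg.
move=> X; have [lX|nX] := pselect (lieH C H X).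
  by rewrite q3// p3; [rewrite e2 zeta_Ad|exact: Ad_lie].
rewrite (evP _).2// (evP _).2// => /(Ad_lie hh).
by rewrite Ad_mul mulgV Ad_1.
Qed.

Lemma pact_unique h x y y' : pact (C := C) (H := H) h x y -> pact h x y' -> y = y'.
Proof.
move=> [[b1 c1] e1] [[b2 c2] e2].
rewrite [y]surjective_pairing [y']surjective_pairing; congr pair.
  by apply: acov_inj; apply: covec_eq => [|V bV]; rewrite /acov ?b1 ?b2// c1 c2.
by apply: dualH_eq => X _; rewrite e1 e2.
Qed.

(** Equivariance passes to the inverse map because [pact] determines its target. *)
Lemma pact_cact h x y : H h -> pact h x y -> cact h (psi' x) (psi' y).
Proof.
move=> hh xy; have := psi_equivariant hh (lact_cact hh (psi' x)).
rewrite psi'K => /(pact_unique xy) ->; rewrite psiK; exact: lact_cact.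
Qed.

Lemma orbP_psi x y : orbP x y <-> TS_orb (psi' x) (psi' y).
Proof.
split=> [[h hh xy]|[h hh /(psi_equivariant hh)]]; first by exists h => //; exact: pact_cact.
by rewrite !psi'K; exists h.
Qed.

Lemma orbT_psi a b : TS_orb a b <-> orbP (psi a) (psi b).
Proof. by rewrite orbP_psi !psiK. Qed.

Lemma orbP_refl (x : PS) : orbP x x.
Proof. by apply/orbP_psi; exact: orbT_refl. Qed.

Lemma orbP_sym (x y : PS) : orbP x y -> orbP y x.
Proof. by move=> /orbP_psi/orbT_sym/orbP_psi. Qed.

Lemma orbP_trans (x y z : PS) : orbP x y -> orbP y z -> orbP x z.
Proof. by move=> /orbP_psi xy /orbP_psi yz; apply/orbP_psi; exact: orbT_trans xy yz. Qed.

Notation qT := (@qT R G C H).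
Notation qP := (@qP R G C H).

Lemma qT_psi a b : qT a = qT b <-> qP (psi a) = qP (psi b).
Proof.
split=> [/(qmap_inj orbT_refl)/orbT_psi ab|/(qmap_inj orbP_refl)/orbT_psi ab].
  exact: qmap_eq orbP_sym orbP_trans _ _ ab.
exact: qmap_eq orbT_sym orbT_trans _ _ ab.
Qed.

Lemma quotient_psi : exists (Psi : TmodH C H -> coadj_bundle C H) (Psi' : coadj_bundle C H -> TmodH C H),
  diffeo Psi Psi' /\ forall a, Psi (qT a) = qP (psi a).
Proof.
have /choice[r hr] : forall q : TmodH C H, exists a, qT a = q by exact: qmap_surj.
have /choice[r' hr'] : forall q : coadj_bundle C H, exists x, qP x = q by exact: qmap_surj.
pose Psi q := qP (psi (r q)); pose Psi' q := qT (psi' (r' q)).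
have E a : Psi (qT a) = qP (psi a) by apply/qT_psi; rewrite hr.
have E' x : Psi' (qP x) = qT (psi' x) by apply/qT_psi; rewrite !psi'K hr'.
have [s s' _ _] := psi_diffeo hG ht.
exists Psi, Psi'; split=> //; split.
- apply: quot_smooth => f cf; rewrite -[X in cinf _ X]/(fun x => f (Psi (qT x))).
  by under eq_fun do rewrite E; exact: (s _ cf).
- apply: quot_smooth => f cf; rewrite -[X in cinf _ X]/(fun x => f (Psi' (qP x))).
  by under eq_fun do rewrite E'; exact: (s' _ cf).
- by move=> q; rewrite -(hr q) E E' psiK.
- by move=> q; rewrite -(hr' q) E' E psi'K.
Qed.

End Action.

Theorem theorem19 (R : realType) (n : nat) (G : groupType)
    (C : set (G -> R)) (H : set G) (theta : hform1 C H)
    (hG : blie_group C H n) (htheta : bconnection theta) :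
  exists (pibar : Hann C H -> bcot (GmodH C H))
         (psi : bcot (gspace C H) -> Pspace C H)
         (psi' : Pspace C H -> bcot (gspace C H)),
  [/\ is_pibar pibar,
      is_psi theta psi,
      diffeo psi psi',
      forall h a a', H h -> cact h a a' -> pact h (psi a) (psi a')
    & eq_form2 (pull2 psi' (omega_can (gspace C H)))
               (omega_theta theta pibar) /\
      bsymplectic (omega_theta theta pibar) /\
      exists (brP : bracket (Pspace C H)) (brQ : bracket (coadj_bundle C H)),
      [/\ dual_poisson (omega_theta theta pibar) brP,
          poisson brP,
          poisson brQ,
          poisson_map (@qP R G C H) brP brQ
        & exists (Psi : TmodH C H -> coadj_bundle C H)
                 (Psi' : coadj_bundle C H -> TmodH C H),
          [/\ diffeo Psi Psi',
              forall a, Psi (qT a) = qP (psi a)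
            & poisson (pull_bracket Psi Psi' brQ)]]].
Proof.
have [pibar hp] := pibar_exists hG.
exists pibar, (psi hG htheta), (psi' hG htheta).
have dpsi := psi_diffeo hG htheta; have cpsi := psi_crit hG htheta.
have gT := @bcot_gclosed R (gspace C H); have gP := @P_gclosed R G C H.
have ww := eq_omega_theta hG htheta hp.
have sw := omega_can_symplectic hG.
(* The bracket is made on the b-cotangent bundle, where the action is a symmetry of the canonical
   form; the one on the product is its transport by [psi]. *)
pose brT := hbr gT sw (canonical_ham gT (liouville_GS hG)).
have dT : dual_poisson (omega_can _) brT := hbr_dual gT sw _.
have pT : poisson brT := hbr_poisson gT sw _.
split=> //; [exact: psi_is|by move=> h a a'; exact: psi_equivariant|split=> //; split].
  exact: (symplectic_transport gT gP dpsi cpsi sw ww).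
have pP := poisson_transport (diffeo_sym dpsi) pT.
have [brQ pQ mQ] : exists2 brQ : bracket (coadj_bundle C H), poisson brQ &
    poisson_map (@qP R G C H) (pull_bracket (psi' hG htheta) (psi hG htheta) brT) brQ.
  apply: (quotient_poisson pP) => [f g x y cf cg [h hh xy]|]; last exact: (orbP_refl hG htheta).
  have [s _ _ _] := dpsi.
  have cF : cinf (bcot (gspace C H)) ((f \o @qP R G C H) \o psi hG htheta) := s _ cf.
  have cF' : cinf (bcot (gspace C H)) ((g \o @qP R G C H) \o psi hG htheta) := s _ cg.
  have pc : cact h (psi' hG htheta x) (psi' hG htheta y) by exact: pact_cact.
  (* Functions pulled back from the orbit space of the product are invariant upstairs, since [psi]
     sends orbits to orbits. *)
  apply: (cact_bracket hG dT cF cF' _ hh pc) => k b b' hk bb'.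
  have e : qP (psi hG htheta b) = qP (psi hG htheta b').
    apply/(qT_psi hG htheta); apply: qmap_eq; [exact: (orbT_sym hG)|exact: (orbT_trans hG)|].
    by exists k.
  by rewrite /= e.
have [Psi [Psi' [dP hP]]] := quotient_psi hG htheta.
exists (pull_bracket (psi' hG htheta) (psi hG htheta) brT), brQ; split=> //.
  exact: (dual_transport gT gP dpsi cpsi sw ww dT).
by exists Psi, Psi'; split=> //; exact: poisson_transport.
Qed.
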